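(* There exists an absolute constant $C>0$ such that the following holds. Let $n\ge 1$ and let $(\xi_i,\mathcal{F}_i)_{i=0,\dots,n}$ be a sequence of martingale differences on a probability space $(\Omega,\mathcal{F},\mathbf{P})$, with $\xi_0=0$ and $\{\emptyset,\Omega\}=\mathcal{F}_0\subseteq\dots\subseteq\mathcal{F}_n\subseteq\mathcal{F}$. Let $S_n=\sum_{i=1}^n\xi_i$ and $\langle S\rangle_n=\sum_{i=1}^n\mathbf{E}[\xi_i^2|\mathcal{F}_{i-1}]$. Assume: (A1) there is a number $\epsilon\in(0,1/2]$ such that $\big|\mathbf{E}[\xi_i^k|\mathcal{F}_{i-1}]\big|\le \frac12 k!\,\epsilon^{k-2}\,\mathbf{E}[\xi_i^2|\mathcal{F}_{i-1}]$ a.s. for all integers $k\ge 2$ and all $1\le i\le n$; (A2) there is a number $\delta\in[0,1]$ such that $|\langle S\rangle_n-1|\le\delta^2$ a.s. Then, for all $x\in\mathbf{R}$, $$\big|\mathbf{P}(S_n\le x)-\Phi(x)\big|\le C\,(1+x^2)\Big(\epsilon|\log\epsilon|+\frac{\delta}{1+|x|}\Big)\exp\Big\{-\frac{\widehat{x}^2}{2}\Big\},$$ where $$\widehat{x}=\frac{2|x|/\sqrt{1+\delta^2}}{1+\sqrt{1+2|x|\epsilon/(1+\delta^2)}}.$$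
   Context: $\Phi$ is the standard normal distribution function. Martingale differences: $\xi_i$ is $\mathcal{F}_i$-measurable, integrable and $\mathbf{E}[\xi_i|\mathcal{F}_{i-1}]=0$ a.s. for $1\le i\le n$ (here with moments of all orders). ''Absolute constant'' means $C$ depends on nothing (not on $n$, the martingale, $\epsilon$, $\delta$ or $x$). *)

(* Defs.v *)
From HB Require Import structures.
From mathcomp Require Import all_boot all_order all_algebra.
From mathcomp Require Import all_classical all_reals all_analysis.
From mathcomp Require Import measurable_realfun.
Set Implicit Arguments.
Unset Strict Implicit.
Unset Printing Implicit Defensive.
Import Order.TTheory GRing.Theory Num.Theory.
Import numFieldNormedType.Exports.
Local Open Scope classical_set_scope.
Local Open Scope ring_scope.

Section conditional_expectation.
Context d (T : measurableType d) (R : realType).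
Implicit Types (P : probability T R) (G : set (set T)) (X Y : T -> R).

Definition measurable_wrt G Y : Prop :=
  forall B : set R, measurable B -> G (Y @^-1` B).

(* Y is a version of E[X | G]. *)
Definition is_cond_exp P G X Y : Prop :=
  [/\ measurable_wrt G Y,
      P.-integrable setT (EFin \o Y) &
      forall A, G A ->
        (\int[P]_(w in A) (Y w)%:E = \int[P]_(w in A) (X w)%:E)%E].

(* A chosen version of E[X | G]; the default value 0 is never used when X is
   integrable and G is a sub-sigma-algebra (lemma [cond_expP]), and the choice
   of the version is irrelevant up to a null set (lemma [is_cond_exp_ae_eq]). *)
Definition cond_exp P G X : T -> R := xget (cst 0) (is_cond_exp P G X).

Section sub_sigma_algebra.
Variables (P : probability T R) (G : set (set T)).
Hypotheses (sG : sigma_algebra setT G) (Gm : G `<=` measurable).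

Let TG := g_sigma_algebraType G.
Let phi : T -> TG := id.

Let mGE : @measurable _ TG = G.
Proof. exact: measurable_g_measurableTypeE. Qed.

Let mphi : measurable_fun [set: T] phi.
Proof. by move=> _ A; rewrite mGE => GA; rewrite setTI; exact: Gm. Qed.

HB.instance Definition _ := isMeasurableFun.Build _ _ _ _ phi mphi.

Let phiRV : {RV P >-> TG} := phi.
Let Q : probability TG R := distribution P phiRV.

Lemma cond_expP X : P.-integrable setT (EFin \o X) ->
  is_cond_exp P G X (cond_exp P G X).
Proof.
move=> iX; rewrite /cond_exp; apply: (@xgetPex _ (cst 0) (is_cond_exp P G X)).
have mX := measurable_int _ iX.
pose nu0 : {charge set T -> \bar R} := induced_charge iX.
have dom : nu0 `<< P.
  apply/null_content_dominatesP => /= A mA PA.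
  rewrite /induced_charge; apply: null_set_integral => //.
  exact: measurable_funS mX.
pose nu : {charge set TG -> \bar R} :=
  measure_function_pushforward__canonical__charge_Charge nu0 mphi.
have domQ : nu `<< Q by exact: dominates_pushforward.
pose f : TG -> \bar R := Radon_Nikodym nu Q.
have ffin w : f w \is a fin_num by exact: Radon_Nikodym_fin_num.
have fint : Q.-integrable setT f by exact: Radon_Nikodym_integrable.
have mf := measurable_int _ fint.
have fineE : EFin \o (fine \o f) = f by apply/funext => w /=; rewrite fineK.
have iPf : P.-integrable setT f.
  apply/integrableP; split.
    by move=> _ B mB; have := mf measurableT B mB; rewrite !setTI mGE; exact: Gm.
  have /integrableP[_] := fint.
  rewrite (@ge0_integral_pushforward _ _ _ _ _ phi mphi)//.
  by have /= := measurable_int _ (integrable_abse fint).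
exists (fine \o f : T -> R); split.
- move=> B mB; rewrite -mGE.
  have := mf; rewrite -fineE.
  by move=> /measurable_EFinP/(_ measurableT B mB); rewrite setTI.
- by rewrite fineE.
- move=> A GA; under eq_integral do rewrite /= fineK//.
  have mA : @measurable _ TG A by rewrite mGE.
  have -> : (\int[P]_(w in A) (X w)%:E = nu A)%E by [].
  rewrite (Radon_Nikodym_integral domQ mA) /Q.
  rewrite (@integral_pushforward _ _ _ _ _ phi mphi)//.
  by apply: integrableS iPf => //; exact: Gm.
Qed.

Lemma is_cond_exp_ae_eq X Y Z :
  is_cond_exp P G X Y -> is_cond_exp P G X Z -> {ae P, forall w, Y w = Z w}.
Proof.
move=> [mY iY YE] [mZ iZ ZE].
have mfun V : measurable_wrt G V -> measurable_fun [set: TG] (EFin \o V : TG -> _).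
  move=> mV; apply/measurable_EFinP => _ B mB.
  by rewrite setTI mGE; exact: mV.
have iQ V : measurable_wrt G V -> P.-integrable setT (EFin \o V) ->
    Q.-integrable setT (EFin \o V : TG -> _).
  by move=> mV iV; apply: integrable_pushforward => //; exact: mfun.
have IQ V A : measurable_wrt G V -> P.-integrable setT (EFin \o V) -> G A ->
    (\int[Q]_(w in A) (V w)%:E = \int[P]_(w in A) (V w)%:E)%E.
  move=> mV iV GA; rewrite /Q (@integral_pushforward _ _ _ _ _ phi mphi)//.
  - exact: mfun.
  - by apply: integrableS iV => //; exact: Gm.
  - by rewrite mGE.
have : ae_eq Q setT (EFin \o Y) (EFin \o Z).
  apply: integral_ae_eq => //; [exact: iQ|exact: mfun|].
  by move=> E _; rewrite mGE => GE; rewrite !IQ// YE// ZE.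
case=> N [mN QN0 subN]; exists N; split => //.
  by apply: Gm; rewrite -mGE.
move=> w /= YZ; apply: subN => /= /(_ I) [] ?; exact: YZ.
Qed.

End sub_sigma_algebra.
End conditional_expectation.

Section martingale.
Context d (T : measurableType d) (R : realType).
Implicit Types (P : probability T R) (n : nat).
Implicit Types (F : nat -> set (set T)) (xi : nat -> T -> R).

(* (xi_i, F_i)_{i = 0, ..., n}; the values of F and xi beyond n are
   irrelevant. *)
Record martingale_differences P n F xi : Prop := {
  md_sigma_algebra : forall i, (i <= n)%N ->
    sigma_algebra setT (F i) /\ F i `<=` measurable;
  md_trivial0 : F 0%N = [set set0; setT];
  md_filtration : forall i, (i < n)%N -> F i `<=` F i.+1;
  md_adapted : forall i, (i <= n)%N -> measurable_wrt (F i) (xi i);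
  md_integrable : forall i, (i <= n)%N -> P.-integrable setT (EFin \o xi i);
  md_null0 : forall w, xi 0%N w = 0;
  md_cond_exp0 : forall i, (1 <= i <= n)%N ->
    {ae P, forall w, cond_exp P (F i.-1) (xi i) w = 0} }.

(* S_n *)
Definition mart_sum xi n (w : T) : R := \sum_(1 <= i < n.+1) xi i w.

(* E[xi_i^k | F_{i-1}] *)
Definition cond_moment P F xi (k i : nat) : T -> R :=
  cond_exp P (F i.-1) (fun w => xi i w ^+ k).

(* <S>_n *)
Definition quad_char P F xi n (w : T) : R :=
  \sum_(1 <= i < n.+1) cond_moment P F xi 2 i w.

End martingale.

(* The standard normal distribution function Phi. *)
Definition std_normal_cdf (R : realType) (x : R) : R :=
  fine (normal_prob (0 : R) 1 `]-oo, x]).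

Definition x_hat (R : realType) (eps delta x : R) : R :=
  (2 * `|x| / Num.sqrt (1 + delta ^+ 2)) /
  (1 + Num.sqrt (1 + 2 * `|x| * eps / (1 + delta ^+ 2))).

(* Main.v *)
Require Import Defs.
From HB Require Import structures.
From mathcomp Require Import all_boot all_order all_algebra.
From mathcomp Require Import all_classical all_reals all_analysis.
From mathcomp Require Import measurable_realfun.
From mathcomp Require Import ring lra.
Set Implicit Arguments.
Unset Strict Implicit.
Unset Printing Implicit Defensive.
Import Order.TTheory GRing.Theory Num.Theory.
Import numFieldNormedType.Exports.
Local Open Scope classical_set_scope.
Local Open Scope ring_scope.

(** Proof idea. When (1 + x^2) e |ln e| or (1 + |x|) dl is not small, it suffices
    that P(S_n <= x) and Phi x, or their complements, are at most
    exp (- x_hat^2 / 2): the moment condition gives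
      E[exp (t xi_i) | F_{i-1}] <= 1 + t^2 s_i / (2 (1 - |t| e)),
    with s_i the conditional variance, and one applies Markov's inequality to
    exp (t S_n) for a suitable t.
    Otherwise, let Q be the probability of density
      prod_i exp (x xi_i) / E[exp (x xi_i) | F_{i-1}]
    with respect to P. Under Q the increments xi_i - x s_i form almost a
    martingale with conditional variances s_i. Replacing them one by one by
    Gaussian increments, at the smoothing scale
      A_k^2 = 1 + dl^2 + a^2 - (s_1 + ... + s_k), with a of order e,
    bounds the distance D of their sum to the normal law by a contraction
    inequality D <= C (e |ln e| + ...) + 2 D / 3. Undoing the change of measure,
    and using that the same tilt of the normal law is a translation, yields the
    claim with the factor exp (- x^2 / 2 + |x|^3 e / 2), which is of the order of
    exp (- x_hat^2 / 2) for such x. *)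

(** * Integrable functions under a probability *)

(** The logarithm comes from the third-order remainders of the replacement. The one at step k
    carries the weight s_(k+1) A_(k+1)^-3 / (1 + z^2), where z is the distance from S_k to the level
    y in units of A_(k+1). Without the denominator these weights add up to order 1/a, and the factor
    e in front leaves a constant, so the decay in z must be exploited although the law of S_k is
    unknown. In mean, S_k can be exchanged for S_n, because S_n - S_k has a conditional second
    moment of order A_(k+1)^2. With the end point fixed, the weights telescope along each path to 1
    / (a + |S_n - y|), whose expectation is at most C (1 + |ln a| + D / a) when the law of S_n is
    within D of the normal law. For a a large multiple of e this leaves e |ln e| and a small
    multiple of D; removing the smoothing costs another D / 3. The scales are random but
    predictable: A_(k+1) is known at time k, so functions of it may weight the conditional moments
    of the next increment. Versions of conditional expectations are clamped so that their bounds
    hold everywhere, which keeps null sets out of the pathwise estimates. *)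

Section integrable_functions.
Context d (T : measurableType d) (R : realType).
Implicit Types (P : probability T R) (X Y : T -> R).

Definition L1 P X : Prop := P.-integrable setT (EFin \o X).
Definition Ex P X : R := \int[P]_w X w.

Lemma L1_meas P X : L1 P X -> measurable_fun setT X.
Proof. by move=> /measurable_int /measurable_EFinP. Qed.

Lemma L1_le P X Y : measurable_fun setT X -> L1 P Y ->
  (forall w, `|X w| <= `|Y w|) -> L1 P X.
Proof.
move=> mX iY XY; apply: (le_integrable measurableT) iY.
  exact/measurable_EFinP.
by move=> w _; rewrite /= lee_fin.
Qed.

Lemma L1_cst P (c : R) : L1 P (fun=> c).
Proof. exact: finite_measure_integrable_cst. Qed.

Lemma L1_bnd P X (c : R) : measurable_fun setT X ->
  (forall w, `|X w| <= c) -> L1 P X.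
Proof.
move=> mX Xc; apply: (@L1_le _ _ (fun=> c)) => //; first exact: L1_cst.
by move=> w; rewrite (le_trans (Xc w)) ?ler_norm.
Qed.

Lemma L1D P X Y : L1 P X -> L1 P Y -> L1 P (fun w => X w + Y w).
Proof. by move=> iX iY; exact: (integrableD measurableT iX iY). Qed.

Lemma L1N P X : L1 P X -> L1 P (fun w => - X w).
Proof. by move=> iX; exact: (integrableN iX). Qed.

Lemma L1B P X Y : L1 P X -> L1 P Y -> L1 P (fun w => X w - Y w).
Proof. by move=> iX iY; apply: L1D => //; exact: L1N. Qed.

Lemma L1Z P (c : R) X : L1 P X -> L1 P (fun w => c * X w).
Proof. by move=> iX; exact: (integrableZl measurableT c iX). Qed.

Lemma L1_abs P X : L1 P X -> L1 P (fun w => `|X w|).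
Proof. by move=> iX; exact: (integrable_norm iX). Qed.

Lemma L1_sum P m n (X : nat -> T -> R) :
  (forall i, (m <= i < n)%N -> L1 P (X i)) ->
  L1 P (fun w => \sum_(m <= i < n) X i w).
Proof.
move=> iX; elim: n iX => [|n ih] iX.
  have -> : (fun w => \sum_(m <= i < 0) X i w) = (fun=> 0).
    by apply/funext => w; rewrite big_geq.
  exact: L1_cst.
have [mn|nm] := leqP m n; last first.
  have -> : (fun w => \sum_(m <= i < n.+1) X i w) = (fun=> 0).
    by apply/funext => w; rewrite big_geq.
  exact: L1_cst.
have -> : (fun w => \sum_(m <= i < n.+1) X i w) =
    (fun w => \sum_(m <= i < n) X i w + X n w).
  by apply/funext => w; rewrite big_nat_recr.
apply: L1D; last by apply: iX; rewrite mn ltnS leqnn.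
by apply: ih => i /andP[mi ni]; apply: iX; rewrite mi ltnS ltnW.
Qed.

Lemma L1_ge0 P X : measurable_fun setT X -> (forall w, 0 <= X w) ->
  (\int[P]_w (X w)%:E < +oo)%E -> L1 P X.
Proof.
move=> mX X0 iX; apply/integrableP; split; first exact/measurable_EFinP.
by under eq_integral do rewrite /= ger0_norm//.
Qed.

Lemma ExE P X : L1 P X -> (\int[P]_w (X w)%:E = (Ex P X)%:E)%E.
Proof. by move=> iX; rewrite /Ex /Rintegral fineK//; exact: integrable_fin_num. Qed.

Lemma ExD P X Y : L1 P X -> L1 P Y ->
  Ex P (fun w => X w + Y w) = Ex P X + Ex P Y.
Proof. by move=> iX iY; apply: RintegralD. Qed.

Lemma ExB P X Y : L1 P X -> L1 P Y ->
  Ex P (fun w => X w - Y w) = Ex P X - Ex P Y.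
Proof. by move=> iX iY; apply: RintegralB. Qed.

Lemma ExZ P (c : R) X : L1 P X -> Ex P (fun w => c * X w) = c * Ex P X.
Proof. by move=> iX; apply: RintegralZl. Qed.

Lemma Ex_cst P (c : R) : Ex P (fun=> c) = c.
Proof. by rewrite /Ex Rintegral_cst// [X in fine X]probability_setT mulr1. Qed.

Lemma Ex_sum P m n (X : nat -> T -> R) :
  (forall i, (m <= i < n)%N -> L1 P (X i)) ->
  Ex P (fun w => \sum_(m <= i < n) X i w) = \sum_(m <= i < n) Ex P (X i).
Proof.
move=> iX; elim: n iX => [|n ih] iX.
  rewrite big_geq// -[RHS](Ex_cst P 0); congr Ex.
  by apply/funext => w; rewrite big_geq.
have [mn|nm] := leqP m n; last first.
  rewrite big_geq// -[RHS](Ex_cst P 0); congr Ex.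
  by apply/funext => w; rewrite big_geq.
have -> : (fun w => \sum_(m <= i < n.+1) X i w) =
    (fun w => \sum_(m <= i < n) X i w + X n w).
  by apply/funext => w; rewrite big_nat_recr.
have iX' i : (m <= i < n)%N -> L1 P (X i).
  by move=> /andP[mi ni]; apply: iX; rewrite mi ltnS ltnW.
rewrite big_nat_recr// ExD ?ih//; first exact: L1_sum.
by apply: iX; rewrite mn ltnS leqnn.
Qed.

Lemma eq_Ex P X Y : X =1 Y -> Ex P X = Ex P Y.
Proof. by move=> XY; congr Ex; exact/funext. Qed.

Lemma Ex_le P X Y : L1 P X -> L1 P Y -> (forall w, X w <= Y w) ->
  Ex P X <= Ex P Y.
Proof. by move=> iX iY XY; apply: le_Rintegral. Qed.

Lemma Ex_ge0 P X : (forall w, 0 <= X w) -> 0 <= Ex P X.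
Proof. by move=> X0; apply: Rintegral_ge0. Qed.

Lemma Ex_abs P X : L1 P X -> `|Ex P X| <= Ex P (fun w => `|X w|).
Proof. by move=> iX; apply: le_normr_Rintegral. Qed.

Lemma Ex_absW P X Y : L1 P X -> L1 P Y -> (forall w, `|X w| <= Y w) ->
  `|Ex P X| <= Ex P Y.
Proof.
by move=> iX iY XY; apply: le_trans (Ex_abs iX) _; apply: Ex_le => //; exact: L1_abs.
Qed.

Lemma Ex_ae P X Y : L1 P X -> L1 P Y -> {ae P, forall w, X w = Y w} ->
  Ex P X = Ex P Y.
Proof.
move=> iX iY XY; congr fine; apply: ae_eq_integral => //.
- exact: measurable_int iX.
- exact: measurable_int iY.
- by apply: filterS XY => w /= ->.
Qed.

Lemma Ex_le_ae P X Y : L1 P X -> L1 P Y -> {ae P, forall w, X w <= Y w} ->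
  Ex P X <= Ex P Y.
Proof.
move=> iX iY XY.
(* [Z] dominates [X] everywhere and equals [Y] almost surely, which reduces the claim to [Ex_le]. *)
pose Z w := Num.max (X w) (Y w).
have iZ : L1 P Z.
  apply: (@L1_le _ _ (fun w => `|X w| + `|Y w|)).
  - by apply: measurable_maxr; [exact: L1_meas iX|exact: L1_meas iY].
  - by apply: L1D; exact: L1_abs.
  - move=> w; rewrite [leRHS]ger0_norm ?addr_ge0// /Z.
    by case: (leP (X w) (Y w)) => _; rewrite ?lerDl ?lerDr.
rewrite (@Ex_ae P Y Z)//; last by apply: filterS XY => w XY; rewrite /Z max_r.
by apply: Ex_le => // w; rewrite /Z le_max lexx.
Qed.

Lemma Ex_indic P (A : set T) : measurable A -> Ex P \1_A = fine (P A).
Proof. by move=> mA; rewrite /Ex /Rintegral integral_indic// setIT. Qed.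

Lemma L1_indic P (A : set T) : measurable A -> L1 P \1_A.
Proof.
move=> mA; apply: (@L1_bnd _ _ 1); first exact: measurable_indic.
by move=> w; rewrite indicE; case: (_ \in _); rewrite ?normr1 ?normr0.
Qed.

Lemma integral_indicM P (A : set T) X : measurable A ->
  (\int[P]_(w in A) (X w)%:E = \int[P]_w (\1_A w * X w)%:E)%E.
Proof.
move=> mA; rewrite integral_mkcond; apply: eq_integral => w _.
by rewrite patchE indicE; case: ifPn => _; rewrite /= ?mul1r ?mul0r.
Qed.

End integrable_functions.

(** The base measure is only sigma-finite, so that the lemma serves both for the normal density
    against Lebesgue measure and for a likelihood against [P]. The density agrees almost everywhere
    with the Radon-Nikodym derivative, whose change of variables is known. *)
Lemma ge0_integral_density d (T : measurableType d) (R : realType)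
    (mu : {sigma_finite_measure set T -> \bar R})
    (nu : {finite_measure set T -> \bar R}) (X : T -> R) :
  (forall w, 0 <= X w) -> mu.-integrable setT (EFin \o X) ->
  (forall A, measurable A -> nu A = \int[mu]_(w in A) (X w)%:E)%E ->
  forall f : T -> \bar R, measurable_fun setT f -> (forall w, 0 <= f w)%E ->
  (\int[nu]_w f w = \int[mu]_w (f w * (X w)%:E))%E.
Proof.
move=> X0 iX nuE f mf f0.
have mX := measurable_int _ iX.
have dom : nu `<< mu.
  apply/null_content_dominatesP => A mA muA0.
  by rewrite nuE//; apply: null_set_integral => //; exact: measurable_funS mX.
rewrite -(Radon_Nikodym_SigmaFinite.change_of_variables dom)//.
have iRN := Radon_Nikodym_SigmaFinite.f_integrable dom.
have XRN : ae_eq mu setT (EFin \o X) (Radon_Nikodym_SigmaFinite.f nu mu).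
  apply: integral_ae_eq => //; first exact: measurable_int iRN.
  by move=> E _ mE; rewrite -Radon_Nikodym_SigmaFinite.f_integral// nuE.
apply: ae_eq_integral => //.
- by apply: emeasurable_funM => //; exact: measurable_int iRN.
- exact: emeasurable_funM.
- by apply: filterS XRN => w /= /(_ I) <-.
Qed.

(** * Weights and conditional expectations *)

Section density_measure.
Context d (T : measurableType d) (R : realType) (P : probability T R).

(** Positivity and integrability are arguments, so that the finite measure structure can be inferred
    from the term itself. *)
Definition density (X : T -> R) (X0 : forall w, 0 <= X w) (iX : L1 P X) :
    set T -> \bar R :=
  fun A => (\int[P]_(w in A) (X w)%:E)%E.

Variables (X : T -> R) (X0 : forall w, 0 <= X w) (iX : L1 P X).

Let density0 : density X0 iX set0 = 0%E.
Proof. by rewrite /density integral_set0. Qed.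

Let density_ge0 A : (0 <= density X0 iX A)%E.
Proof. by apply: integral_ge0 => w _; rewrite lee_fin. Qed.

Let density_sigma_additive : semi_sigma_additive (density X0 iX).
Proof.
move=> /= F mF tF mUF; rewrite /density; apply: cvg_toP.
  apply: ereal_nondecreasing_is_cvgn => m n mn.
  apply: lee_sum_nneg_natr => // k _ _.
  by apply: integral_ge0 => /= x Fkx; rewrite lee_fin.
rewrite ge0_integral_bigcup//=.
- by apply: measurable_funTS; exact: measurable_int iX.
- by move=> x _; rewrite lee_fin.
Qed.

HB.instance Definition _ := isMeasure.Build _ _ _ (density X0 iX)
  density0 density_ge0 density_sigma_additive.

Let density_finite : fin_num_fun (density X0 iX).
Proof.
move=> A mA; apply: integrable_fin_num => //.
exact: integrableS iX.
Qed.

HB.instance Definition _ := Measure_isFinite.Build _ _ _ (density X0 iX)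
  density_finite.

Lemma ge0_integral_densityE (f : T -> \bar R) : measurable_fun setT f ->
  (forall w, 0 <= f w)%E ->
  (\int[density X0 iX]_w f w = \int[P]_w (f w * (X w)%:E))%E.
Proof. by move=> mf f0; exact: (ge0_integral_density X0). Qed.

End density_measure.

Lemma invr_measurable (R : realType) : measurable_fun [set: R] (@GRing.inv R).
Proof.
rewrite -(setUv [set 0 : R]); apply/measurable_funU => //.
  exact: measurableC.
split; first exact: measurable_fun_set1.
apply: open_continuous_measurable_fun; first exact: closed_openC.
by move=> x; rewrite inE/= => /eqP x0; exact: inv_continuous.
Qed.

Section measurable_wrt_theory.
Context d (T : measurableType d) (R : realType) (G : set (set T)).
Hypothesis sG : sigma_algebra setT G.
Implicit Types X Y : T -> R.

Let TG := g_sigma_algebraType G.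

Lemma g_measurableE : @measurable _ TG = G.
Proof. exact: measurable_g_measurableTypeE. Qed.

Lemma mwrtP X : measurable_wrt G X <-> measurable_fun setT (X : TG -> R).
Proof.
split=> [mX _ B mB|mX B mB]; first by rewrite setTI g_measurableE; exact: mX.
by have := mX measurableT B mB; rewrite setTI g_measurableE.
Qed.

Lemma mwrt_cst (c : R) : measurable_wrt G (fun=> c).
Proof. exact/mwrtP/measurable_cst. Qed.

Lemma mwrtD X Y : measurable_wrt G X -> measurable_wrt G Y ->
  measurable_wrt G (fun w => X w + Y w).
Proof. by move=> /mwrtP mX /mwrtP mY; apply/mwrtP/measurable_funD. Qed.

Lemma mwrtB X Y : measurable_wrt G X -> measurable_wrt G Y ->
  measurable_wrt G (fun w => X w - Y w).
Proof. by move=> /mwrtP mX /mwrtP mY; apply/mwrtP/measurable_funB. Qed.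

Lemma mwrtM X Y : measurable_wrt G X -> measurable_wrt G Y ->
  measurable_wrt G (fun w => X w * Y w).
Proof. by move=> /mwrtP mX /mwrtP mY; apply/mwrtP/measurable_funM. Qed.

Lemma mwrt_max X Y : measurable_wrt G X -> measurable_wrt G Y ->
  measurable_wrt G (fun w => Num.max (X w) (Y w)).
Proof. by move=> /mwrtP mX /mwrtP mY; apply/mwrtP/measurable_maxr. Qed.

Lemma mwrt_min X Y : measurable_wrt G X -> measurable_wrt G Y ->
  measurable_wrt G (fun w => Num.min (X w) (Y w)).
Proof. by move=> /mwrtP mX /mwrtP mY; apply/mwrtP/measurable_minr. Qed.

Lemma mwrt_comp (f : R -> R) X : measurable_fun setT f ->
  measurable_wrt G X -> measurable_wrt G (fun w => f (X w)).
Proof. by move=> mf mX B mB; apply: (mX (f @^-1` B)); rewrite -[f @^-1` B]setTI; exact: mf. Qed.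

Lemma mwrtN X : measurable_wrt G X -> measurable_wrt G (fun w => - X w).
Proof. by move=> mX; exact: (@mwrt_comp -%R X (@oppr_measurable R setT) mX). Qed.

Lemma mwrtV X : measurable_wrt G X -> measurable_wrt G (fun w => (X w)^-1).
Proof. by move=> mX; exact: (@mwrt_comp GRing.inv X (@invr_measurable R) mX). Qed.

Lemma mwrtX X (k : nat) : measurable_wrt G X -> measurable_wrt G (fun w => X w ^+ k).
Proof. by move=> mX; exact: (@mwrt_comp (fun x => x ^+ k) X (@exprn_measurable R setT k) mX). Qed.

Lemma mwrt_abs X : measurable_wrt G X -> measurable_wrt G (fun w => `|X w|).
Proof. by move=> mX; exact: (@mwrt_comp Num.norm X (@normr_measurable R setT) mX). Qed.

Lemma mwrt_sum m n (X : nat -> T -> R) :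
  (forall i, (m <= i < n)%N -> measurable_wrt G (X i)) ->
  measurable_wrt G (fun w => \sum_(m <= i < n) X i w).
Proof.
move=> mX; apply/mwrtP.
pose X' i := if (m <= i < n)%N then X i else cst 0.
have -> : (fun w : TG => \sum_(m <= i < n) X i w) =
    (fun w => \sum_(m <= i < n) X' i w).
  by apply/funext => w; apply: eq_big_nat => i mi; rewrite /X' mi.
apply: measurable_sum => i; rewrite /X'; case: ifPn => mi; last exact: measurable_cst.
exact/mwrtP/mX.
Qed.

Lemma mwrt_prod m n (X : nat -> T -> R) :
  (forall i, (m <= i < n)%N -> measurable_wrt G (X i)) ->
  measurable_wrt G (fun w => \prod_(m <= i < n) X i w).
Proof.
move=> mX; apply/mwrtP; apply: measurable_prod => i.
by rewrite mem_index_iota => mi; exact/mwrtP/mX.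
Qed.

Lemma mwrt_lt X Y : measurable_wrt G X -> measurable_wrt G Y ->
  G [set w | X w < Y w].
Proof.
move=> mX mY; have := mwrtB mX mY (measurable_itv `]-oo, (0 : R)[).
congr G; apply/seteqP; split=> w /=; rewrite in_itv/= subr_lt0 //.
Qed.

End measurable_wrt_theory.

Lemma mwrt_meas d (T : measurableType d) (R : realType) (G : set (set T))
  (X : T -> R) : G `<=` measurable -> measurable_wrt G X ->
  measurable_fun setT X.
Proof. by move=> Gm mX _ B mB; rewrite setTI; apply/Gm/mX. Qed.

Section conditioning.
Context d (T : measurableType d) (R : realType) (P : probability T R).
Variable G : set (set T).
Hypotheses (sG : sigma_algebra setT G) (Gm : G `<=` measurable).
Implicit Types X Y W : T -> R.

Let TG := g_sigma_algebraType G.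
Let phi : T -> TG := id.

Let mphi : measurable_fun [set: T] phi.
Proof. by move=> _ A; rewrite g_measurableE// => GA; rewrite setTI; exact: Gm. Qed.

(** Pushed forward along the identity to the coarser measurable space of [G], the measures with
    densities [X] and [Y] coincide, and [W] is measurable there. *)
Lemma ge0_integral_weight X Y : (forall w, 0 <= X w) -> (forall w, 0 <= Y w) ->
  L1 P X -> L1 P Y ->
  (forall A, G A -> \int[P]_(w in A) (X w)%:E = \int[P]_(w in A) (Y w)%:E)%E ->
  forall W, measurable_wrt G W -> (forall w, 0 <= W w) ->
  (\int[P]_w (W w * X w)%:E = \int[P]_w (W w * Y w)%:E)%E.
Proof.
move=> X0 Y0 iX iY XY W mW W0.
have mWT : measurable_fun setT (EFin \o W).
  exact/measurable_EFinP/(mwrt_meas Gm mW).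
have mWG : measurable_fun setT (EFin \o W : TG -> _).
  by apply/measurable_EFinP/mwrtP.
have push Z (Z0 : forall w, 0 <= Z w) (iZ : L1 P Z) :
    (\int[P]_w (W w * Z w)%:E =
     \int[pushforward (density Z0 iZ) phi]_w (W w)%:E)%E.
  rewrite ge0_integral_pushforward//=; last first.
    by move=> w _; rewrite lee_fin.
  by rewrite preimage_setT ge0_integral_densityE// => w; rewrite lee_fin.
rewrite (push X X0 iX) (push Y Y0 iY); apply: eq_measure_integral => /= A.
by rewrite g_measurableE// => GA _; exact: XY.
Qed.

(** Positive parts of [X] and [Y] need not have equal integrals over [G], but the nonnegative
    functions X^+ + Y^- and Y^+ + X^- do; [ge0_integral_weight] applies to them. *)
Lemma Ex_weight X Y W : L1 P X -> L1 P Y ->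
  (forall A, G A -> \int[P]_(w in A) (X w)%:E = \int[P]_(w in A) (Y w)%:E)%E ->
  measurable_wrt G W -> (forall w, 0 <= W w) ->
  L1 P (fun w => W w * X w) -> L1 P (fun w => W w * Y w) ->
  Ex P (fun w => W w * X w) = Ex P (fun w => W w * Y w).
Proof.
move=> iX iY XY mW W0 iWX iWY.
pose X1 w := Num.max (X w) 0; pose X2 w := Num.max (- X w) 0.
pose Y1 w := Num.max (Y w) 0; pose Y2 w := Num.max (- Y w) 0.
have maxE (a : R) : a = Num.max a 0 - Num.max (- a) 0.
  have [a0|] := boolP (0 <= a).
    by rewrite (max_l a0) max_r ?oppr_le0// subr0.
  rewrite -ltNge => /ltW a0.
  by rewrite (max_r a0) max_l ?oppr_ge0// sub0r opprK.
have XE w : X w = X1 w - X2 w by exact: maxE.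
have YE w : Y w = Y1 w - Y2 w by exact: maxE.
have pos1 Z : L1 P Z -> L1 P (fun w => Num.max (Z w) 0).
  move=> iZ; apply: (L1_le _ iZ).
    by apply: measurable_maxr => //; exact: L1_meas iZ.
  by move=> w; case: (leP (Z w) 0) => ?; rewrite ?normr0.
have iX1 : L1 P X1 by exact: pos1.
have iX2 : L1 P X2 by apply: pos1; exact: L1N.
have iY1 : L1 P Y1 by exact: pos1.
have iY2 : L1 P Y2 by apply: pos1; exact: L1N.
have WZ Z : L1 P (fun w => W w * Z w) ->
    L1 P (fun w => W w * Num.max (Z w) 0).
  move=> iWZ; have := pos1 _ iWZ; congr L1; apply/funext => w.
  by rewrite maxr_pMr// mulr0.
have WN Z : L1 P (fun w => W w * Z w) -> L1 P (fun w => W w * - Z w).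
  by move=> /L1N; congr L1; apply/funext => w; rewrite mulrN.
have iWX1 := WZ _ iWX; have iWX2 := WZ _ (WN _ iWX).
have iWY1 := WZ _ iWY; have iWY2 := WZ _ (WN _ iWY).
have := @ge0_integral_weight (fun w => X1 w + Y2 w) (fun w => Y1 w + X2 w).
have m0 (a : R) : 0 <= Num.max a 0 by rewrite le_max lexx orbT.
move=> /(_ _ _ _ _ _ W mW W0).
have -> : (fun w => (W w * (X1 w + Y2 w))%:E) = EFin \o (fun w => W w * X1 w + W w * Y2 w).
  by apply/funext => w /=; rewrite mulrDr.
have -> : (fun w => (W w * (Y1 w + X2 w))%:E) = EFin \o (fun w => W w * Y1 w + W w * X2 w).
  by apply/funext => w /=; rewrite mulrDr.
rewrite !ExE; [|exact: L1D|exact: L1D].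
rewrite !ExD// => H.
have -> : Ex P (fun w => W w * X w) = Ex P (fun w => W w * X1 w - W w * X2 w).
  by apply: eq_Ex => w; rewrite XE mulrBr.
have -> : Ex P (fun w => W w * Y w) = Ex P (fun w => W w * Y1 w - W w * Y2 w).
  by apply: eq_Ex => w; rewrite YE mulrBr.
rewrite !ExB//.
suff H2 : ((Ex P (fun w => W w * X1 w) + Ex P (fun w => W w * Y2 w))%:E =
    (Ex P (fun w => W w * Y1 w) + Ex P (fun w => W w * X2 w))%:E)%E by have := EFin_inj H2; lra.
apply: H.
- by move=> w; rewrite addr_ge0// m0.
- by move=> w; rewrite addr_ge0// m0.
- exact: L1D.
- exact: L1D.
move=> A GA; have mA := Gm GA; have iA Z : L1 P Z -> P.-integrable A (EFin \o Z).
  by move=> iZ; exact: integrableS iZ.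
pose e Z := fine (\int[P]_(w in A) (Z w)%:E)%E.
have eE Z : L1 P Z -> (\int[P]_(w in A) (Z w)%:E = (e Z)%:E)%E.
  by move=> iZ; rewrite fineK//; apply: integrable_fin_num => //; exact: iA.
have eD Z1 Z2 : L1 P Z1 -> L1 P Z2 ->
    (\int[P]_(w in A) (Z1 w + Z2 w)%:E = (e Z1 + e Z2)%:E)%E.
  move=> i1 i2; rewrite EFinD -!eE//.
  exact: (@integralD_EFin _ _ _ P A mA Z1 Z2 (iA _ i1) (iA _ i2)).
have eB Z1 Z2 : L1 P Z1 -> L1 P Z2 -> e (fun w => Z1 w - Z2 w) = e Z1 - e Z2.
  by move=> i1 i2; rewrite /e -[LHS]/(Rintegral P A _) RintegralB //; exact: iA.
have : e X = e Y by apply: EFin_inj; rewrite -!eE//; exact: XY.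
rewrite (_ : X = fun w => X1 w - X2 w); last exact/funext.
rewrite (_ : Y = fun w => Y1 w - Y2 w); last exact/funext.
rewrite !eB// => XY'; rewrite (eD _ _ iX1 iY2) (eD _ _ iY1 iX2).
by congr EFin; lra.
Qed.

Lemma Ex0_ae0 X : L1 P X -> (forall w, 0 <= X w) -> Ex P X <= 0 ->
  {ae P, forall w, X w = 0}.
Proof.
move=> iX X0 EX.
have : ae_eq P setT (EFin \o X) (cst 0%E).
  apply/(ae_eq_integral_abs P measurableT); first exact: measurable_int iX.
  under eq_integral do rewrite /= ger0_norm//.
  rewrite ExE//; congr EFin; apply/eqP; rewrite eq_le EX/=; exact: Ex_ge0.
by apply: filterS => w /= /(_ I) [].
Qed.

(** Bounds on integrals over the sets of [G] hold almost surely for the conditional expectation;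
    clamping it between [lo] and [up] changes it on a null set only. This is the source of all
    versions with bounds valid everywhere. *)
Lemma cond_exp_between X lo up : L1 P X ->
  measurable_wrt G lo -> measurable_wrt G up -> L1 P lo -> L1 P up ->
  (forall w, lo w <= up w) ->
  (forall A, G A -> Ex P (fun w => \1_A w * lo w) <= Ex P (fun w => \1_A w * X w)) ->
  (forall A, G A -> Ex P (fun w => \1_A w * X w) <= Ex P (fun w => \1_A w * up w)) ->
  exists Y, is_cond_exp P G X Y /\ forall w, lo w <= Y w <= up w.
Proof.
move=> iX mlo mup ilo iup loup Hlo Hup.
have [mZ iZ ZE] := cond_expP sG Gm iX; set Z := cond_exp P G X in mZ iZ ZE.
pose Y w := Num.max (lo w) (Num.min (Z w) (up w)).
have mY : measurable_wrt G Y by apply: mwrt_max => //; exact: mwrt_min.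
have iI A V : G A -> L1 P V -> L1 P (fun w => \1_A w * V w).
  move=> GA iV; apply: (L1_le _ iV).
    apply: measurable_funM; last exact: L1_meas iV.
    by apply: measurable_indic; exact: Gm.
  move=> w; rewrite indicE; case: (_ \in _); rewrite ?mul1r ?mul0r ?normr0//.
have EZ A : G A -> Ex P (fun w => \1_A w * Z w) = Ex P (fun w => \1_A w * X w).
  move=> GA; apply: EFin_inj; rewrite -!ExE; [|exact: iI..].
  by rewrite -!integral_indicM; [exact: ZE|exact: Gm..].
(* Test the hypothesis on the set where the inequality fails, which belongs to [G]: the positive
   part of [V1 - V2] then has integral zero. *)
have neg V1 V2 : measurable_wrt G V1 -> measurable_wrt G V2 ->
    L1 P V1 -> L1 P V2 ->
    (forall A, G A -> Ex P (fun w => \1_A w * V1 w) <= Ex P (fun w => \1_A w * V2 w)) ->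
    {ae P, forall w, V1 w <= V2 w}.
  move=> m1 m2 i1 i2 H; pose A := [set w | V2 w < V1 w].
  have GA : G A by exact: mwrt_lt.
  have iV := iI A _ GA (L1B i1 i2).
  have : {ae P, forall w, \1_A w * (V1 w - V2 w) = 0}.
    apply: Ex0_ae0 => //.
      move=> w; rewrite indicE; case: (boolP (w \in A)); rewrite ?mul0r//.
      by rewrite inE mul1r => /ltW; rewrite -subr_ge0.
    have -> : (fun w => \1_A w * (V1 w - V2 w)) = (fun w => \1_A w * V1 w - \1_A w * V2 w).
      by apply/funext => w; rewrite mulrBr.
    by rewrite ExB ?subr_le0 ?H//; exact: iI.
  apply: filterS => w /eqP; rewrite leNgt mulf_eq0 subr_eq0 indicE.
  case: (boolP (w \in A)).
    by rewrite inE /A/= oner_eq0/= => + /eqP ->; rewrite ltxx.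
  by move=> wA _; apply/negP => ?; move/negP : wA; apply; rewrite inE.
have aelo : {ae P, forall w, lo w <= Z w}.
  by apply: neg => // A GA; rewrite EZ//; exact: Hlo.
have aeup : {ae P, forall w, Z w <= up w}.
  by apply: neg => // A GA; rewrite EZ//; exact: Hup.
have loYup w : lo w <= Y w <= up w.
  by rewrite /Y le_max lexx/= ge_max loup/= ge_min lexx orbT.
have iY : L1 P Y.
  apply: (@L1_le _ _ _ _ _ (fun w => `|lo w| + `|up w|)).
  - exact: mwrt_meas mY.
  - by apply: L1D; exact: L1_abs.
  - move=> w; rewrite [leRHS]ger0_norm ?addr_ge0// ler_norml.
    have /andP[] := loYup w; have := ler_norm (lo w); have := ler_norm (up w).
    have := ler_norm (- lo w); have := ler_norm (- up w); rewrite !normrN.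
    by move=> *; apply/andP; split; lra.
have YZ : {ae P, forall w, Y w = Z w}.
  apply: filterS2 aelo aeup => w h1 h2.
  by rewrite /Y min_l// max_r.
exists Y; split => //.
split => // A GA; rewrite -ZE//; apply: ae_eq_integral.
- exact: Gm.
- by apply: measurable_funTS; exact: measurable_int iY.
- by apply: measurable_funTS; exact: measurable_int iZ.
- by apply: filterS YZ => w -> _.
Qed.

End conditioning.

(** * The standard normal law *)

Section lebesgue_translation.
Context (R : realType).
Local Notation mu := (@lebesgue_measure R).

Let lebesgue_measure_shift (a : R) (A : set R) : measurable A ->
  pushforward mu (fun x : R => x + a : measurableTypeR R) A = mu A.
Proof.
move=> mA.
have mf : measurable_fun [set: R] (fun x : R => x + a : measurableTypeR R).
  exact: measurable_funD.
pose nu : {measure set (measurableTypeR R) -> \bar R} :=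
  measure_function_pushforward__canonical__measure_function_Measure mu mf.
suff H : forall X, ocitv X -> mu X = nu X.
  by rewrite [RHS](lebesgue_measure_unique H).
move=> _ [[b c]] _ <-; rewrite /nu/= /pushforward.
rewrite (_ : _ @^-1` _ = [set` `]b - a, c - a]]); last first.
  by apply/seteqP; split=> x /=; rewrite !in_itv/= ltrBlDr lerBrDr.
rewrite !lebesgue_measure_itv/= !lte_fin ltrD2r.
by case: ifP => // _; rewrite -!EFinB; congr EFin; lra.
Qed.

Lemma ge0_integral_shift (a : R) (f : R -> \bar R) :
  measurable_fun setT f -> (forall x, 0 <= f x)%E ->
  (\int[mu]_x f x = \int[mu]_x f (x + a)%R)%E.
Proof.
move=> mf f0.
have mfa : measurable_fun [set: measurableTypeR R]
    (fun x : measurableTypeR R => (x : R) + a : measurableTypeR R).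
  exact: (@measurable_funD _ _ R).
have := @ge0_integral_pushforward _ _ _ _ R _ mfa lebesgue_measure setT f measurableT mf.
rewrite preimage_setT => <-; last by move=> ? _.
by apply: eq_measure_integral => A mA _; apply/esym/lebesgue_measure_shift.
Qed.

(** Symmetry reduces the integral to the half-line, where the exponential density has total mass
    1. *)
Lemma integral_expRN_norm (t : R) : 0 < t ->
  (\int[mu]_x (expR (- (t * `|x|)))%:E = (2 / t)%:E)%E.
Proof.
move=> t0.
have ct : continuous (fun x : R => expR (- (t * `|x|))).
  move=> x; apply: continuous_comp; last exact: continuous_expR.
  apply: (@continuousN _ R^o); apply: continuousM; first exact: cst_continuous.
  exact: norm_continuous.
have mt := continuous_measurable_fun ct.
rewrite ge0_symfun_integralT//; last first.
  by move=> x /=; rewrite normrN.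
suff -> : (\int[mu]_(x in [set x | (0 <= x)%R]) (expR (- (t * `|x|)))%:E = (t^-1)%:E)%E.
  by rewrite -EFinM.
have := integral_exponential_pdf t0.
rewrite /exponential_pdf => H.
have H2 : (\int[mu]_(x in [set x | (0 <= x)%R]) (t%:E * (expR (- (t * `|x|)))%:E) = 1)%E.
  rewrite -H [in RHS](_ : (fun x => _) = (fun x => (((fun x => (t * expR (- t * x))%:E) \_ `[0%R, +oo[) x))).
    rewrite -integral_mkcond set_itvE.
    by apply: eq_integral => x; rewrite inE/= => x0; rewrite ger0_norm// mulNr EFinM.
  by apply/funext => x; rewrite !patchE; case: ifP.
move: H2; rewrite ge0_integralZl//.
- move=> H2; have : (t^-1%:E * (t%:E *
    \int[mu]_(x in [set x0 | (0 <= x0)%R]) (expR (- (t * `|x|)))%:E) = t^-1%:E)%E.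
    by rewrite H2 mule1.
  by rewrite muleA -EFinM mulVf ?gt_eqF// mul1e.
- by rewrite -set_itvcy; exact: measurable_itv.
- by apply: measurable_funTS; exact/measurable_EFinP.
- by rewrite lee_fin ltW.
Qed.

End lebesgue_translation.

Section standard_normal.
Context (R : realType).
Local Notation mu := (@lebesgue_measure R).
Local Notation phi := (normal_pdf (0 : R) 1).
Local Notation Phi := (@std_normal_cdf R).

Definition std_normal : probability (measurableTypeR R) R :=
  @normal_prob R 0 1.

Lemma std_normal_pdfE (x : R) : phi x = phi 0 * expR (- (x ^+ 2 / 2)).
Proof.
rewrite normal_pdfE ?oner_neq0// /normal_fun !subr0 expr1n.
by rewrite expr0n/= oppr0 mul0r expR0 mulr1 mulNr.
Qed.

Lemma std_normal_pdf_ge0 (x : R) : 0 <= phi x.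
Proof. exact: normal_pdf_ge0. Qed.

Lemma std_normal_pdf_le1 (x : R) : phi x <= 1.
Proof.
apply: le_trans (normal_pdf_ub 0 x (oner_neq0 R)) _.
rewrite /normal_peak expr1n mul1r invf_le1; last first.
  by rewrite sqrtr_gt0 mulrn_wgt0// pi_gt0.
have h : 1 <= (pi : R) *+ 2 by have := pi_ge2 R; rewrite -mulr_natr; lra.
by rewrite -[leLHS]sqrtr1; exact: ler_wsqrtr.
Qed.

Lemma std_normal_cdfE (x : R) : std_normal `]-oo, x]%classic = (Phi x)%:E.
Proof. by rewrite /std_normal_cdf fineK// fin_num_measure. Qed.

Lemma std_normal_cdf_ge0 (x : R) : 0 <= Phi x.
Proof. exact: fine_ge0. Qed.

Lemma std_normal_cdf_le1 (x : R) : Phi x <= 1.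
Proof. by rewrite -lee_fin -std_normal_cdfE probability_le1. Qed.

Lemma std_normal_cdf_le (x y : R) : x <= y -> Phi x <= Phi y.
Proof.
move=> xy; rewrite -lee_fin -!std_normal_cdfE; apply: le_measure; rewrite ?inE//.
by move=> z /=; rewrite !in_itv/= => /le_trans; exact.
Qed.

Lemma is_derive_std_normal_cdf (x : R) : is_derive x 1 Phi (phi x).
Proof.
have iphi : mu.-integrable [set: R] (EFin \o phi) by exact: integrable_normal_pdf.
have [] := @continuous_FTC1 R phi (BInfty _ true) x (x + 1).
- by rewrite ltrDl.
- exact: integrableS iphi.
- by rewrite ltNyr.
- by apply: continuous_normal_pdf; exact: oner_neq0.
- by move=> d1 d2; apply: DeriveDef => //; rewrite -derive1E.
Qed.

Lemma std_normal_integral (f : R -> \bar R) : measurable_fun setT f ->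
  (forall x, 0 <= f x)%E ->
  (\int[std_normal]_x f x = \int[mu]_x (f x * (phi x)%:E))%E.
Proof.
move=> mf f0; apply: (@ge0_integral_density _ _ _ mu std_normal phi) => //.
- exact: std_normal_pdf_ge0.
- exact: integrable_normal_pdf.
Qed.

(** The translation identity phi(u + l) = exp (- l^2 / 2) exp (- l u) phi(u). It writes the normal
    probability in the same shape as the probability of the martingale after the change of measure,
    so that the two can be compared factor by factor. *)
Lemma std_normal_tilt (l : R) (B : set R) : measurable B ->
  fine (std_normal B) = expR (- (l ^+ 2 / 2)) *
    Ex std_normal (fun u => expR (- (l * u)) * \1_B (u + l)).
Proof.
move=> mB.
have mphi := @measurable_normal_pdf R 0 1.
have mB' : measurable_fun [set: R] (fun u : R => (\1_B (u + l) : R)).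
  by apply: (@measurableT_comp _ _ _ _ _ _ (\1_B : R -> R)); [exact: measurable_indic|exact: measurable_funD].
have mE : measurable_fun [set: R] (fun u : R => expR (- (l * u))).
  by apply: measurableT_comp => //; apply: measurableT_comp => //; exact: measurable_funM.
have BE : (std_normal B = \int[mu]_u ((\1_B u)%:E * (phi u)%:E))%E.
  rewrite -std_normal_integral; [|exact/measurable_EFinP/measurable_indic|].
    by rewrite integral_indic// setIT.
  by move=> x; rewrite lee_fin.
move: BE; rewrite (@ge0_integral_shift _ l); first last.
- by move=> x; rewrite mule_ge0// lee_fin// std_normal_pdf_ge0.
- by apply: emeasurable_funM; apply/measurable_EFinP => //; exact: measurable_indic.
have E0 u : expR (- (l * u)) * \1_B (u + l) >= 0 by rewrite mulr_ge0// expR_ge0.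
rewrite /Ex /Rintegral std_normal_integral; first last.
- by move=> x; rewrite lee_fin.
- by apply/measurable_EFinP; exact: measurable_funM.
have -> : (\int[mu]_x ((\1_B (x + l))%:E * (phi (x + l))%:E) =
    \int[mu]_x ((expR (- (l ^+ 2 / 2)))%:E *
      ((expR (- (l * x)) * \1_B (x + l))%:E * (phi x)%:E)))%E.
  apply: eq_integral => x _; rewrite -!EFinM; congr EFin.
  rewrite std_normal_pdfE [in RHS]std_normal_pdfE.
  rewrite (_ : - ((x + l) ^+ 2 / 2) = - (l ^+ 2 / 2) + (- (l * x) + - (x ^+ 2 / 2))); last by field.
  by rewrite !expRD; ring.
set c := expR _; have c0 : 0 < c by exact: expR_gt0.
rewrite ge0_integralZl//; first last.
- by rewrite lee_fin ltW.
- by move=> x _; rewrite mule_ge0// lee_fin// std_normal_pdf_ge0.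
- by apply: emeasurable_funM; apply/measurable_EFinP => //; exact: measurable_funM.
set I := (X in (c%:E * X)%E) => H.
transitivity (c * fine I); last by [].
have -> : I = (c^-1%:E * (fine (std_normal B))%:E)%E.
  by rewrite fineK ?fin_num_measure// H muleA -EFinM mulVf ?gt_eqF// mul1e.
by rewrite -EFinM/= mulrA divff ?gt_eqF// mul1r.
Qed.

Lemma std_normal_pdf_bounded (f : R -> R) (c : R) :
  measurable_fun setT f -> (forall x, 0 <= f x) ->
  (\int[mu]_x (f x)%:E <= c%:E)%E -> Ex std_normal f <= c.
Proof.
move=> mf f0 fc; rewrite /Ex /Rintegral.
have H : (\int[std_normal]_x (f x)%:E <= \int[mu]_x (f x)%:E)%E.
  rewrite std_normal_integral; [|exact/measurable_EFinP|by move=> x; rewrite lee_fin].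
  apply: ge0_le_integral => //.
  - by move=> x _; rewrite mule_ge0// lee_fin// std_normal_pdf_ge0.
  - apply: emeasurable_funM; apply/measurable_EFinP => //.
    exact: measurable_normal_pdf.
  - exact/measurable_EFinP.
  - move=> x _; rewrite -EFinM lee_fin ler_piMr//; exact: std_normal_pdf_le1.
rewrite -lee_fin fineK ?(le_trans H)// ge0_fin_numE; last first.
  by apply: integral_ge0 => x _; rewrite lee_fin.
by rewrite (le_lt_trans H)// (le_lt_trans fc)// ltry.
Qed.

Lemma Ex_std_normal_expRN (t z : R) : 0 < t ->
  Ex std_normal (fun x => expR (- (t * `|x - z|))) <= 2 / t.
Proof.
move=> t0; have mf : measurable_fun [set: R] (fun x : R => expR (- (t * `|x - z|))).
  apply: continuous_measurable_fun => x.
  apply: continuous_comp; last exact: continuous_expR.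
  apply: (@continuousN _ R^o); apply: continuousM; first exact: cst_continuous.
  apply: (@continuous_comp _ _ _ (fun x => x - z) Num.norm); last exact: norm_continuous.
  by apply: continuousB => //; exact: cst_continuous.
apply: std_normal_pdf_bounded => //.
rewrite -(@ge0_integral_shift _ (- z) (fun x => (expR (- (t * `|x|)))%:E)).
- by rewrite integral_expRN_norm.
- have ct : continuous (fun x : R => expR (- (t * `|x|))).
    move=> x; apply: continuous_comp; last exact: continuous_expR.
    apply: (@continuousN _ R^o); apply: continuousM; first exact: cst_continuous.
    exact: norm_continuous.
  by have mt := continuous_measurable_fun ct; exact/measurable_EFinP.
- by move=> x; rewrite lee_fin expR_ge0.
Qed.

(** On the translated set the weight exp (- l u) is at most 1, so the factor in front is already a
    bound. *)
Let std_normal_tilt_le (l : R) (B : set R) : measurable B ->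
  (forall u, B (u + l) -> 0 <= l * u) -> fine (std_normal B) <= expR (- (l ^+ 2 / 2)).
Proof.
move=> mB Bl; rewrite (std_normal_tilt l mB).
rewrite -[leRHS]mulr1 ler_pM2l ?expR_gt0// -[leRHS](Ex_cst std_normal 1).
have mf : measurable_fun [set: R] (fun u : R => expR (- (l * u)) * \1_B (u + l)).
  apply: measurable_funM.
    by apply: measurableT_comp => //; apply: measurableT_comp => //; exact: measurable_funM.
  by apply: (@measurableT_comp _ _ _ _ _ _ (\1_B : R -> R)); [exact: measurable_indic|exact: measurable_funD].
have f1 u : 0 <= expR (- (l * u)) * \1_B (u + l) <= 1.
  rewrite indicE; case: (boolP (u + l \in B)); last by rewrite mulr0 lexx ler01.
  by rewrite inE => /Bl lu; rewrite mulr1 expR_ge0 expR_le1 oppr_le0.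
apply: Ex_le.
- by apply: (@L1_bnd _ _ _ _ _ 1) => // u; have /andP[? ?] := f1 u; rewrite ger0_norm.
- exact: L1_cst.
- by move=> u; have /andP[] := f1 u.
Qed.

Lemma std_normal_cdf_tail (x : R) : x <= 0 -> Phi x <= expR (- (x ^+ 2 / 2)).
Proof.
move=> x0; apply: std_normal_tilt_le => // u /=; rewrite in_itv/= => ux.
by rewrite mulr_le0// -(lerD2r x) add0r.
Qed.

Lemma std_normal_ccdf (x : R) : fine (std_normal `]x, +oo[%classic) = 1 - Phi x.
Proof.
have := probability_setC std_normal (measurable_itv `]-oo, x]).
by rewrite setCitvl std_normal_cdfE => ->.
Qed.

Lemma std_normal_ccdf_tail (x : R) : 0 <= x -> 1 - Phi x <= expR (- (x ^+ 2 / 2)).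
Proof.
move=> x0; rewrite -std_normal_ccdf; apply: std_normal_tilt_le => // u /=.
by rewrite in_itv/= andbT => ux; rewrite mulr_ge0// -(lerD2r x) add0r ltW.
Qed.

End standard_normal.

(** * Elementary bounds and expansions of the normal distribution function *)

Section polynomial_exponential_bounds.
Context (R : realType).

Lemma expR_ge_exprn (k : nat) (y : R) : 0 <= y -> (1 + y / k.+1%:R) ^+ k.+1 <= expR y.
Proof.
move=> y0; have -> : y = k.+1%:R * (y / k.+1%:R).
  by rewrite mulrCA divff ?mulr1// pnatr_eq0.
rewrite expRM_natl [X in 1 + X / _]mulrCA divff ?pnatr_eq0// mulr1.
apply: lerXn2r; rewrite ?nnegrE ?expR_ge0//; last exact: expR_ge1Dx.
by rewrite addr_ge0// divr_ge0.
Qed.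

Lemma expRN_sqr_half_le (z : R) :
  expR (- (z ^+ 2 / 2)) * (1 + z ^+ 2) ^+ 2 <= 16.
Proof.
have z0 := sqr_ge0 z; rewrite expRN mulrC ler_pdivrMr ?expR_gt0//.
have := @expR_ge_exprn 1 (z ^+ 2 / 2); rewrite divr_ge0// => /(_ isT) H.
apply: (@le_trans _ _ (16 * (1 + z ^+ 2 / 2 / 2) ^+ 2)); last by rewrite ler_pM2l.
rewrite (_ : 16 = 4 ^+ 2); last by ring.
rewrite -exprMn; move: (z ^+ 2) z0 => y y0.
by apply: lerXn2r; rewrite ?nnegrE; lra.
Qed.

Lemma expRN_sqr_quarter_le (z : R) :
  expR (- (z ^+ 2 / 4)) * (1 + z ^+ 2) ^+ 3 <= 12 ^+ 3.
Proof.
have z0 := sqr_ge0 z; rewrite expRN mulrC ler_pdivrMr ?expR_gt0//.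
have := @expR_ge_exprn 2 (z ^+ 2 / 4); rewrite divr_ge0// => /(_ isT) H.
apply: (@le_trans _ _ (12 ^+ 3 * (1 + z ^+ 2 / 4 / 3) ^+ 3)); last first.
  by rewrite ler_pM2l// exprn_gt0.
rewrite -exprMn; move: (z ^+ 2) z0 => y y0.
by apply: lerXn2r; rewrite ?nnegrE; lra.
Qed.

Lemma norm_le_sqr (z : R) : `|z| <= 1 + z ^+ 2.
Proof.
rewrite -(real_normK (num_real z)); have := normr_ge0 z; move: `|z| => y y0.
by have := sqr_ge0 (y - 1); rewrite sqrrB expr1n mulr1; have := sqr_ge0 y; lra.
Qed.

End polynomial_exponential_bounds.

Section mean_value.
Context (R : realType).

(** The derivative is bounded on a ball centred at [a], whichever side [b] lies on, so that the
    lemma can be iterated to give Taylor expansions around [a]. *)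
Lemma mean_value_le (f df : R -> R) (a b M : R) :
  (forall x : R, is_derive x 1 f (df x)) ->
  (forall x, `|x - a| <= `|b - a| -> `|df x| <= M) ->
  `|f b - f a| <= M * `|b - a|.
Proof.
move=> fdf dfM.
have cf x : {for x, continuous f}.
  by apply: differentiable_continuous; exact/derivable1_diffP.
have wcf c d : {within `[c, d], continuous f}.
  by apply: continuous_subspaceT => x; exact: cf.
have [ab|ba|->] := ltgtP a b.
- have [x] := MVT ab (fun x _ => fdf x) (wcf a b).
  rewrite in_itv/= => /andP[ax xb] ->; rewrite normrM ler_wpM2r//.
  by apply: dfM; rewrite !ger0_norm ?subr_ge0 ?(ltW ax) ?(ltW ab)// lerD2r ltW.
- have [x] := MVT ba (fun x _ => fdf x) (wcf b a).
  rewrite in_itv/= => /andP[bx xa] E; rewrite distrC E normrM [`|b - a|]distrC ler_wpM2r//.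
  by apply: dfM; rewrite !ler0_norm ?subr_le0 ?(ltW xa) ?(ltW ba)// lerN2 lerD2r ltW.
- by rewrite !subrr normr0 mulr0.
Qed.

End mean_value.

Section normal_taylor.
Context (R : realType).
Local Notation phi := (normal_pdf (0 : R) 1).
Local Notation Phi := (@std_normal_cdf R).

Lemma std_normal_pdf_le_expR (x : R) : phi x <= expR (- (x ^+ 2 / 2)).
Proof. by rewrite std_normal_pdfE ler_piMl ?expR_ge0// std_normal_pdf_le1. Qed.

Lemma is_derive_std_normal_pdf (x : R) : is_derive x 1 phi (- (x * phi x)).
Proof.
have -> : phi = fun x => phi 0 * expR (- (x ^+ 2 / 2)).
  by apply/funext => y; rewrite -std_normal_pdfE.
set c := phi 0; apply: is_derive_eq.
by rewrite /GRing.scale/=; field.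
Qed.

Lemma is_derive2_std_normal_pdf (x : R) :
  is_derive x 1 (fun y => - (y * phi y)) ((x ^+ 2 - 1) * phi x).
Proof.
have := is_derive_std_normal_pdf x => H.
by apply: is_derive_eq; rewrite /GRing.scale/=; ring.
Qed.

Lemma std_normal_pdf_sqr_le (z : R) : phi z * (1 + z ^+ 2) ^+ 2 <= 16.
Proof.
apply: le_trans (expRN_sqr_half_le z); rewrite ler_wpM2r ?sqr_ge0//.
exact: std_normal_pdf_le_expR.
Qed.

Lemma std_normal_cdf_lipschitz (x y : R) : `|Phi x - Phi y| <= `|x - y|.
Proof.
rewrite -[leRHS]mul1r; apply: (@mean_value_le R Phi phi y x 1) => [|z _]; first exact: is_derive_std_normal_cdf.
by rewrite ger0_norm ?std_normal_pdf_ge0 ?std_normal_pdf_le1.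
Qed.

Lemma std_normal_cdf_diff_tail (z h : R) : 2 * `|h| <= `|z| ->
  `|Phi (z - h) - Phi z| <= expR (- ((z / 2) ^+ 2 / 2)).
Proof.
move=> hz; have h1 := ler_norm h; have h2 := ler_norm (- h); rewrite normrN in h2.
have P0 := @std_normal_cdf_ge0 R; have P1 := @std_normal_cdf_le1 R.
have [z0|z0] := leP 0 z.
- rewrite (ger0_norm z0) in hz.
  have t1 := std_normal_ccdf_tail (_ : 0 <= z / 2).
  have {}t1 : 1 - Phi (z / 2) <= expR (- ((z / 2) ^+ 2 / 2)) by apply: t1; lra.
  have m1 : Phi (z / 2) <= Phi z by apply: std_normal_cdf_le; lra.
  have m2 : Phi (z / 2) <= Phi (z - h) by apply: std_normal_cdf_le; lra.
  have := P1 z; have := P1 (z - h); rewrite ler_norml => *; apply/andP; split; lra.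
- rewrite (ltr0_norm z0) in hz.
  have t1 : Phi (z / 2) <= expR (- ((z / 2) ^+ 2 / 2)).
    by apply: std_normal_cdf_tail; lra.
  have m1 : Phi z <= Phi (z / 2) by apply: std_normal_cdf_le; lra.
  have m2 : Phi (z - h) <= Phi (z / 2) by apply: std_normal_cdf_le; lra.
  have := P0 z; have := P0 (z - h); rewrite ler_norml => *; apply/andP; split; lra.
Qed.

(** Three applications of the mean value bound. The third derivative (x^2 - 1) phi(x) is at most 48
    / (1 + z^2) for |x - z| <= 1, since then 1 + z^2 <= 3 (1 + x^2). The decay in z is what makes
    the remainders of the replacement summable. *)
Lemma std_normal_cdf_taylor_near (z h : R) : `|h| <= 1 ->
  `|Phi (z - h) - Phi z + h * phi z + h ^+ 2 / 2 * (z * phi z)|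
     * (1 + z ^+ 2) <= 48 * `|h| ^+ 3.
Proof.
move=> h1; have z0 := sqr_ge0 z.
pose M := 48 / (1 + z ^+ 2).
have ball x : `|x - z| <= `|z - h - z| -> `|x - z| <= `|h|.
  by rewrite addrAC subrr sub0r normrN.
have d3 x : `|x - z| <= `|z - h - z| -> `|(x ^+ 2 - 1) * phi x| <= M.
  move=> /ball xz; rewrite /M ler_pdivlMr; last lra.
  rewrite normrM (ger0_norm (std_normal_pdf_ge0 x)).
  have x0 := sqr_ge0 x; have p0 := std_normal_pdf_ge0 x.
  have a1 : `|x ^+ 2 - 1| <= 1 + x ^+ 2 by rewrite ler_norml; apply/andP; split; lra.
  have a2 : 1 + z ^+ 2 <= 3 * (1 + x ^+ 2).
    have : (z - x) ^+ 2 <= 1.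
      by rewrite -real_normK ?num_real// exprn_ile1// distrC (le_trans xz).
    have := sqr_ge0 (2 * x - z).
    have : 2 * (z - x) ^+ 2 + 2 * x ^+ 2 = z ^+ 2 + (2 * x - z) ^+ 2 by ring.
    by lra.
  have b := std_normal_pdf_sqr_le x.
  apply: (@le_trans _ _ ((1 + x ^+ 2) * phi x * (3 * (1 + x ^+ 2)))).
    by apply: ler_pM => //; [rewrite mulr_ge0|lra|rewrite ler_wpM2r].
  rewrite (_ : _ * _ = 3 * (phi x * (1 + x ^+ 2) ^+ 2)); [lra|ring].
have d2 x : `|x - z| <= `|z - h - z| -> `|- (x * phi x) - - (z * phi z)| <= M * `|h|.
  move=> xz; apply: (le_trans (@mean_value_le R _ _ z x M (@is_derive2_std_normal_pdf) _)).
    by move=> y yx; apply: d3; exact: le_trans xz.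
  by rewrite ler_wpM2l ?ball// divr_ge0//; lra.
have M0 : 0 <= M by rewrite divr_ge0//; lra.
have d1 x : `|x - z| <= `|z - h - z| ->
    `|phi x - phi z - (x - z) * - (z * phi z)| <= M * `|h| * `|h|.
  move=> xz.
  have dg (y : R) : is_derive y 1 (fun y => phi y - phi z - (y - z) * - (z * phi z))
      (- (y * phi y) - - (z * phi z)).
    have := is_derive_std_normal_pdf y => H.
    by apply: is_derive_eq; rewrite /GRing.scale/=; ring.
  have := @mean_value_le R _ _ z x (M * `|h|) dg.
  rewrite !subrr mul0r !subr0 => H; apply: le_trans (H _) _.
    by move=> y yx; apply: d2; exact: le_trans xz.
  by rewrite ler_wpM2l ?ball// mulr_ge0.
have dG (y : R) : is_derive y 1
    (fun y => Phi y - Phi z - (y - z) * phi z - (y - z) ^+ 2 / 2 * - (z * phi z))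
    (phi y - phi z - (y - z) * - (z * phi z)).
  have := is_derive_std_normal_cdf y => H.
  by apply: is_derive_eq; rewrite /GRing.scale/=; field.
have := @mean_value_le R _ _ z (z - h) (M * `|h| * `|h|) dG d1.
rewrite !subrr mul0r expr0n/= !mul0r !subr0.
rewrite (_ : z - h - z = - h); last by ring.
rewrite normrN.
rewrite (_ : _ - _ = Phi (z - h) - Phi z + h * phi z + h ^+ 2 / 2 * (z * phi z)); last by field.
rewrite (_ : M * `|h| * `|h| * `|h| = 48 * `|h| ^+ 3 / (1 + z ^+ 2)); last first.
  by rewrite /M; field; rewrite gt_eqF//; lra.
by rewrite ler_pdivlMr//; lra.
Qed.

(** For |h| > 1 there is nothing to expand: the increment and the two Taylor terms are each bounded
    by a multiple of |h|^3, with 8 + 16 + 16 below 48. *)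
Lemma std_normal_cdf_taylor (z h : R) :
  `|Phi (z - h) - Phi z + h * phi z + h ^+ 2 / 2 * (z * phi z)|
     * (1 + z ^+ 2) <= 48 * `|h| ^+ 3.
Proof.
have [/std_normal_cdf_taylor_near//|h1] := leP `|h| 1.
have z0 := sqr_ge0 z; have p0 := std_normal_pdf_ge0 z.
have zz := norm_le_sqr z; have b := std_normal_pdf_sqr_le z.
set H := `|h| in h1 *; have H0 : 0 <= H by exact: normr_ge0.
have H23 : H ^+ 2 <= H ^+ 3 by rewrite ler_eXn2l.
have H13 : H <= H ^+ 3 by rewrite -[leLHS]expr1 ler_eXn2l.
have H03 : 1 <= H ^+ 3 by rewrite exprn_ege1// ltW.
have t1 : `|Phi (z - h) - Phi z| * (1 + z ^+ 2) <= 8 * H ^+ 3.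
  have [hz|hz] := leP (2 * H) `|z|.
    apply: (@le_trans _ _ (8 * 1)); last by rewrite ler_wpM2l.
    rewrite mulr1; apply: (@le_trans _ _ (expR (- ((z / 2) ^+ 2 / 2)) * (1 + z ^+ 2))).
      by rewrite ler_wpM2r//; [lra|exact: std_normal_cdf_diff_tail].
    rewrite expRN mulrC ler_pdivrMr ?expR_gt0//.
    have := expR_ge1Dx ((z / 2) ^+ 2 / 2).
    rewrite (_ : (z / 2) ^+ 2 / 2 = z ^+ 2 / 8); last by field.
    by lra.
  apply: (@le_trans _ _ (1 * (1 + z ^+ 2))).
    rewrite ler_wpM2r//; first lra.
    have := std_normal_cdf_ge0 z; have := std_normal_cdf_le1 z.
    have := std_normal_cdf_ge0 (z - h); have := std_normal_cdf_le1 (z - h).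
    by rewrite ler_norml => *; apply/andP; split; lra.
  have : z ^+ 2 <= (2 * H) ^+ 2.
    rewrite -(real_normK (num_real z)); apply: lerXn2r; rewrite ?nnegrE//.
      by rewrite mulr_ge0.
    exact: ltW.
  by rewrite exprMn; lra.
have t2 : `|h * phi z| * (1 + z ^+ 2) <= 16 * H ^+ 3.
  rewrite normrM (ger0_norm p0) -/H.
  apply: (@le_trans _ _ (H * 16)); last by lra.
  rewrite -mulrA ler_wpM2l//; apply: le_trans b; rewrite ler_wpM2l//.
  by rewrite expr2 ler_peMr//; lra.
have t3 : `|h ^+ 2 / 2 * (z * phi z)| * (1 + z ^+ 2) <= 16 * H ^+ 3.
  rewrite normrM normrM (ger0_norm (_ : 0 <= 2^-1))// normrX -/H normrM (ger0_norm p0).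
  apply: (@le_trans _ _ (H ^+ 2 / 2 * (phi z * (1 + z ^+ 2) ^+ 2))).
    rewrite (_ : _ * _ = H ^+ 2 / 2 * phi z * (1 + z ^+ 2) * `|z|); last by ring.
    rewrite (_ : H ^+ 2 / 2 * (phi z * (1 + z ^+ 2) ^+ 2) =
      H ^+ 2 / 2 * phi z * (1 + z ^+ 2) * (1 + z ^+ 2)); last by ring.
    rewrite ler_wpM2l//; apply: mulr_ge0; last lra.
    by apply: mulr_ge0 => //; apply: divr_ge0 => //; exact: exprn_ge0.
  apply: (@le_trans _ _ (H ^+ 2 / 2 * 16)); last by lra.
  by rewrite ler_wpM2l// divr_ge0// exprn_ge0.
set A := Phi _ - _ in t1 *; set B := h * _ in t2 *; set C := _ * (z * _) in t3 *.
apply: (@le_trans _ _ ((`|A| + `|B| + `|C|) * (1 + z ^+ 2))).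
  rewrite ler_wpM2r//; first lra.
  by rewrite (le_trans (ler_normD _ _))// lerD2r ler_normD.
by rewrite !mulrDl; move: t1 t2 t3; rewrite !mulrDr !mulr1; lra.
Qed.

End normal_taylor.

Section normal_scaling.
Context (R : realType).
Local Notation phi := (normal_pdf (0 : R) 1).
Local Notation Phi := (@std_normal_cdf R).

(** Here r = (1 + q)^(-1/2), the ratio of two successive scales. Everything follows from (1 - r) (1
    + r) = q r^2. *)
Let shrink_bounds (r q : R) : 0 <= q -> 0 < r -> r ^+ 2 * (1 + q) = 1 ->
  [/\ r <= 1, 1 - r <= q & `|1 - r - q / 2| <= q ^+ 2].
Proof.
move=> q0 r0 E; have r20 := sqr_ge0 r.
have r1 : r <= 1.
  rewrite leNgt; apply/negP => r1; have : 1 < r ^+ 2 by rewrite exprn_egt1.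
  by have := mulr_ge0 r20 q0; lra.
have E1 : (1 - r) * (1 + r) = q * r ^+ 2.
  by rewrite (_ : _ * _ = 1 - r ^+ 2); [rewrite -[in LHS]E; ring|ring].
have r21 : r ^+ 2 <= 1 by rewrite exprn_ile1// ltW.
have r10 : 0 < 1 + r by lra.
have rq : 1 - r <= q.
  by rewrite -(ler_pM2r r10) E1 ler_wpM2l//; lra.
split=> //; pose u := 1 - r - q / 2; rewrite -/u.
have E2 : (1 + r) * (2 * u) = - (q * ((2 * r + 1) * (1 - r))).
  have -> : (1 + r) * (2 * u) = 2 * ((1 - r) * (1 + r)) - q * (1 + r).
    by rewrite /u; field.
  by rewrite E1; ring.
have h : q * ((2 * r + 1) * (1 - r)) <= q * ((1 + r) * 2 * q).
  by rewrite ler_wpM2l// ler_pM//; lra.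
have h0 : 0 <= q * ((2 * r + 1) * (1 - r)) by rewrite mulr_ge0// mulr_ge0//; lra.
rewrite ler_norml; apply/andP; split.
  rewrite -(ler_pM2l r10); move: E2 h; rewrite expr2 => E2 h.
  have -> : (1 + r) * - (q * q) = - (q * ((1 + r) * 2 * q)) / 2 by field.
  have : (1 + r) * u = (1 + r) * (2 * u) / 2 by field.
  by lra.
rewrite -(ler_pM2l r10); apply: (@le_trans _ _ 0); last by rewrite mulr_ge0 ?sqr_ge0//; lra.
have : (1 + r) * u = (1 + r) * (2 * u) / 2 by field.
  by lra.
Qed.

(** Expansion in the variance. Its first-order term (q / 2) z phi(z) has the same form as the
    second-order term of [std_normal_cdf_taylor], so that the two cancel in conditional mean when q
    is the variance of the increment h. *)
Lemma std_normal_cdf_shrink (z r q : R) : 0 <= q <= 1 -> 0 < r ->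
  r ^+ 2 * (1 + q) = 1 ->
  `|Phi (z * r) - Phi z + q / 2 * (z * phi z)| * (1 + z ^+ 2)
    <= 3 * 12 ^+ 3 * q ^+ 2.
Proof.
move=> /andP[q0 q1] r0 E; have [r1 rq rq2] := shrink_bounds q0 r0 E.
have z0 := sqr_ge0 z; have p0 := std_normal_pdf_ge0 z; have zz := norm_le_sqr z.
(* For q <= 1 the square of r is at least 1/2, so phi is at most exp (- z^2 / 4) between z r and
   z. *)
set e := expR (- (z ^+ 2 / 4)).
have e0 : 0 <= e by exact: expR_ge0.
pose M := 2 * `|z| * e.
have M0 : 0 <= M by rewrite !mulr_ge0.
have zrE : `|z * r - z| = `|z| * (1 - r).
  rewrite (_ : z * r - z = - (z * (1 - r))); last by ring.
  by rewrite normrN normrM (ger0_norm (_ : 0 <= 1 - r))//; lra.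
have zr : `|z * r - z| <= `|z| * q by rewrite zrE ler_wpM2l.
have d2 x : `|x - z| <= `|z * r - z| -> `|- (x * phi x)| <= M.
  rewrite zrE => xz; rewrite normrN normrM (ger0_norm (std_normal_pdf_ge0 x)).
  have xz1 : `|x| <= 2 * `|z|.
    have := ler_normD z (x - z); rewrite addrC subrK.
    by have := ler_wpM2l (normr_ge0 z) (_ : 1 - r <= 1); lra.
  have xz2 : `|z| * r <= `|x|.
    by have := ler_normB x (x - z); rewrite opprB addrC subrK; lra.
  apply: ler_pM => //; first exact: std_normal_pdf_ge0.
  apply: le_trans (std_normal_pdf_le_expR x) _; rewrite ler_expR lerN2.
  have h : (`|z| * r) ^+ 2 <= `|x| ^+ 2.
    by apply: lerXn2r; rewrite ?nnegrE// mulr_ge0// ltW.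
  rewrite exprMn !real_normK ?num_real// in h.
  have : z ^+ 2 * (r ^+ 2 * (1 + q)) = z ^+ 2 by rewrite E mulr1.
  have := ler_wpM2l (mulr_ge0 z0 (sqr_ge0 r)) q1.
  by rewrite mulrDr; lra.
have d1 x : `|x - z| <= `|z * r - z| -> `|phi x - phi z| <= M * `|z * r - z|.
  move=> xz; apply: le_trans (@mean_value_le R _ _ z x M (@is_derive_std_normal_pdf R) _) _.
    by move=> y yx; apply: d2; exact: le_trans xz.
  by rewrite ler_wpM2l.
have dG (y : R) : is_derive y 1 (fun y => Phi y - Phi z - (y - z) * phi z) (phi y - phi z).
  have := is_derive_std_normal_cdf y => H.
  by apply: is_derive_eq; rewrite /GRing.scale/=; ring.
have := @mean_value_le R _ _ z (z * r) _ dG d1.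
rewrite !subrr mul0r !subr0 => H.
have H1 : `|Phi (z * r) - Phi z - (z * r - z) * phi z| <= M * (`|z| * q) * (`|z| * q).
  apply: le_trans H _; apply: ler_pM => //; first by rewrite mulr_ge0.
  by rewrite ler_wpM2l.
set A := Phi (z * r) - _ in H1 *.
have -> : A + q / 2 * (z * phi z) =
    A - (z * r - z) * phi z - (1 - r - q / 2) * (z * phi z) by ring.
set B := A - _ in H1 *; set C := _ * (z * _).
have HC : `|C| * (1 + z ^+ 2) <= 16 * q ^+ 2.
  rewrite /C !normrM (ger0_norm p0).
  apply: (@le_trans _ _ (q ^+ 2 * (phi z * (1 + z ^+ 2) ^+ 2))).
    rewrite -mulrA ler_pM//; first by rewrite !mulr_ge0//; lra.
    rewrite [X in X * _]mulrC -mulrA ler_wpM2l// expr2 ler_wpM2r//; lra.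
  by rewrite [leRHS]mulrC ler_wpM2l ?sqr_ge0// std_normal_pdf_sqr_le.
have HB : `|B| * (1 + z ^+ 2) <= 2 * 12 ^+ 3 * q ^+ 2.
  apply: (@le_trans _ _ (M * (`|z| * q) * (`|z| * q) * (1 + z ^+ 2))).
    by rewrite ler_wpM2r//; lra.
  have -> : M * (`|z| * q) * (`|z| * q) * (1 + z ^+ 2) =
      2 * q ^+ 2 * (e * (`|z| * `|z| ^+ 2 * (1 + z ^+ 2))).
    by rewrite /M; ring.
  rewrite (_ : 2 * 12 ^+ 3 * q ^+ 2 = 2 * q ^+ 2 * 12 ^+ 3); last by rewrite mulrAC.
  rewrite ler_wpM2l ?mulr_ge0 ?sqr_ge0//.
  apply: le_trans (expRN_sqr_quarter_le z); rewrite -/e ler_wpM2l//.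
  rewrite real_normK ?num_real// [leRHS]exprSr ler_wpM2r//; first lra.
  by rewrite expr2 ler_pM//; lra.
apply: (@le_trans _ _ ((`|B| + `|C|) * (1 + z ^+ 2))).
  by rewrite ler_wpM2r ?ler_normB//; lra.
rewrite mulrDl; apply: (@le_trans _ _ (2 * 12 ^+ 3 * q ^+ 2 + 16 * q ^+ 2)).
  exact: lerD.
have h : 16 <= 12 ^+ 3 :> R by rewrite -natrX ler_nat.
have := ler_wpM2r (sqr_ge0 q) h; move: (12 ^+ 3) => K.
by rewrite -!mulrA; lra.
Qed.

(** A cruder version that allows q up to 2, for the passage from the initial variance 1 + dl^2 + a^2
    to 1. Now r^2 >= 1/3, whence the exponent z^2 / 6. *)
Lemma std_normal_cdf_shrink_le (z r q : R) : 0 <= q <= 2 -> 0 < r ->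
  r ^+ 2 * (1 + q) = 1 -> `|Phi (z * r) - Phi z| <= 3 * q.
Proof.
move=> /andP[q0 q2] r0 E; have [r1 rq _] := shrink_bounds q0 r0 E.
have z0 := sqr_ge0 z.
pose M := expR (- (z ^+ 2 / 6)).
have := @mean_value_le R _ _ z (z * r) M (@is_derive_std_normal_cdf R).
have -> : `|z * r - z| = `|z| * (1 - r).
  rewrite (_ : z * r - z = - (z * (1 - r))); last by ring.
  by rewrite normrN normrM (ger0_norm (_ : 0 <= 1 - r))//; lra.
move=> H; apply: le_trans (H _) _ => [x xz|].
  rewrite (ger0_norm (std_normal_pdf_ge0 x)).
  apply: le_trans (std_normal_pdf_le_expR x) _; rewrite ler_expR lerN2.
  have xz2 : `|z| * r <= `|x|.
    by have := ler_normB x (x - z); rewrite opprB addrC subrK; lra.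
  have h : (`|z| * r) ^+ 2 <= `|x| ^+ 2.
    by apply: lerXn2r; rewrite ?nnegrE// mulr_ge0// ltW.
  rewrite exprMn !real_normK ?num_real// in h.
  have : z ^+ 2 * (r ^+ 2 * (1 + q)) = z ^+ 2 by rewrite E mulr1.
  have := ler_wpM2l (mulr_ge0 z0 (sqr_ge0 r)) q2.
  by rewrite mulrDr; lra.
rewrite mulrA; apply: ler_pM => //; [by rewrite mulr_ge0 ?expR_ge0|lra|].
rewrite /M expRN mulrC ler_pdivrMr ?expR_gt0//.
have := expR_ge1Dx (z ^+ 2 / 6); rewrite -(real_normK (num_real z)).
by have := sqr_ge0 (`|z| - 1); rewrite sqrrB expr1n mulr1; lra.
Qed.

End normal_scaling.

Section level_sets.
Context (R : realType) d (T : measurableType d).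
Implicit Types X Y : T -> R.

Lemma measurable_gt X (r : R) : measurable_fun setT X -> measurable [set w | r < X w].
Proof.
move=> mX; have := mX measurableT _ (measurable_itv `]r, +oo[).
by rewrite setTI; congr measurable; apply/seteqP; split=> w /=; rewrite in_itv/= andbT.
Qed.

Lemma measurable_le X (r : R) : measurable_fun setT X -> measurable [set w | X w <= r].
Proof.
move=> mX; have := mX measurableT _ (measurable_itv `]-oo, r]).
by rewrite setTI; congr measurable; apply/seteqP; split=> w /=; rewrite in_itv.
Qed.

Lemma prob_le (P : probability T R) (A B : set T) : measurable A -> measurable B ->
  A `<=` B -> fine (P A) <= fine (P B).
Proof.
move=> mA mB AB; apply: fine_le; rewrite ?fin_num_measure//.
by apply: le_measure; rewrite ?inE.
Qed.

Lemma prob_ge0 (P : probability T R) (A : set T) : 0 <= fine (P A).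
Proof. exact: fine_ge0. Qed.

Lemma prob_le1 (P : probability T R) (A : set T) : measurable A -> fine (P A) <= 1.
Proof.
by move=> mA; rewrite -lee_fin fineK ?fin_num_measure// probability_le1.
Qed.

End level_sets.

(** * Comparison of expectations with the normal law *)

(** The expectation of a nonnegative variable is the integral of its tail; as the variables are at
    most 1, only levels in [0, 1] contribute, and the error [D] is integrated over a set of measure
    1. *)
Lemma Ex_le_of_tail (R : realType) d (T : measurableType d) d' (T' : measurableType d')
    (P : probability T R) (P' : probability T' R)
    (X : T -> R) (X' : T' -> R) (D : R) :
  measurable_fun setT X -> measurable_fun setT X' -> 0 <= D ->
  (forall w, 0 <= X w <= 1) -> (forall w, 0 <= X' w <= 1) ->
  (forall r, fine (P [set w | r < X w]) <= fine (P' [set w | r < X' w]) + D) ->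
  Ex P X <= Ex P' X' + D.
Proof.
move=> mX mX' D0 X01 X01' H.
pose rX : {RV P >-> R} := HB.pack X (isMeasurableFun.Build _ _ _ _ X mX).
pose rX' : {RV P' >-> R} := HB.pack X' (isMeasurableFun.Build _ _ _ _ X' mX').
have iX : L1 P X.
  by apply: (@L1_bnd _ _ _ _ _ 1) => // w; have /andP[? ?] := X01 w; rewrite ger0_norm.
have iX' : L1 P' X'.
  by apply: (@L1_bnd _ _ _ _ _ 1) => // w; have /andP[? ?] := X01' w; rewrite ger0_norm.
have E := @ge0_expectation_ccdf _ _ _ P rX (fun w => proj1 (andP (X01 w))).
have E' := @ge0_expectation_ccdf _ _ _ P' rX' (fun w => proj1 (andP (X01' w))).
rewrite expectation_def ExE// in E; rewrite expectation_def ExE// in E'.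
have cE r : ccdf rX r = (fine (P [set w | r < X w]))%:E.
  rewrite fineK; last by apply: fin_num_measure; exact: measurable_gt.
  rewrite /ccdf /distribution /pushforward; congr (P _).
  by apply/seteqP; split=> w /=; rewrite in_itv/= andbT.
have cE' r : ccdf rX' r = (fine (P' [set w | r < X' w]))%:E.
  rewrite fineK; last by apply: fin_num_measure; exact: measurable_gt.
  rewrite /ccdf /distribution /pushforward; congr (P' _).
  by apply/seteqP; split=> w /=; rewrite in_itv/= andbT.
rewrite -lee_fin EFinD E E'.
have mI : measurable (`[0, 1]%classic : set R) by exact: measurable_itv.
have -> : (D%:E = \int[lebesgue_measure]_(r in `[0%R, +oo[) (D * \1_(`[0, 1]) r)%:E)%E.
  rewrite -[LHS]mule1 (_ : 1%E = lebesgue_measure (`[0%R, 1%R] `&` `[0%R, +oo[ : set R)).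
    rewrite -integral_indic//.
    rewrite -ge0_integralZl//.
    by apply/measurable_EFinP; apply: measurable_funTS; exact: measurable_indic.
  rewrite (_ : _ `&` _ = `[0%R, 1%R]%classic); last first.
    by apply/seteqP; split=> r /=; rewrite !in_itv/= ?andbT; [case|move=> /andP[-> ->]].
  by rewrite lebesgue_measure_itv/= lte_fin ltr01 oppr0 adde0.
have mcc : measurable_fun (`[0, +oo[%classic : set R) (ccdf rX).
  by apply: measurable_funTS; exact: ccdf_measurable.
have mcc' : measurable_fun (`[0, +oo[%classic : set R) (ccdf rX').
  by apply: measurable_funTS; exact: ccdf_measurable.
have mD : measurable_fun (`[0, +oo[%classic : set R) (fun r => (D * \1_`[0, 1] r)%:E).
  by apply/measurable_EFinP; apply: measurable_funTS; apply: measurable_funM => //; exact: measurable_indic.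
have D1 r : (0 <= (D * \1_`[0, 1] r)%:E)%E by rewrite lee_fin mulr_ge0.
have c0 r : (0 <= ccdf rX r)%E by rewrite cE lee_fin prob_ge0.
have c0' r : (0 <= ccdf rX' r)%E by rewrite cE' lee_fin prob_ge0.
rewrite -ge0_integralD//.
apply: ge0_le_integral => //; first exact: emeasurable_funD.
move=> r /=; rewrite in_itv/= andbT => r0; rewrite cE cE' -EFinD lee_fin.
rewrite indicE; have [r1|r1] := leP r 1.
  by rewrite mem_set ?mulr1//= in_itv/= r0.
rewrite memNset ?mulr0 ?addr0; last by rewrite /= in_itv/= r0/= leNgt r1.
rewrite (_ : [set w | r < X w] = set0) ?measure0 ?prob_ge0//.
apply/seteqP; split=> w //=; have /andP[_ h] := X01 w.
by move=> /(lt_trans r1); rewrite ltNge h.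
Qed.

Section normal_comparison.
Context (R : realType) d (T : measurableType d) (Q : probability T R).
Variables (X : T -> R) (D : R).
Hypothesis mX : measurable_fun setT X.
Hypothesis XD : forall y,
  `|fine (Q [set w | X w <= y]) - std_normal_cdf y| <= D.

Local Notation Phi := (@std_normal_cdf R).
Local Notation gamma := (std_normal R).

Let D_ge0 : 0 <= D.
Proof. exact: le_trans (XD 0). Qed.

Let gammaE y : fine (gamma [set u | u <= y]) = Phi y.
Proof.
by rewrite (_ : [set u | u <= y] = `]-oo, y]%classic) ?std_normal_cdfE.
Qed.

Let m_id : measurable_fun [set: R] (fun u : R => u).
Proof. exact: measurable_id. Qed.

(* A set closed downwards is a half-line, open or closed. *)
Lemma normal_comparison_downset (S : set R) : measurable S ->
  (forall u v, S v -> u <= v -> S u) ->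
  `|fine (Q (X @^-1` S)) - fine (gamma S)| <= D.
Proof.
move=> mS Sdown.
have mXS : measurable (X @^-1` S) by rewrite -[X in measurable X]setTI; exact: mX.
have [[v0 Sv0]|S0] := pselect (exists v, S v); last first.
  have -> : S = set0 by apply/seteqP; split=> v //= Sv; apply: S0; exists v.
  by rewrite preimage_set0 !measure0/= subrr normr0.
have [[y0 yub]|nub] := pselect (exists y, forall v, S v -> v <= y); last first.
  have -> : S = setT.
    apply/seteqP; split=> v // _; apply: contrapT => nSv; apply: nub; exists v => u Su.
    by rewrite leNgt; apply/negP => /ltW vu; apply: nSv; exact: Sdown vu.
  by rewrite preimage_setT !probability_setT subrr normr0.
have hs : has_sup S by split; [exists v0|exists y0 => v; exact: yub].
pose y := sup S.
have Sy v : S v -> v <= y by move=> Sv; apply: ub_le_sup => //; case: hs.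
have yS v : v < y -> S v.
  move=> vy; have vy0 : 0 < y - v by rewrite subr_gt0.
  have [u Su vu] := sup_adherent vy0 hs.
  by apply: (Sdown _ _ Su); rewrite -/y in vu; lra.
have ub1 : fine (Q (X @^-1` S)) <= fine (Q [set w | X w <= y]).
  by apply: prob_le => //; [exact: measurable_le|move=> w; exact: Sy].
have ub2 : fine (gamma S) <= Phi y.
  rewrite -gammaE; apply: prob_le => //; first exact: (@measurable_le R _ _ (fun u => u)).
have lb e : 0 < e -> fine (Q [set w | X w <= y - e]) <= fine (Q (X @^-1` S)).
  move=> e0; apply: prob_le => //; first exact: measurable_le.
  by move=> w /= h; apply: yS; rewrite (le_lt_trans h)// ltrBlDr ltrDl.
have lb2 e : 0 < e -> Phi (y - e) <= fine (gamma S).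
  move=> e0; rewrite -gammaE; apply: prob_le => //; first exact: (@measurable_le R _ _ (fun u => u)).
  by move=> u /= h; apply: yS; rewrite (le_lt_trans h)// ltrBlDr ltrDl.
apply/ler_addgt0Pl => e e0.
have c := @std_normal_cdf_lipschitz R y (y - e).
rewrite (_ : y - (y - e) = e) in c; last by ring.
rewrite (gtr0_norm e0) in c.
have := XD y; have := XD (y - e); have := lb e e0; have := lb2 e e0.
move: c; rewrite !ler_norml => /andP[? ?] ? ? /andP[? ?] /andP[? ?].
by apply/andP; split; lra.
Qed.

(** The sets where a nonincreasing function exceeds a level are closed downwards, so the comparison
    of half-lines passes to [h] through [Ex_le_of_tail]. *)
Lemma Ex_normal_comparison (h : R -> R) : measurable_fun setT h ->
  (forall u v, u <= v -> h v <= h u) -> (forall u, 0 <= h u <= 1) ->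
  `|Ex Q (fun w => h (X w)) - Ex gamma h| <= D.
Proof.
move=> mh hdec h01.
have mhX : measurable_fun setT (fun w => h (X w)) by exact: (measurableT_comp mh mX).
have H r := normal_comparison_downset (measurable_gt r mh)
  (fun u v (hv : r < h v) uv => lt_le_trans hv (hdec u v uv)).
rewrite ler_norml; apply/andP; split.
  rewrite lerBrDr addrC lerBlDr; apply: Ex_le_of_tail => // r.
  by have := H r; rewrite ler_norml /preimage/= => /andP[? ?]; lra.
rewrite lerBlDr addrC; apply: Ex_le_of_tail => // r.
by have := H r; rewrite ler_norml /preimage/= => /andP[? ?]; lra.
Qed.

End normal_comparison.

Lemma measurable_std_normal_cdf (R : realType) :
  measurable_fun [set: R] (@std_normal_cdf R).
Proof.
apply: continuous_measurable_fun => s; apply: differentiable_continuous.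
by apply/derivable1_diffP; have := is_derive_std_normal_cdf s.
Qed.

(** * Anticoncentration and removal of the smoothing *)

Section smoothing.
Context (R : realType) d (T : measurableType d) (Q : probability T R).
Variables (X : T -> R) (D : R).
Hypothesis mX : measurable_fun setT X.
Hypothesis XD : forall y,
  `|fine (Q [set w | X w <= y]) - std_normal_cdf y| <= D.

Local Notation Phi := (@std_normal_cdf R).
Local Notation gamma := (std_normal R).
Local Notation F := (fun y => fine (Q [set w | X w <= y])).

Lemma measurable_norm_le (y r : R) : measurable [set w | `|X w - y| <= r].
Proof.
by apply: measurable_le; apply: measurableT_comp => //; exact: measurable_funB.
Qed.

Lemma normal_comparison_ball (y r : R) : 0 < r ->
  fine (Q [set w | `|X w - y| <= r]) <= 2 * D + 3 * r.
Proof.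
(* The lower half-line stops at y - 2 r rather than y - r to be disjoint from the closed ball; hence
   the length 3 r. *)
move=> r0; pose A := [set w | X w <= y + r]; pose B := [set w | X w <= y - 2 * r].
have mA : measurable A by exact: measurable_le.
have mB : measurable B by exact: measurable_le.
have h1 : fine (Q [set w | `|X w - y| <= r]) + fine (Q B) <= fine (Q A).
  rewrite -fineD ?fin_num_measure//; last exact: measurable_norm_le.
  rewrite -measureU//; [|exact: measurable_norm_le|].
    apply: prob_le => //; first by apply: measurableU => //; exact: measurable_norm_le.
    move=> w [/=|]; first by rewrite ler_norml /A/= => /andP[_]; lra.
    by rewrite /A /B/=; lra.
  by apply/seteqP; split=> w //= -[]; rewrite ler_norml /B/= => /andP[]; lra.
have := XD (y + r); have := XD (y - 2 * r); rewrite -/A -/B.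
have := @std_normal_cdf_lipschitz R (y + r) (y - 2 * r).
rewrite (_ : y + r - (y - 2 * r) = 3 * r); last by ring.
rewrite (ger0_norm (_ : 0 <= 3 * r)); last lra.
by rewrite !ler_norml => /andP[? ?] /andP[? ?] /andP[? ?]; lra.
Qed.

(** The inverse distance to y, capped at 2^J; the dyadic cap allows an induction over scales. *)
Let dist J (y : R) (w : T) : R := (Num.max (2 ^- J) `|X w - y|)^-1.

Let dist_pos J y w : 0 < Num.max (2 ^- J) `|X w - y|.
Proof. by rewrite lt_max invr_gt0 exprn_gt0. Qed.

Let mdist J y : measurable_fun setT (dist J y).
Proof.
apply: measurableT_comp; first exact: invr_measurable.
apply: measurable_maxr => //.
by apply: measurableT_comp => //; exact: measurable_funB.
Qed.

Let dist_le J y w : dist J y w <= 2 ^+ J.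
Proof.
rewrite /dist -[leRHS]invrK lef_pV2 ?posrE ?dist_pos ?invr_gt0 ?exprn_gt0//.
by rewrite le_max lexx.
Qed.

Let L1_dist J y : L1 Q (dist J y).
Proof.
apply: (@L1_bnd _ _ _ _ _ (2 ^+ J)) => // w.
by rewrite ger0_norm// invr_ge0 ltW.
Qed.

(** Raising the cap from 2^J to 2^(J+1) matters only in the ball of radius 2^(-J), of probability at
    most 2 D + 3 2^(-J). Each scale thus costs the constant 6 and a multiple of D that grows
    geometrically. *)
Let Ex_dist J y : Ex Q (dist J y) <= 1 + 6 * J%:R + 2 ^+ J.+2 * D.
Proof.
have D0 : 0 <= D by exact: le_trans (XD 0).
elim: J => [|J ih].
  rewrite mulr0 addr0; apply: (@le_trans _ _ 1); last by rewrite lerDl mulr_ge0.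
  rewrite -[leRHS](Ex_cst Q 1); apply: (Ex_le (L1_dist _ _) (L1_cst _ _)).
  by move=> w; have := dist_le 0 y w; rewrite expr0.
pose B := [set w | `|X w - y| <= 2 ^- J].
have mB : measurable B by exact: measurable_norm_le.
have iB := L1_indic Q mB.
have : Ex Q (dist J.+1 y) <= Ex Q (fun w => dist J y w + 2 ^+ J.+1 * \1_B w).
  apply: (Ex_le (L1_dist _ _) (L1D (L1_dist _ _) (L1Z _ iB))).
  move=> w; rewrite indicE; have [wB|wB] := boolP (w \in B).
    rewrite mulr1 (le_trans (dist_le _ _ _))// lerDr invr_ge0 ltW//.
  rewrite mulr0 addr0.
  have {}wB : 2 ^- J < `|X w - y|.
    by rewrite ltNge; apply/negP => h; move/negP : wB; apply; rewrite inE.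
  have wB' : 2 ^- J.+1 < `|X w - y|.
    apply: le_lt_trans wB; rewrite lef_pV2 ?posrE ?exprn_gt0//.
    by rewrite exprS ler_peMl ?exprn_ge0// ler1n.
  by rewrite /dist !max_r// ltW.
rewrite (ExD (L1_dist J y) (L1Z _ iB)) (ExZ _ iB) Ex_indic//.
have J0 : 0 < 2 ^- J :> R by rewrite invr_gt0 exprn_gt0.
have H : 2 ^+ J.+1 * fine (Q B) <= 2 ^+ J.+2 * D + 6.
  apply: (@le_trans _ _ (2 ^+ J.+1 * (2 * D + 3 * 2 ^- J))).
    by rewrite ler_wpM2l ?exprn_ge0//; exact: normal_comparison_ball.
  rewrite !exprS; have : (2 ^+ J : R) * 2 ^- J = 1 by rewrite divff// expf_neq0.
  move: (2 ^+ J) (2 ^- J) => u v uv.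
  have -> : 2 * u * (2 * D + 3 * v) = 2 * (2 * u) * D + 6 * (u * v) by ring.
  by rewrite uv mulr1.
have -> : (2 : R) ^+ J.+3 * D = 2 ^+ J.+2 * D + 2 ^+ J.+2 * D.
  by rewrite exprS; ring.
by rewrite -natr1; lra.
Qed.

(** Take the first dyadic scale below [a]. The number of scales is of order |ln a|, and the
    geometric growth ends at 2^J <= 2 / a, which gives the term D / a. *)
Lemma Ex_inv_dist_le (a y : R) : 0 < a <= 1 ->
  Ex Q (fun w => (a + `|X w - y|)^-1) <= 7 + 12 * `|ln a| + 8 * D / a.
Proof.
move=> /andP[a0 a1].
have D0 : 0 <= D by exact: le_trans (XD 0).
have exJ : exists J : nat, 2 ^- J <= a.
  pose k := Num.truncn a^-1; exists k.+1.
  have h : a^-1 < k.+1%:R by apply: real_truncnS_gt; exact: num_real.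
  rewrite -[leRHS]invrK lef_pV2 ?posrE ?invr_gt0 ?exprn_gt0//.
  apply: (le_trans (ltW h)); rewrite -natrX ler_nat.
  by rewrite ltnW// ltn_expl.
have [J JE Jmin] := ex_minnP exJ.
have J2 : 2 ^+ J <= 2 / a.
  case: J JE Jmin => [|J] JE Jmin.
    by rewrite expr0 ler_pdivlMr//; lra.
  have : a < 2 ^- J by rewrite ltNge; apply/negP => /Jmin; rewrite ltnn.
  rewrite -[X in X < _]invrK ltf_pV2 ?posrE ?invr_gt0 ?exprn_gt0// => h.
  by rewrite exprS ler_pM2l// ltW.
have JL : J%:R <= 1 + 2 * `|ln a|.
  have l2 : 2^-1 <= ln 2 :> R.
    have h : -1 < - (2^-1 : R) by lra.
    have := le_ln1Dx h; rewrite (_ : 1 + - 2^-1 = 2^-1); last by field.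
    by rewrite lnV ?posrE//; lra.
  have la : ln a <= 0 by exact: ln_le0.
  have : ln (2 ^+ J) <= ln (2 / a) by rewrite ler_ln ?posrE ?exprn_gt0 ?divr_gt0.
  rewrite lnXn// -[ln 2 *+ J]mulr_natl ln_div ?posrE// (ler0_norm la) => h.
  have [J0|J1] := leqP J 1.
    have : J%:R <= 1 :> R by rewrite lern1.
    by lra.
  have J1' : 1 <= J%:R :> R by rewrite ler1n ltnW.
  have J2' : 0 <= J%:R - 1 :> R by lra.
  have := ler_wpM2l J2' l2.
  by rewrite !mulrBl !mul1r; lra.
have inv0 w : 0 < a + `|X w - y| by rewrite ltr_pwDl.
have H : Ex Q (fun w => (a + `|X w - y|)^-1) <= Ex Q (dist J y).
  apply: (Ex_le _ (L1_dist _ _)).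
    apply: (@L1_bnd _ _ _ _ _ a^-1).
      apply: measurableT_comp; first exact: invr_measurable.
      apply: measurable_funD => //.
      by apply: measurableT_comp => //; exact: measurable_funB.
    move=> w; rewrite ger0_norm ?invr_ge0 ?(ltW (inv0 w))//.
    by rewrite lef_pV2 ?posrE// lerDl.
  move=> w; rewrite /dist lef_pV2 ?posrE ?dist_pos// ge_max.
  by apply/andP; split; [rewrite (le_trans JE)// lerDl|rewrite lerDr ltW].
apply: (le_trans H); apply: (le_trans (Ex_dist J y)).
have : 2 ^+ J * D <= 2 / a * D by rewrite ler_wpM2r.
rewrite !exprS => h; have -> : 8 * D / a = 4 * (2 / a * D) by field; rewrite gt_eqF.
by lra.
Qed.

(** The usual argument compares [F z] with the smoothed value at a shifted level and loses only the
    shift, but requires control of the smoothing error far from z. Here the shift is 2 b and Phi(2)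
    >= 3/4, so [f] captures at least 3/4 of the event; the excess over 3/4 is a monotone function of
    [X] with values in [0, 1/4], which the normal comparison evaluates up to D / 4. Dividing by 3/4
    gives D / 3, and 4 b becomes 16 b / 3. *)
Lemma smoothing_inequality (f : R -> T -> R) (b e : R) : 0 < b ->
  (forall y, measurable_fun setT (f y)) ->
  (forall y w, 0 <= f y w <= 1) ->
  (forall y w, X w <= y -> Phi ((y - X w) / b) <= f y w) ->
  (forall y w, y <= X w -> f y w <= Phi ((y - X w) / b)) ->
  (forall y, `|Ex Q (f y) - Phi y| <= e) ->
  forall z, `|F z - Phi z| <= 4 / 3 * e + 16 / 3 * b + D / 3.
Proof.
move=> b0 mf f01 flo fup fe z.
have D0 : 0 <= D by exact: le_trans (XD 0).
have if_ y : L1 Q (f y).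
  apply: (@L1_bnd _ _ _ _ _ 1) => // w; have /andP[? ?] := f01 y w.
  by rewrite ger0_norm.
have quarter : expR (- 2) <= 4^-1 :> R.
  rewrite expRN lef_pV2 ?posrE ?expR_gt0//.
  have := @expR_ge_exprn R 1 2 (ler0n _ _).
  by rewrite divff// (_ : (1 + 1) ^+ 2 = 4) //; ring.
have tail (s : R) : 2 <= s -> expR (- (s ^+ 2 / 2)) <= expR (- s).
  move=> s2; rewrite ler_expR lerN2 expr2.
  by have := ler_wpM2l (_ : 0 <= s) s2; rewrite -mulrA; lra.
have Phi2 (s : R) : 2 <= s -> 3 / 4 <= Phi s.
  move=> s2; have := @std_normal_ccdf_tail R s; have := tail _ s2.
  have : expR (- s) <= expR (- 2) by rewrite ler_expR lerN2.
  by move=> h1 h2 h3; have := h3 (_ : 0 <= s); lra.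
have PhiN2 (s : R) : s <= - 2 -> Phi s <= 4^-1.
  move=> s2; have := @std_normal_cdf_tail R s; have := tail (- s).
  rewrite sqrrN => h1 h3.
  have : expR (- - s) <= expR (- 2) by rewrite ler_expR; lra.
  by have := h1 (_ : 2 <= - s); have := h3 (_ : s <= 0); lra.
have P01 (s : R) : 0 <= Phi s <= 1 by rewrite std_normal_cdf_ge0 std_normal_cdf_le1.
have mPhi := @measurable_std_normal_cdf R.
have gE := @Ex_std_normal_expRN R b^-1 z.
have {}gE : Ex gamma (fun u => expR (- (b^-1 * `|u - z|))) <= 2 * b.
  by have := gE (_ : 0 < b^-1); rewrite invr_gt0 invrK; apply.
have iexp : L1 gamma (fun u => expR (- (b^-1 * `|u - z|))).
  apply: (@L1_bnd _ _ _ _ _ 1).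
    apply: measurableT_comp => //; apply: measurableT_comp => //.
    apply: measurable_funM => //; apply: measurableT_comp => //.
    exact: measurable_funB.
  move=> u; rewrite ger0_norm ?expR_ge0// expR_le1 oppr_le0.
  by rewrite mulr_ge0// invr_ge0 ltW.
have FE y : Ex Q (\1_[set w | X w <= y]) = F y.
  by rewrite Ex_indic//; exact: measurable_le.
have GE : Ex gamma (\1_(`]-oo, z])) = Phi z by rewrite Ex_indic// std_normal_cdfE.
have iI : L1 gamma (\1_(`]-oo, z])) by exact: L1_indic.
have iF y : L1 Q (\1_[set w | X w <= y]) by apply: L1_indic; exact: measurable_le.
have mPhiy y : measurable_fun [set: R] (fun u => Phi ((y - u) / b)).
  by apply: measurableT_comp => //; apply: measurable_funM => //; exact: measurable_funB.
have I01 u : (\1_(`]-oo, z]) u : R) = if u <= z then 1 else 0.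
  rewrite indicE; case: ifPn => h; first by rewrite mem_set//= in_itv.
  by rewrite memNset//= in_itv/=; exact/negP.
have J01 y w : (\1_[set w | X w <= y] w : R) = if X w <= y then 1 else 0.
  rewrite indicE; case: ifPn => h; first by rewrite mem_set.
  by rewrite memNset//=; exact/negP.
have b10 : 0 < b^-1 by rewrite invr_gt0.
rewrite ler_norml; apply/andP; split.
(* Lower bound on [F z]. On {X > z} the smoothed indicator is at most Phi(-2) <= 1/4, and [k]
   records by how much it falls below 1/4. *)
- pose y := z - 2 * b.
  have yu u : (y - u) / b = - (b^-1 * (u - z)) - 2.
    by rewrite /y; field; rewrite gt_eqF.
  pose k u := (1 - \1_(`]-oo, z]) u) * (4^-1 - Phi ((y - u) / b)).
  have mk : measurable_fun [set: R] k.
    by apply: measurable_funM; apply: measurable_funB => //; exact: measurable_indic.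
  have k01 u : 0 <= k u <= 4^-1.
    rewrite /k I01; case: ifPn => [_|]; first by (rewrite subrr mul0r; apply/andP; split; lra).
    rewrite -ltNge subr0 mul1r yu => zu.
    have h : 0 <= b^-1 * (u - z) by rewrite mulr_ge0 ?subr_ge0 ?ltW.
    have h2 : - (b^-1 * (u - z)) - 2 <= - 2 by lra.
    have := PhiN2 _ h2; have /andP[? ?] := P01 (- (b^-1 * (u - z)) - 2).
    by move=> ?; apply/andP; split; lra.
  have kinc u v : u <= v -> k u <= k v.
    move=> uv; have [uz|zu] := leP u z.
      by rewrite {1}/k I01 uz subrr mul0r; have /andP[] := k01 v.
    have zv : z < v by exact: lt_le_trans uv.
    rewrite /k !I01 (lt_geF zu) (lt_geF zv) !subr0 !mul1r lerD2l lerN2.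
    by apply: std_normal_cdf_le; rewrite ler_pM2r// lerD2l lerN2.
  have ik : L1 gamma k.
    apply: (@L1_bnd _ _ _ _ _ 4^-1) => // u; have /andP[? ?] := k01 u.
    by rewrite ger0_norm.
  have ikX : L1 Q (fun w => k (X w)).
    apply: (@L1_bnd _ _ _ _ _ 4^-1); first exact: measurableT_comp.
    by move=> w; have /andP[? ?] := k01 (X w); rewrite ger0_norm.
  have cmp := @Ex_normal_comparison _ _ _ Q X D mX XD (fun u => 1 - 4 * k u).
  have {}cmp : `|(1 - 4 * Ex Q (fun w => k (X w))) - (1 - 4 * Ex gamma k)| <= D.
    rewrite -[X in `|X - _ - _|](Ex_cst Q) -[X in `|_ - (X - _)|](Ex_cst gamma).
    rewrite -(ExZ _ ikX) -(ExZ _ ik) -!ExB; try exact: L1_cst; try exact: L1Z.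
    apply: cmp.
    - by apply: measurable_funB => //; exact: measurable_funM.
    - by move=> u v /kinc; lra.
    - by move=> u; have /andP[? ?] := k01 u; apply/andP; split; lra.
  have gk : 4^-1 * (1 - Phi z) - 2 * b <= Ex gamma k.
    rewrite lerBlDr -lerBlDl; apply: le_trans gE.
    rewrite -[X in _ * (X - _)](Ex_cst gamma) -GE -ExB//; last exact: L1_cst.
    have iI1 : L1 gamma (fun u => 1 - \1_(`]-oo, z]) u) by apply: L1B => //; exact: L1_cst.
    rewrite -ExZ// -ExB//; last exact: L1Z.
    apply: Ex_le => //; first by apply: L1B => //; exact: L1Z.
    move=> u; rewrite /k I01; case: ifPn => [_|]; first by rewrite subrr mulr0 mul0r subrr expR_ge0.
    rewrite -ltNge => zu; rewrite subr0 mulr1 mul1r opprB addrCA subrr addr0 yu.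
    rewrite (gtr0_norm (_ : 0 < u - z)) ?subr_gt0//.
    have h : 0 <= b^-1 * (u - z) by rewrite mulr_ge0 ?subr_ge0 ?ltW.
    set s := b^-1 * _ in h *; have h2 : - s - 2 <= 0 by lra.
    have h3 : 2 <= - (- s - 2) by lra.
    apply: le_trans (std_normal_cdf_tail h2) _; rewrite -(sqrrN (- s - 2)).
    by apply: le_trans (tail _ h3) _; rewrite ler_expR; lra.
  have up : Ex Q (f y) <= 1 - 3 / 4 * (1 - F z) - Ex Q (fun w => k (X w)).
    rewrite -[X in 1 - _ * (X - _)](Ex_cst Q) -[X in _ <= X - _ - _](Ex_cst Q) -FE -ExB//; last exact: L1_cst.
    have i1 : L1 Q (fun w => 1 - \1_[set w | X w <= z] w) by apply: L1B => //; exact: L1_cst.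
    have i2 := L1Z (3 / 4) i1; have i3 := L1B (L1_cst Q 1) i2.
    rewrite -ExZ// -ExB//; last exact: L1_cst.
    rewrite -ExB//; apply: Ex_le => //; first exact: L1B.
    move=> w; rewrite /k I01 J01; case: ifPn => [_|].
      by rewrite subrr mulr0 mul0r !subr0; have /andP[] := f01 y w.
    rewrite -ltNge => zX; rewrite !subr0 mulr1 mul1r.
    have yX : y <= X w by rewrite /y; lra.
    by have := fup _ _ yX; lra.
  have := fe y; have := @std_normal_cdf_lipschitz R y z.
  rewrite (_ : y - z = - (2 * b)); last by rewrite /y; ring.
  rewrite normrN (ger0_norm (_ : 0 <= 2 * b)); last lra.
  by move: cmp; rewrite !ler_norml => /andP[? ?] /andP[? ?] /andP[? ?]; lra.
(* Upper bound on [F z], the mirror image: on {X <= z} the smoothed indicator is at least 3/4, and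
   [k] is the excess. *)
- pose y := z + 2 * b.
  have yu u : (y - u) / b = b^-1 * (z - u) + 2.
    by rewrite /y; field; rewrite gt_eqF.
  pose k u := \1_(`]-oo, z]) u * (Phi ((y - u) / b) - 3 / 4).
  have mk : measurable_fun [set: R] k.
    by apply: measurable_funM; [exact: measurable_indic|exact: measurable_funB].
  have k01 u : 0 <= k u <= 4^-1.
    rewrite /k I01; case: ifPn => [uz|_]; last by (rewrite mul0r; apply/andP; split; lra).
    rewrite mul1r yu.
    have h : 0 <= b^-1 * (z - u) by rewrite mulr_ge0 ?(ltW b10) ?subr_ge0.
    have h2 : 2 <= b^-1 * (z - u) + 2 by lra.
    have := Phi2 _ h2; have /andP[? ?] := P01 (b^-1 * (z - u) + 2).
    by move=> ?; apply/andP; split; lra.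
  have kdec u v : u <= v -> k v <= k u.
    move=> uv; have [vz|zv] := leP v z; last first.
      by rewrite {1}/k I01 (lt_geF zv) mul0r; have /andP[] := k01 u.
    have uz : u <= z by exact: le_trans vz.
    rewrite /k !I01 uz vz !mul1r lerD2r.
    by apply: std_normal_cdf_le; rewrite ler_pM2r// lerD2l lerN2.
  have ik : L1 gamma k.
    apply: (@L1_bnd _ _ _ _ _ 4^-1) => // u; have /andP[? ?] := k01 u.
    by rewrite ger0_norm.
  have ikX : L1 Q (fun w => k (X w)).
    apply: (@L1_bnd _ _ _ _ _ 4^-1); first exact: measurableT_comp.
    by move=> w; have /andP[? ?] := k01 (X w); rewrite ger0_norm.
  have cmp := @Ex_normal_comparison _ _ _ Q X D mX XD (fun u => 4 * k u).
  have {}cmp : `|4 * Ex Q (fun w => k (X w)) - 4 * Ex gamma k| <= D.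
    rewrite -(ExZ _ ikX) -(ExZ _ ik); apply: cmp.
    - exact: measurable_funM.
    - by move=> u v /kdec; lra.
    - by move=> u; have /andP[? ?] := k01 u; apply/andP; split; lra.
  have gk : 4^-1 * Phi z - 2 * b <= Ex gamma k.
    rewrite lerBlDr -lerBlDl; apply: le_trans gE.
    rewrite -GE -ExZ// -ExB//; last exact: L1Z.
    apply: Ex_le => //; first by apply: L1B => //; exact: L1Z.
    move=> u; rewrite /k I01; case: ifPn => [uz|_]; last by rewrite mulr0 mul0r subrr expR_ge0.
    rewrite mulr1 mul1r yu distrC (ger0_norm (_ : 0 <= z - u)) ?subr_ge0//.
    have h : 0 <= b^-1 * (z - u) by rewrite mulr_ge0 ?(ltW b10) ?subr_ge0.
    set s := b^-1 * _ in h *; have h2 : 0 <= s + 2 by lra.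
    have h3 : 2 <= s + 2 by lra.
    have := std_normal_ccdf_tail h2; have := tail _ h3.
    have : expR (- (s + 2)) <= expR (- s) by rewrite ler_expR; lra.
    by lra.
  have up : 3 / 4 * F z + Ex Q (fun w => k (X w)) <= Ex Q (f y).
    rewrite -FE -ExZ// -ExD//; last exact: L1Z.
    apply: Ex_le => //; first by apply: L1D => //; exact: L1Z.
    move=> w; rewrite /k I01 J01; case: ifPn => [Xz|_]; last first.
      by rewrite mulr0 mul0r addr0; have /andP[] := f01 y w.
    rewrite mulr1 mul1r.
    have Xy : X w <= y by rewrite /y; lra.
    by have := flo _ _ Xy; lra.
  have := fe y; have := @std_normal_cdf_lipschitz R y z.
  rewrite (_ : y - z = 2 * b); last by rewrite /y; ring.
  rewrite (ger0_norm (_ : 0 <= 2 * b)); last lra.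
  by move: cmp; rewrite !ler_norml => /andP[? ?] /andP[? ?] /andP[? ?]; lra.
Qed.

End smoothing.

(** * Approximate martingales *)

Lemma mart_sumS (R : realType) d (T : measurableType d) (x : nat -> T -> R) k w :
  mart_sum x k.+1 w = mart_sum x k w + x k.+1 w.
Proof. by rewrite /mart_sum big_nat_recr. Qed.

Lemma mart_sum0 (R : realType) d (T : measurableType d) (x : nat -> T -> R) w :
  mart_sum x 0 w = 0.
Proof. by rewrite /mart_sum big_geq. Qed.

Lemma mwrt_sub d (T : measurableType d) (R : realType) (G H : set (set T))
    (X : T -> R) : measurable_wrt G X -> G `<=` H -> measurable_wrt H X.
Proof. by move=> mX GH B mB; apply: GH; exact: mX. Qed.

Ltac mwrt_auto sG :=
  repeat first
    [ assumption
    | exact: (mwrt_cst sG)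
    | apply: (mwrtD sG)
    | apply: mwrtN
    | apply: (mwrtM sG)
    | apply: mwrtV
    | apply: mwrtX
    | apply: mwrt_abs ].

(** The variance budget left after k steps. The total 1 + dl^2 in place of 1 keeps it nonnegative
    under [am_sum_le]. *)
Definition remaining (R : realType) d (T : measurableType d)
  (s : nat -> T -> R) (dl : R) k w : R := 1 + dl ^+ 2 - mart_sum s k w.

Lemma filtration_sub (T : Type) (F : nat -> set (set T)) n k j :
  (forall i, (i < n)%N -> F i `<=` F i.+1) -> (k <= j <= n)%N -> F k `<=` F j.
Proof.
move=> FS; elim: j => [|j ih] /andP[kj jn]; first by move: kj; rewrite leqn0 => /eqP ->.
move: kj; rewrite leq_eqVlt => /predU1P[->//|kj].
by apply: subset_trans (FS _ jn); apply: ih; rewrite -ltnS kj ltnW.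
Qed.

(* Increments [eta] which, conditionally on the past, have mean and variance close to 0 and [s], and small third moments. *)
Record approx_martingale (R : realType) d (T : measurableType d)
    (Q : probability T R) (n : nat) (F : nat -> set (set T))
    (eta s : nat -> T -> R) (e dl al be K : R) : Prop := {
  am_sigma : forall k, (k <= n)%N -> sigma_algebra setT (F k);
  am_sub : forall k, (k <= n)%N -> F k `<=` measurable;
  am_filtration : forall k, (k < n)%N -> F k `<=` F k.+1;
  am_adapted : forall k, (k < n)%N -> measurable_wrt (F k.+1) (eta k.+1);
  am_predictable : forall k, (k < n)%N -> measurable_wrt (F k) (s k.+1);
  am_s_ge0 : forall k w, 0 <= s k w;
  am_s_le : forall k w, s k w <= 12 * e ^+ 2;
  am_sum_le : forall w, mart_sum s n w <= 1 + dl ^+ 2;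
  am_weight : forall k W, (k < n)%N -> measurable_wrt (F k) W ->
    (forall w, 0 <= W w) -> L1 Q W ->
    [/\ L1 Q (fun w => W w * `|eta k.+1 w| ^+ 3),
        `|Ex Q (fun w => W w * eta k.+1 w)| <= al * Ex Q (fun w => W w * s k.+1 w),
        `|Ex Q (fun w => W w * eta k.+1 w ^+ 2) - Ex Q (fun w => W w * s k.+1 w)|
          <= be * Ex Q (fun w => W w * s k.+1 w) &
        Ex Q (fun w => W w * `|eta k.+1 w| ^+ 3)
          <= K * e * Ex Q (fun w => W w * s k.+1 w)];
  am_e : 0 < e;
  am_dl : 0 <= dl <= 1;
  am_al : 0 <= al <= 1;
  am_be : 0 <= be <= 1 }.

Section approximate_martingale.
Context (R : realType) d (T : measurableType d) (Q : probability T R).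
Variables (n : nat) (F : nat -> set (set T)) (eta s : nat -> T -> R).
Variables (e dl al be K : R).
Hypothesis AM : approx_martingale Q n F eta s e dl al be K.

Local Notation S := (mart_sum eta).
Local Notation V := (mart_sum s).

Let sF := am_sigma AM.
Let Fm := am_sub AM.
Let FS := am_filtration AM.
Let meta := am_adapted AM.
Let ms := am_predictable AM.
Let s_ge0 := am_s_ge0 AM.
Let s_le := am_s_le AM.
Let eta_weight := am_weight AM.
Let dl01 := am_dl AM.
Let al01 := am_al AM.
Let be01 := am_be AM.

Lemma am_filtration_sub k j : (k <= j <= n)%N -> F k `<=` F j.
Proof. exact: filtration_sub (am_filtration AM). Qed.

Lemma am_V_homo j k w : (j <= k)%N -> V j w <= V k w.
Proof.
elim: k => [|k ih]; first by rewrite leqn0 => /eqP ->.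
rewrite leq_eqVlt => /predU1P[->//|]; rewrite ltnS => /ih h.
by rewrite mart_sumS (le_trans h)// lerDl.
Qed.

Lemma am_V_ge0 k w : 0 <= V k w.
Proof. by have := @am_V_homo 0 k w isT; rewrite {1}/V big_geq. Qed.

Lemma am_V_le k w : (k <= n)%N -> V k w <= 1 + dl ^+ 2.
Proof. by move=> /am_V_homo h; apply: le_trans (h w) (am_sum_le AM w). Qed.

Lemma am_measurable_S k : (k <= n)%N -> measurable_wrt (F k) (S k).
Proof.
move=> kn; apply: mwrt_sum; first exact: sF.
case=> // i; rewrite !ltnS => /andP[_ ik]; apply: (mwrt_sub (meta (leq_trans ik kn))).
by apply: am_filtration_sub; rewrite ik.
Qed.

Lemma am_measurable_V k : (k < n)%N -> measurable_wrt (F k) (V k.+1).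
Proof.
move=> kn; apply: mwrt_sum; first exact: sF (ltnW kn).
case=> // i; rewrite !ltnS => /andP[_ ik]; apply: (mwrt_sub (ms (leq_ltn_trans ik kn))).
by apply: am_filtration_sub; rewrite ik ltnW.
Qed.

Lemma am_measurable_V' k : (k <= n)%N -> measurable_wrt (F k) (V k).
Proof.
case: k => [|k] kn; last by apply: (mwrt_sub (am_measurable_V kn)); exact: FS.
have -> : V 0 = fun=> 0 by apply/funext => w; rewrite /V big_geq.
exact: (mwrt_cst (sF kn)).
Qed.

Lemma am_measurable k (X : T -> R) : (k <= n)%N -> measurable_wrt (F k) X -> measurable_fun setT X.
Proof. by move=> kn; apply: mwrt_meas; exact: Fm. Qed.

Lemma am_L1s k W : (k < n)%N -> L1 Q W -> L1 Q (fun w => W w * s k.+1 w).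
Proof.
move=> kn iW; apply: (@L1_le _ _ _ _ _ (fun w => 12 * e ^+ 2 * W w)); last 2 first.
- exact: L1Z.
- move=> w; rewrite mulrC normrM [leRHS]normrM ler_wpM2r// (ger0_norm (s_ge0 _ _)).
  by rewrite (le_trans (s_le _ _))// ler_norm.
apply: measurable_funM; first exact: L1_meas iW.
exact: am_measurable (ltnW kn) (ms kn).
Qed.

(* The hypotheses on nonnegative weights extend to signed ones by splitting into positive and negative parts. *)
Lemma am_signed k W : (k < n)%N -> measurable_wrt (F k) W -> L1 Q W ->
  [/\ L1 Q (fun w => `|W w| * `|eta k.+1 w| ^+ 3),
      `|Ex Q (fun w => W w * eta k.+1 w)| <= al * Ex Q (fun w => `|W w| * s k.+1 w),
      `|Ex Q (fun w => W w * eta k.+1 w ^+ 2) - Ex Q (fun w => W w * s k.+1 w)|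
        <= be * Ex Q (fun w => `|W w| * s k.+1 w) &
      L1 Q (fun w => W w * eta k.+1 w) /\ L1 Q (fun w => W w * eta k.+1 w ^+ 2)].
Proof.
move=> kn mW iW; have sG := sF (ltnW kn).
have meta' : measurable_fun setT (eta k.+1) by exact: am_measurable kn (meta kn).
have mW' := L1_meas iW.
have mA : measurable_wrt (F k) (fun w => `|W w|) by exact: mwrt_abs.
have [i3 _ _ _] := eta_weight kn mA (fun w => normr_ge0 _) (L1_abs iW).
have pow p : (p <= 3)%N -> L1 Q (fun w => W w * eta k.+1 w ^+ p).
  move=> p3; apply: (@L1_le _ _ _ _ _ (fun w => `|W w| + `|W w| * `|eta k.+1 w| ^+ 3)).
  - by apply: measurable_funM => //; exact: measurable_funX.
  - by apply: L1D => //; exact: L1_abs.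
  - move=> w; rewrite normrM normrX [leRHS]ger0_norm ?addr_ge0 ?mulr_ge0 ?exprn_ge0//.
    rewrite -{2}[`|W w|]mulr1 -mulrDr ler_wpM2l//.
    have [h|h] := leP `|eta k.+1 w| 1.
      by apply: (@le_trans _ _ 1); [exact: exprn_ile1|rewrite lerDl exprn_ge0].
    by rewrite (le_trans (ler_weXn2l (ltW h) p3))// lerDr ler01.
pose Wp w := Num.max (W w) 0; pose Wn w := Num.max (- W w) 0.
have maxE (a : R) : a = Num.max a 0 - Num.max (- a) 0 /\ `|a| = Num.max a 0 + Num.max (- a) 0.
  have [a0|] := boolP (0 <= a).
    by rewrite (max_l a0) max_r ?oppr_le0// subr0 addr0 ger0_norm.
  rewrite -ltNge => /ltW a0.
  by rewrite (max_r a0) max_l ?oppr_ge0// sub0r opprK add0r ler0_norm.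
have WE w : W w = Wp w - Wn w by exact: (maxE _).1.
have WA w : `|W w| = Wp w + Wn w by exact: (maxE _).2.
have mWp : measurable_wrt (F k) Wp by apply: mwrt_max => //; exact: mwrt_cst.
have mWn : measurable_wrt (F k) Wn.
  by apply: mwrt_max => //; [exact: mwrtN|exact: mwrt_cst].
have Wp0 w : 0 <= Wp w by rewrite le_max lexx orbT.
have Wn0 w : 0 <= Wn w by rewrite le_max lexx orbT.
have iWp : L1 Q Wp.
  apply: (L1_le (am_measurable (ltnW kn) mWp) iW) => w.
  by rewrite ger0_norm// WA lerDl.
have iWn : L1 Q Wn.
  apply: (L1_le (am_measurable (ltnW kn) mWn) iW) => w.
  by rewrite ger0_norm// WA lerDr.
have [p3 p1 p2 _] := eta_weight kn mWp Wp0 iWp.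
have [q3 q1 q2 _] := eta_weight kn mWn Wn0 iWn.
have low U p : L1 Q U -> measurable_wrt (F k) U -> (forall w, 0 <= U w) ->
    (forall w, U w <= `|W w|) -> (p <= 3)%N ->
    L1 Q (fun w => U w * eta k.+1 w ^+ p).
  move=> iU mU U0 UW p_3; apply: (L1_le _ (pow p p_3)).
    apply: measurable_funM; first exact: L1_meas iU.
    exact: measurable_funX.
  by move=> w; rewrite !normrM ler_wpM2r// ger0_norm.
have WpW w : Wp w <= `|W w| by rewrite WA lerDl.
have WnW w : Wn w <= `|W w| by rewrite WA lerDr.
have Ediff X : L1 Q (fun w => Wp w * X w) -> L1 Q (fun w => Wn w * X w) ->
    Ex Q (fun w => W w * X w) = Ex Q (fun w => Wp w * X w) - Ex Q (fun w => Wn w * X w).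
  by move=> i1 i2; rewrite -ExB//; apply: eq_Ex => w; rewrite WE mulrBl.
have Es : Ex Q (fun w => `|W w| * s k.+1 w) =
    Ex Q (fun w => Wp w * s k.+1 w) + Ex Q (fun w => Wn w * s k.+1 w).
  by rewrite -ExD//; [apply: eq_Ex => w; rewrite WA mulrDl|exact: am_L1s..].
have e1 U : (fun w => U w * eta k.+1 w) = (fun w => U w * eta k.+1 w ^+ 1) by [].
split=> //.
- rewrite Ediff; [|exact: (low Wp 1)|exact: (low Wn 1)].
  by rewrite Es mulrDr (le_trans (ler_normB _ _))// lerD.
- rewrite Ediff; [|exact: (low Wp 2)|exact: (low Wn 2)].
  rewrite (Ediff (s k.+1)); [|exact: am_L1s..].
  rewrite Es mulrDr opprB addrACA addrC -opprB.
  move: p2 q2; set a1 := Ex Q _; set a2 := Ex Q (fun w => Wp w * s _ _).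
  set a3 := Ex Q _; set a4 := Ex Q (fun w => Wn w * s _ _).
  by rewrite !ler_norml => /andP[? ?] /andP[? ?]; apply/andP; split; lra.
- by split; [exact: (pow 1)|exact: (pow 2)].
Qed.

Local Notation rest := (remaining s dl).

Lemma am_restP k w : (k <= n)%N -> 0 <= rest k w <= 2.
Proof.
move=> kn; have := am_V_le w kn; have := am_V_ge0 k w; rewrite /remaining.
have /andP[d0 d1] := dl01; have : dl ^+ 2 <= 1 by rewrite exprn_ile1.
by move=> *; apply/andP; split; lra.
Qed.

(** For an exact martingale this would be orthogonality of increments. The small drift adds a cross
    term of size |D| s, with D = S_m - S_k, which has to be absorbed. The factor [1 + rest] drops by
    s at every step, so it releases - W D^2 s, and 6 |D| <= D^2 + 9. The constant is 15 = 9 + 6, the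
    6 being the new square, as 1 + rest <= 3 and the relative variance error is at most 1. *)
Lemma am_increment_sqr k j W : (k + j <= n)%N -> measurable_wrt (F k) W ->
  (forall w, 0 <= W w) -> L1 Q W ->
  L1 Q (fun w => W w * (S (k + j) w - S k w) ^+ 2) /\
  Ex Q (fun w => W w * (1 + rest (k + j) w) * (S (k + j) w - S k w) ^+ 2)
    <= 15 * Ex Q (fun w => W w * (V (k + j) w - V k w)).
Proof.
move=> kjn mW W0 iW; have kn : (k <= n)%N by exact: leq_trans (leq_addr _ _) kjn.
elim: j kjn => [|j ih] kjn.
  rewrite addn0; have -> : (fun w => W w * (S k w - S k w) ^+ 2) = fun=> 0.
    by apply/funext => w; rewrite subrr expr0n mulr0.
  have -> : (fun w => W w * (1 + rest k w) * (S k w - S k w) ^+ 2) = fun=> 0.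
    by apply/funext => w; rewrite subrr expr0n mulr0.
  have -> : (fun w => W w * (V k w - V k w)) = fun=> 0.
    by apply/funext => w; rewrite subrr mulr0.
  by split; [exact: L1_cst|rewrite Ex_cst mulr0].
have jn : (k + j < n)%N by rewrite -addnS.
have [i2 ih2] := ih (ltnW jn).
have sG := sF (ltnW jn).
rewrite addnS; set m := (k + j)%N in jn sG ih ih2 i2 *.
have km : (k <= m <= n)%N by rewrite leq_addr ltnW.
pose D w := S m w - S k w.
have mD : measurable_wrt (F m) D.
  by apply: (mwrtB sG); [exact: am_measurable_S (ltnW jn)|apply: (mwrt_sub (am_measurable_S kn)); exact: am_filtration_sub].
have mWm : measurable_wrt (F m) W by apply: (mwrt_sub mW); exact: am_filtration_sub.
have mr : measurable_wrt (F m) (rest m.+1).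
  by apply: (mwrtB sG); [exact: mwrt_cst|exact: am_measurable_V].
have r02 w := am_restP w jn.
have DS w : S m.+1 w - S k w = D w + eta m.+1 w by rewrite mart_sumS /D; ring.
have rS w : rest m w = rest m.+1 w + s m.+1 w by rewrite /remaining mart_sumS; ring.
pose U w := W w * (1 + rest m.+1 w).
have mU : measurable_wrt (F m) U by rewrite /U; mwrt_auto sG.
have U0 w : 0 <= U w.
  by have /andP[? ?] := r02 w; rewrite mulr_ge0//; lra.
have UW w : U w <= 3 * W w.
  have /andP[? ?] := r02 w; rewrite /U mulrC ler_wpM2r//; lra.
have iU : L1 Q U.
  apply: (L1_le (am_measurable (ltnW jn) mU) (L1Z 3 iW)) => w.
  by rewrite ger0_norm// ger0_norm// mulr_ge0.
have WD2 w : 0 <= W w * D w ^+ 2 by apply: mulr_ge0 => //; exact: sqr_ge0.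
have UD2 w : 0 <= U w * D w ^+ 2 by apply: mulr_ge0 => //; exact: sqr_ge0.
have mUD : measurable_wrt (F m) (fun w => U w * D w) by exact: mwrtM.
have i2' : L1 Q (fun w => W w * D w ^+ 2) by exact: i2.
have iUD2 : L1 Q (fun w => U w * D w ^+ 2).
  apply: (L1_le _ (L1Z 3 i2')).
    by apply: (@am_measurable m) (ltnW jn) _; mwrt_auto sG.
  move=> w; rewrite (ger0_norm (UD2 w)) ger0_norm; last by rewrite mulr_ge0.
  by rewrite mulrA ler_wpM2r ?sqr_ge0.
have iUD : L1 Q (fun w => U w * D w).
  apply: (L1_le (am_measurable (ltnW jn) mUD) (L1D iU iUD2)) => w.
  rewrite [leRHS]ger0_norm; last exact: addr_ge0.
  rewrite normrM (ger0_norm (U0 w)).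
  by rewrite -{2}[U w]mulr1 -mulrDr ler_wpM2l// norm_le_sqr.
have [_ h1 _ [iUDe _]] := am_signed jn mUD iUD.
have [_ _ h2 [_ iUe2]] := am_signed jn mU iU.
have absU w : `|U w| = U w by rewrite ger0_norm.
have [_ _ _ [_ iWe2]] := am_signed jn mWm iW.
have iWD : L1 Q (fun w => W w * D w).
  apply: (L1_le _ (L1D iW i2')).
    by apply: (@am_measurable m) (ltnW jn) _; mwrt_auto sG.
  move=> w.
  rewrite [leRHS]ger0_norm; last exact: addr_ge0.
  rewrite normrM (ger0_norm (W0 w)).
  by rewrite -{2}[W w]mulr1 -mulrDr ler_wpM2l// norm_le_sqr.
have mWD : measurable_wrt (F m) (fun w => W w * D w) by exact: mwrtM.
have [_ _ _ [iWDe _]] := am_signed jn mWD iWD.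
have iWDs : L1 Q (fun w => W w * D w ^+ 2 * s m.+1 w) by exact: am_L1s.
have iWs : L1 Q (fun w => W w * s m.+1 w) by exact: am_L1s.
split.
  have -> : (fun w => W w * (S m.+1 w - S k w) ^+ 2) =
      fun w => W w * D w ^+ 2 + (2 * (W w * D w * eta m.+1 w) + W w * eta m.+1 w ^+ 2).
    by apply/funext => w; rewrite DS; ring.
  by apply: L1D => //; apply: L1D => //; exact: L1Z.
have -> : Ex Q (fun w => W w * (1 + rest m.+1 w) * (S m.+1 w - S k w) ^+ 2) =
    Ex Q (fun w => U w * D w ^+ 2) + 2 * Ex Q (fun w => U w * D w * eta m.+1 w)
    + Ex Q (fun w => U w * eta m.+1 w ^+ 2).
  rewrite -ExZ// -ExD//; last exact: L1Z.
  rewrite -ExD//; last by apply: L1D => //; exact: L1Z.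
  by apply: eq_Ex => w; rewrite DS /U; ring.
have -> : Ex Q (fun w => U w * D w ^+ 2) =
    Ex Q (fun w => W w * (1 + rest m w) * (S m w - S k w) ^+ 2)
    - Ex Q (fun w => W w * D w ^+ 2 * s m.+1 w).
  rewrite -ExB//; first by apply: eq_Ex => w; rewrite rS /U /D; ring.
  have -> : (fun w => W w * (1 + rest m w) * (S m w - S k w) ^+ 2) =
      fun w => U w * D w ^+ 2 + W w * D w ^+ 2 * s m.+1 w.
    by apply/funext => w; rewrite rS /U /D; ring.
  exact: L1D.
have -> : Ex Q (fun w => W w * (V m.+1 w - V k w)) =
    Ex Q (fun w => W w * (V m w - V k w)) + Ex Q (fun w => W w * s m.+1 w).
  rewrite -ExD//; first by apply: eq_Ex => w; rewrite mart_sumS; ring.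
  apply: (L1_le _ (L1Z 2 iW)).
    apply: measurable_funM; first exact: L1_meas iW.
    by apply: measurable_funB; [exact: am_measurable (ltnW jn) (am_measurable_V' (ltnW jn))|exact: am_measurable kn (am_measurable_V' kn)].
  move=> w; rewrite normrM mulrC normrM (ger0_norm (W0 w)) ler_wpM2r//.
  have := am_V_homo w (_ : (k <= m)%N); rewrite leq_addr => /(_ isT) h.
  rewrite !ger0_norm ?subr_ge0//.
  have := am_restP w (ltnW jn); have := am_restP w kn; have := am_V_ge0 k w.
  have /andP[d0 d1] := dl01; have : dl ^+ 2 <= 1 by rewrite exprn_ile1.
  by rewrite /remaining => ? ? /andP[? ?] /andP[? ?]; lra.
have absUD : Ex Q (fun w => `|U w * D w| * s m.+1 w) * 2
    <= Ex Q (fun w => W w * D w ^+ 2 * s m.+1 w) + 9 * Ex Q (fun w => W w * s m.+1 w).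
  have iaUD : L1 Q (fun w => `|U w * D w| * s m.+1 w) by apply: am_L1s => //; exact: L1_abs.
  rewrite mulrC -ExZ// -ExZ// -ExD//; last exact: L1Z.
  apply: Ex_le; [exact: L1Z|by apply: L1D => //; exact: L1Z|].
  move=> w; rewrite normrM absU.
  have -> : 2 * (U w * `|D w| * s m.+1 w) = 2 * (U w * `|D w|) * s m.+1 w by ring.
  have -> : W w * D w ^+ 2 * s m.+1 w + 9 * (W w * s m.+1 w) =
    (W w * D w ^+ 2 + 9 * W w) * s m.+1 w by ring.
  rewrite ler_wpM2r//.
  apply: (@le_trans _ _ (2 * (3 * W w * `|D w|))).
    by rewrite ler_wpM2l// ler_wpM2r.
  rewrite -(real_normK (num_real (D w))).
  have := mulr_ge0 (W0 w) (sqr_ge0 (`|D w| - 3)).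
  have -> : W w * (`|D w| - 3) ^+ 2 =
    W w * `|D w| ^+ 2 + 9 * W w - 2 * (3 * W w * `|D w|) by ring.
  by lra.
have /andP[a0 a1] := al01; have /andP[b0 b1] := be01.
have Us : Ex Q (fun w => U w * s m.+1 w) <= 3 * Ex Q (fun w => W w * s m.+1 w).
  rewrite -ExZ//; apply: Ex_le; [exact: am_L1s|exact: L1Z|].
  by move=> w; rewrite mulrA ler_wpM2r.
have {}h1 : 2 * Ex Q (fun w => U w * D w * eta m.+1 w) <=
    Ex Q (fun w => `|U w * D w| * s m.+1 w) * 2.
  have x0 : 0 <= Ex Q (fun w => `|U w * D w| * s m.+1 w).
    by apply: Ex_ge0 => w; rewrite mulr_ge0.
  have := ler_wpM2r x0 a1; move: h1; rewrite ler_norml => /andP[_]; lra.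
have {}h2 : Ex Q (fun w => U w * eta m.+1 w ^+ 2) <= 6 * Ex Q (fun w => W w * s m.+1 w).
  move: h2; have -> : Ex Q (fun w => `|U w| * s m.+1 w) = Ex Q (fun w => U w * s m.+1 w).
    by apply: eq_Ex => w; rewrite absU.
  have x0 : 0 <= Ex Q (fun w => U w * s m.+1 w).
    by apply: Ex_ge0 => w; rewrite mulr_ge0.
  have := ler_wpM2r x0 b1; rewrite ler_norml => ? /andP[_]; lra.
by rewrite mulrDr; move: ih2; rewrite -/D; lra.
Qed.

End approximate_martingale.

(** * The Lindeberg argument *)

Section scale_sums.
Context (R : realType) (A s : nat -> R) (n : nat) (a : R).
Hypothesis a_gt0 : 0 < a.
Hypothesis aA : forall k, (k <= n)%N -> a <= A k.
Hypothesis A_ratio : forall k, (k < n)%N -> A k <= 2 * A k.+1.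
Hypothesis As : forall k, (k < n)%N -> A k ^+ 2 = A k.+1 ^+ 2 + s k.+1.
Hypothesis s_ge0 : forall k, 0 <= s k.

Let A_gt0 k : (k <= n)%N -> 0 < A k.
Proof. by move=> /aA; exact: lt_le_trans. Qed.

Let A_dec k : (k < n)%N -> A k.+1 <= A k.
Proof.
move=> kn; have x0 := ltW (A_gt0 (ltnW kn)); have y0 := ltW (A_gt0 kn).
suff : A k.+1 ^+ 2 <= A k ^+ 2 by rewrite ler_pXn2r ?nnegrE.
by rewrite (As kn) lerDl.
Qed.

Let s_le k : (k < n)%N -> s k.+1 <= 3 * A k.+1 * (A k - A k.+1).
Proof.
move=> kn; have -> : s k.+1 = (A k + A k.+1) * (A k - A k.+1).
  rewrite [RHS](_ : _ = A k ^+ 2 - A k.+1 ^+ 2); last by ring.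
  by rewrite (As kn) addrC addKr.
by rewrite ler_wpM2r ?subr_ge0 ?A_dec//; have := A_ratio kn; lra.
Qed.

(** As s is the decrement of A^2, the three sums are Riemann sums for integrals in A. They are
    bounded by telescoping primitives; [A_ratio] allows the scales at k and k + 1 to be exchanged up
    to a constant. Here the primitive is linear. *)
Lemma sum_scale_inv : \sum_(0 <= k < n) s k.+1 * (A k.+1)^-1 <= 3 * A 0.
Proof.
apply: (@le_trans _ _ (\sum_(0 <= k < n) (- 3 * A k.+1 - (- 3 * A k)))).
  rewrite !big_nat; apply: ler_sum => k /andP[_ kn].
  rewrite ler_pdivrMr ?A_gt0//; apply: le_trans (s_le kn) _.
  by rewrite le_eqVlt; apply/orP; left; apply/eqP; ring.
rewrite (telescope_sumr (fun k => - 3 * A k))//.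
by have := A_gt0 (leqnn n); lra.
Qed.

(** The primitive is now a logarithm: s / A_k^2 = 1 - A_(k+1)^2 / A_k^2 is at most - ln of the
    quotient. The variance errors enter with this sum, hence the factor |ln e| they carry in the
    final estimate. *)
Lemma sum_scale_inv_sqr :
  \sum_(0 <= k < n) s k.+1 * (A k.+1) ^- 2 <= 8 * (ln (A 0) - ln (A n)).
Proof.
apply: (@le_trans _ _ (\sum_(0 <= k < n) (- 8 * ln (A k.+1) - (- 8 * ln (A k))))).
  rewrite !big_nat; apply: ler_sum => k /andP[_ kn].
  have A0 := A_gt0 (ltnW kn); have A1 := A_gt0 kn.
  have A20 : 0 < A k ^+ 2 by rewrite exprn_gt0.
  have A21 : 0 < A k.+1 ^+ 2 by rewrite exprn_gt0.
  have h1 : s k.+1 * A k.+1 ^- 2 <= 4 * (s k.+1 / A k ^+ 2).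
    rewrite mulrCA ler_wpM2l// -[leLHS]mul1r ler_pdivrMr// mulrAC ler_pdivlMr// mul1r.
    have : A k ^+ 2 <= (2 * A k.+1) ^+ 2.
      by apply: lerXn2r; rewrite ?nnegrE ?A_ratio// ?mulr_ge0// ltW.
    by rewrite exprMn; lra.
  apply: le_trans h1 _.
  have -> : s k.+1 / A k ^+ 2 = 1 - A k.+1 ^+ 2 / A k ^+ 2.
    rewrite -{1}(divff (lt0r_neq0 A20)) -mulrBl; congr (_ / _).
    by rewrite (As kn) addrC addKr.
  have h : -1 < A k.+1 ^+ 2 / A k ^+ 2 - 1 by rewrite ltrBrDl subrr divr_gt0.
  have := le_ln1Dx h.
  by rewrite addrC subrK ln_div ?posrE// !lnXn// !mulr2n; lra.
rewrite (telescope_sumr (fun k => - 8 * ln (A k)))//; lra.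
Qed.

(** The summand is s / (A (A^2 + r^2)), comparable to the increment of 1 / (A + r). A distance r
    that is the same for all k is essential for the telescoping. *)
Lemma sum_scale_dist (r : R) : 0 <= r ->
  \sum_(0 <= k < n) s k.+1 * (A k.+1) ^- 3 / (1 + r ^+ 2 / A k.+1 ^+ 2)
    <= 12 * (a + r)^-1.
Proof.
move=> r0; pose G k := (A k + r)^-1.
apply: (@le_trans _ _ (\sum_(0 <= k < n) (12 * G k.+1 - 12 * G k))).
  rewrite !big_nat; apply: ler_sum => k /andP[_ kn].
  have A0 := A_gt0 (ltnW kn); have A1 := A_gt0 kn; have Ad := A_dec kn.
  have Ar := A_ratio kn.
  have -> : 12 * G k.+1 - 12 * G k = 12 * (A k - A k.+1) / ((A k.+1 + r) * (A k + r)).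
    by rewrite /G; field; rewrite !gt_eqF//; lra.
  have -> : s k.+1 * A k.+1 ^- 3 / (1 + r ^+ 2 / A k.+1 ^+ 2) =
      s k.+1 / (A k.+1 * (A k.+1 ^+ 2 + r ^+ 2)).
    by field; rewrite !gt_eqF// ltr_wpDr ?sqr_ge0// exprn_gt0.
  move: (A k) (A k.+1) (s k.+1) (s_le kn) A0 A1 Ad Ar => x y t tle x0 y0 yx xy2.
  have r20 := sqr_ge0 r; have y20 : 0 < y ^+ 2 by rewrite exprn_gt0.
  have p1 : 0 < y * (y ^+ 2 + r ^+ 2) by rewrite mulr_gt0//; lra.
  have p2 : 0 < (y + r) * (x + r) by rewrite mulr_gt0//; lra.
  rewrite ler_pdivrMr// mulrAC ler_pdivlMr//.
  have h1 : (y + r) * (x + r) <= 4 * (y ^+ 2 + r ^+ 2).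
    apply: (@le_trans _ _ ((y + r) * (2 * (y + r)))).
      by rewrite ler_wpM2l//; lra.
    have := sqr_ge0 (y - r).
    have -> : (y + r) * (2 * (y + r)) = 4 * (y ^+ 2 + r ^+ 2) - 2 * (y - r) ^+ 2 by ring.
    by lra.
  apply: (@le_trans _ _ (3 * y * (x - y) * ((y + r) * (x + r)))).
    by rewrite ler_wpM2r// ltW.
  apply: (@le_trans _ _ (3 * y * (x - y) * (4 * (y ^+ 2 + r ^+ 2)))).
    by apply: ler_wpM2l => //; apply: mulr_ge0; lra.
  by rewrite le_eqVlt; apply/orP; left; apply/eqP; ring.
rewrite (telescope_sumr (fun k => 12 * G k))// /G.
have : (A n + r)^-1 <= (a + r)^-1.
  have An := aA (leqnn n).
  have p1 : 0 < a + r by rewrite ltr_pwDl.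
  have p2 : 0 < A n + r by rewrite ltr_pwDl// (lt_le_trans a_gt0).
  by rewrite lef_pV2 ?posrE// lerD2r.
have : 0 <= (A 0 + r)^-1 by rewrite invr_ge0; have := A_gt0 (leq0n n); lra.
by lra.
Qed.

End scale_sums.

Definition scale (R : realType) d (T : measurableType d) (s : nat -> T -> R)
  (dl a : R) k w : R := Num.sqrt (remaining s dl k w + a ^+ 2).

(** The conditional probability that S_k plus an independent centred normal variable of variance
    A_k^2 is at most y. *)
Definition smooth_cdf (R : realType) d (T : measurableType d)
  (eta s : nat -> T -> R) (dl a y : R) k w : R :=
  std_normal_cdf ((y - mart_sum eta k w) / scale s dl a k w).

(** The sum has index k and the scale index k + 1: both are known at time k, since s_(k+1) is
    predictable. It is the common centre of the expansions of [smooth_cdf] at k and k + 1. *)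
Definition standardized (R : realType) d (T : measurableType d)
  (eta s : nat -> T -> R) (dl a y : R) k w : R :=
  (y - mart_sum eta k w) / scale s dl a k.+1 w.

(** The size of the third-order Taylor coefficient of step k, with its decay away from the level
    y. *)
Definition bump (R : realType) d (T : measurableType d)
  (eta s : nat -> T -> R) (dl a y : R) k w : R :=
  (scale s dl a k.+1 w) ^- 3 / (1 + standardized eta s dl a y k w ^+ 2).

Section lindeberg.
Context (R : realType) d (T : measurableType d) (Q : probability T R).
Variables (n : nat) (F : nat -> set (set T)) (eta s : nat -> T -> R).
Variables (e dl al be K a : R).
Hypothesis AM : approx_martingale Q n F eta s e dl al be K.
Hypothesis ea : 4 * e <= a.
Hypothesis a1 : a <= 1.

Local Notation S := (mart_sum eta).
Local Notation V := (mart_sum s).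
Local Notation A := (scale s dl a).
Local Notation phi := (normal_pdf (0 : R) 1).
Local Notation Phi := (@std_normal_cdf R).

Let sF := am_sigma AM.
Let s_ge0 := am_s_ge0 AM.
Let e_gt0 := am_e AM.

Let a_gt0 : 0 < a.
Proof. by apply: lt_le_trans ea; rewrite mulr_gt0// (am_e AM). Qed.

Lemma scale_sqr k w : (k <= n)%N -> A k w ^+ 2 = remaining s dl k w + a ^+ 2.
Proof.
move=> kn; have /andP[h _] := am_restP AM w kn.
by rewrite sqr_sqrtr// addr_ge0// sqr_ge0.
Qed.

Lemma scale_ge k w : (k <= n)%N -> a <= A k w.
Proof.
move=> kn; have /andP[h _] := am_restP AM w kn.
rewrite -[leLHS](ger0_norm (ltW a_gt0)) -sqrtr_sqr; apply: ler_wsqrtr.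
by rewrite lerDr.
Qed.

Lemma scale_gt0 k w : (k <= n)%N -> 0 < A k w.
Proof. by move=> kn; exact: lt_le_trans a_gt0 (scale_ge w kn). Qed.

Lemma scaleS k w : (k < n)%N -> A k w ^+ 2 = A k.+1 w ^+ 2 + s k.+1 w.
Proof.
by move=> kn; rewrite (scale_sqr w (ltnW kn)) (scale_sqr w kn) /remaining mart_sumS; ring.
Qed.

Lemma scale_le2 k w : (k <= n)%N -> A k w <= 2.
Proof.
move=> kn; rewrite -(@ler_pXn2r _ 2)// ?nnegrE ?(ltW (scale_gt0 w kn))//.
rewrite scale_sqr//; have /andP[_ h] := am_restP AM w kn.
have a21 : a ^+ 2 <= 1 by rewrite exprn_ile1// ltW.
have -> : (2 : R) ^+ 2 = 4 by ring.
by lra.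
Qed.

Lemma am_s_scale k w : (k < n)%N -> s k.+1 w <= 3 * e * A k.+1 w.
Proof.
move=> kn; apply: le_trans (am_s_le AM _ _) _.
have := scale_ge w kn => h; rewrite expr2.
have -> : 12 * (e * e) = 3 * e * (4 * e) by ring.
by rewrite ler_wpM2l ?mulr_ge0 ?(ltW e_gt0)// (le_trans ea).
Qed.

Lemma am_s_scale_sqr k w : (k < n)%N -> s k.+1 w <= A k.+1 w ^+ 2.
Proof.
move=> kn; apply: le_trans (am_s_scale w kn) _; rewrite expr2.
have h := scale_ge w kn; rewrite ler_wpM2r//; first exact: ltW (scale_gt0 w kn).
by have := e_gt0; have := ea; lra.
Qed.

Lemma scale_ratio k w : (k < n)%N -> A k w <= 2 * A k.+1 w.
Proof.
move=> kn; have x0 := scale_gt0 w kn; have y0 := scale_gt0 w (ltnW kn).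
rewrite -(@ler_pXn2r _ 2)// ?nnegrE ?mulr_ge0 ?(ltW x0) ?(ltW y0)//.
rewrite scaleS// exprMn; have := am_s_scale_sqr w kn.
have := sqr_ge0 (A k.+1 w); have -> : (2 : R) ^+ 2 = 4 by ring.
by lra.
Qed.

Lemma am_measurable_scale k j : (k <= n)%N -> (j <= n)%N ->
  measurable_wrt (F k) (V j) -> measurable_wrt (F k) (A j).
Proof.
move=> kn jn mVj; apply: (@mwrt_comp _ _ _ _ (@Num.sqrt R)).
  by apply: continuous_measurable_fun; exact: sqrt_continuous.
have sG := sF kn; apply: (mwrtD sG); last exact: mwrt_cst.
by apply: (mwrtB sG) => //; exact: mwrt_cst.
Qed.

Let L1b (X : T -> R) (c : R) k : (k <= n)%N -> measurable_wrt (F k) X ->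
  (forall w, `|X w| <= c) -> L1 Q X.
Proof. by move=> kn mX; apply: L1_bnd; exact: (am_measurable AM kn). Qed.

Let m_phi : measurable_fun [set: R] phi.
Proof. exact: measurable_normal_pdf. Qed.

Local Notation f := (smooth_cdf eta s dl a).

Lemma am_measurable_smooth y k : (k <= n)%N -> measurable_wrt (F k) (f y k).
Proof.
move=> kn; have sG := sF kn; apply: (mwrt_comp (@measurable_std_normal_cdf R)).
have := am_measurable_S AM kn; have := am_measurable_scale kn kn (am_measurable_V' AM kn).
move=> mA mS; apply: (mwrtM sG); last exact: mwrtV.
by apply: (mwrtB sG) => //; exact: mwrt_cst.
Qed.

Lemma am_L1_smooth y k : (k <= n)%N -> L1 Q (f y k).
Proof.
move=> kn; apply: (L1b (c := 1) kn (am_measurable_smooth y kn)) => w.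
by rewrite ger0_norm ?std_normal_cdf_ge0 ?std_normal_cdf_le1.
Qed.

Local Notation z := (standardized eta s dl a).
Local Notation bmp := (bump eta s dl a).

Let opz (x : R) : 0 < 1 + x ^+ 2.
Proof. by have := sqr_ge0 x; lra. Qed.

Lemma am_measurable_ratio y k : (k < n)%N -> measurable_wrt (F k) (z y k).
Proof.
move=> kn; have sG := sF (ltnW kn).
have mA := am_measurable_scale (ltnW kn) kn (am_measurable_V AM kn).
have mS := am_measurable_S AM (ltnW kn).
apply: (mwrtM sG); last exact: mwrtV.
by apply: (mwrtB sG) => //; exact: mwrt_cst.
Qed.

Lemma am_measurable_bump y k : (k < n)%N -> measurable_wrt (F k) (bmp y k).
Proof.
move=> kn; have sG := sF (ltnW kn).
have mA := am_measurable_scale (ltnW kn) kn (am_measurable_V AM kn).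
have mz := am_measurable_ratio y kn.
apply: (mwrtM sG); first by apply: mwrtV; exact: mwrtX.
apply: mwrtV; apply: (mwrtD sG); first exact: mwrt_cst.
exact: mwrtX.
Qed.

Lemma bump_ge0 y k w : (k < n)%N -> 0 <= bmp y k w.
Proof.
move=> kn; apply: divr_ge0; last exact: ltW.
by rewrite invr_ge0 exprn_ge0// ltW// scale_gt0.
Qed.

Lemma inv_scale_le k w p : (k <= n)%N -> (A k w) ^- p <= a ^- p.
Proof.
move=> kn; rewrite lef_pV2 ?posrE ?exprn_gt0 ?scale_gt0//.
by apply: lerXn2r; rewrite ?nnegrE ?(ltW a_gt0) ?(ltW (scale_gt0 w kn)) ?scale_ge.
Qed.

Lemma am_L1_bump y k : (k < n)%N -> L1 Q (bmp y k).
Proof.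
move=> kn; apply: (L1b (c := a ^- 3) (ltnW kn) (am_measurable_bump y kn)) => w.
rewrite ger0_norm ?bump_ge0//; apply: le_trans (inv_scale_le w 3 kn).
rewrite ler_pdivrMr ?opz// ler_peMr//.
  by rewrite invr_ge0 exprn_ge0// ltW// scale_gt0.
by have := sqr_ge0 (z y k w); lra.
Qed.

(** With z the standardized value, step k + 1 is Phi(z - eta / A_(k+1)), while step k is Phi(z r)
    with r = A_(k+1) / A_k. Both are expanded about z. Since A_k^2 = A_(k+1)^2 + s_(k+1), the
    second-order terms differ by eta^2 - s with a predictable coefficient [P2], and the first-order
    term has a predictable coefficient [P1]; their means are controlled by the drift and variance
    errors. *)
Lemma lindeberg_step y k : (k < n)%N ->
  `|Ex Q (f y k.+1) - Ex Q (f y k)| <=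
    (48 * K + 9 * 12 ^+ 3) * e * Ex Q (fun w => bmp y k w * s k.+1 w)
    + al * Ex Q (fun w => s k.+1 w * (A k.+1 w)^-1)
    + 8 * be * Ex Q (fun w => s k.+1 w * (A k.+1 w) ^- 2).
Proof.
move=> kn; have kn' := ltnW kn; have sG := sF kn'.
have mA := am_measurable_scale kn' kn (am_measurable_V AM kn).
have mz := am_measurable_ratio y kn.
have A0 w := scale_gt0 w kn.
have m1z := am_measurable_bump y kn.
pose P1 w := phi (z y k w) * (A k.+1 w)^-1.
pose P2 w := z y k w * phi (z y k w) * 2^-1 * (A k.+1 w) ^- 2.
have mpz : measurable_wrt (F k) (fun w => phi (z y k w)) by exact: mwrt_comp.
have mP1 : measurable_wrt (F k) P1 by rewrite /P1; mwrt_auto sG.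
have mP2 : measurable_wrt (F k) P2 by rewrite /P2; mwrt_auto sG.
have P1le w : `|P1 w| <= (A k.+1 w)^-1.
  have p0 := std_normal_pdf_ge0 (z y k w).
  rewrite ger0_norm; last by rewrite mulr_ge0// invr_ge0 ltW.
  by rewrite ler_piMl ?std_normal_pdf_le1// invr_ge0 ltW.
have P2le w : `|P2 w| <= 8 * (A k.+1 w) ^- 2.
  have p0 := std_normal_pdf_ge0 (z y k w).
  have i0 : 0 <= (A k.+1 w) ^- 2 by rewrite invr_ge0 exprn_ge0// ltW.
  rewrite /P2 normrM [`|_ ^- 2|]ger0_norm// ler_wpM2r//.
  move: (z y k w) p0 => x p0.
  rewrite !normrM (ger0_norm p0) (ger0_norm (_ : 0 <= 2^-1))//.
  have : `|x| * phi x <= 16; last lra.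
  apply: le_trans (std_normal_pdf_sqr_le x).
  rewrite mulrC ler_wpM2l//; apply: le_trans (norm_le_sqr _) _.
  by have h := sqr_ge0 x; rewrite [leRHS]expr2 ler_peMr//; lra.
have iP1 : L1 Q P1.
  apply: (L1b (c := a^-1) kn' mP1) => w; apply: le_trans (P1le w) _.
  by have := inv_scale_le w 1 kn; rewrite !expr1.
have iP2 : L1 Q P2.
  apply: (L1b (c := 8 * a ^- 2) kn' mP2) => w; apply: le_trans (P2le w) _.
  by rewrite ler_wpM2l// inv_scale_le.
have iB := am_L1_bump y kn.
have [_ h1 _ [i1 _]] := am_signed AM kn mP1 iP1.
have [_ _ h2 [_ i2]] := am_signed AM kn mP2 iP2.
have [i3 _ _ h3] := am_weight AM kn m1z (fun w => bump_ge0 y w kn) iB.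
have iP2s := am_L1s AM kn iP2; have iBs := am_L1s AM kn iB.
have if1 := am_L1_smooth y kn; have if0 := am_L1_smooth y kn'.
(* What remains of the difference once the first- and second-order terms are taken out; it is
   bounded pointwise, before any expectation. *)
pose Rt w := f y k.+1 w - f y k w + P1 w * eta k.+1 w
  + (P2 w * eta k.+1 w ^+ 2 - P2 w * s k.+1 w).
have id2 : L1 Q (fun w => P2 w * eta k.+1 w ^+ 2 - P2 w * s k.+1 w) by exact: L1B.
have id1 : L1 Q (fun w => f y k.+1 w - f y k w) by exact: L1B.
have iRt : L1 Q Rt by apply: L1D => //; exact: L1D.
have ERt : Ex Q (f y k.+1) - Ex Q (f y k) = Ex Q Rt - Ex Q (fun w => P1 w * eta k.+1 w)
    - (Ex Q (fun w => P2 w * eta k.+1 w ^+ 2) - Ex Q (fun w => P2 w * s k.+1 w)).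
  rewrite (ExD (L1D id1 i1) id2) (ExD id1 i1) (ExB if1 if0) (ExB i2 iP2s).
  have gen (u v c x t : R) : u - v = u - v + c + (x - t) - c - (x - t) by ring.
  exact: gen.
have Rtle w : `|Rt w| <= 48 * (bmp y k w * `|eta k.+1 w| ^+ 3)
    + 9 * 12 ^+ 3 * e * (bmp y k w * s k.+1 w).
  pose h := eta k.+1 w / A k.+1 w; pose q := s k.+1 w / A k.+1 w ^+ 2.
  pose r := A k.+1 w / A k w; pose zz := z y k w.
  have A0' := scale_gt0 w kn'.
  have An : A k.+1 w != 0 by rewrite gt_eqF.
  have A2 : 0 < A k.+1 w ^+ 2 by rewrite exprn_gt0.
  have q01 : 0 <= q <= 1.
    rewrite divr_ge0 ?(ltW A2)//= ler_pdivrMr// mul1r.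
    exact: am_s_scale_sqr.
  have r0 : 0 < r by rewrite divr_gt0.
  have rq : r ^+ 2 * (1 + q) = 1.
    have -> : 1 + q = A k w ^+ 2 / A k.+1 w ^+ 2.
      by rewrite (scaleS w kn) mulrDl divff// gt_eqF.
    rewrite /r; move: An (lt0r_neq0 A0'); move: (A k.+1 w) (A k w) => u v u0 v0.
    by field; rewrite u0 v0.
  have t1 := std_normal_cdf_taylor zz h.
  have t2 := std_normal_cdf_shrink zz q01 r0 rq.
  have E1 : f y k.+1 w = Phi (zz - h).
    rewrite /smooth_cdf mart_sumS /zz /standardized /h; congr Phi; move: An; move: (A k.+1 w) => u u0.
    by field.
  have E0 : f y k w = Phi (zz * r).
    rewrite /smooth_cdf /zz /standardized /r; congr Phi; move: An (lt0r_neq0 A0').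
    move: (A k.+1 w) (A k w) => u v u0 v0.
    by field; rewrite u0 v0.
  have -> : Rt w = (Phi (zz - h) - Phi zz + h * phi zz + h ^+ 2 / 2 * (zz * phi zz))
      - (Phi (zz * r) - Phi zz + q / 2 * (zz * phi zz)).
    rewrite /Rt E1 E0 /P1 /P2 -/zz /h /q; move: An.
    move: (Phi (zz - _)) (Phi (zz * _)) (Phi zz) (phi zz) => p1 p2 p3 p4.
    by move: (A k.+1 w) => u u0; field.
  have p := opz zz; have pn := lt0r_neq0 p.
  apply: le_trans (ler_normB _ _) _; apply: lerD.
    rewrite -ler_pdivlMr// in t1; apply: le_trans t1 _.
    rewrite /h normrM normfV (gtr0_norm (A0 w)) /bump -/zz.
    rewrite le_eqVlt; apply/orP; left; apply/eqP; move: An pn.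
    move: (A k.+1 w) (1 + zz ^+ 2) (`|eta k.+1 w|) => u v t u0 v0.
    by field; rewrite u0 v0.
  rewrite -ler_pdivlMr// in t2; apply: le_trans t2 _.
  (* The variance expansion leaves q^2 = s^2 / A^4. One factor s is traded for 3 e A by
     [am_s_scale], so that this error has the form of the cubic one. *)
  have -> : 9 * 12 ^+ 3 * e * (bmp y k w * s k.+1 w) =
      3 * 12 ^+ 3 * (3 * e * A k.+1 w * s k.+1 w / A k.+1 w ^+ 4) / (1 + zz ^+ 2).
    rewrite /bump -/zz; move: An pn.
    move: (12 ^+ 3) (A k.+1 w) (1 + zz ^+ 2) => c u v u0 v0.
    by field; rewrite u0 v0.
  rewrite ler_pM2r ?invr_gt0// ler_wpM2l ?mulr_ge0 ?exprn_ge0//.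
  rewrite (_ : q ^+ 2 = s k.+1 w * s k.+1 w / A k.+1 w ^+ 4); last by rewrite /q; field.
  rewrite ler_wpM2r ?invr_ge0 ?exprn_ge0 ?(ltW (A0 w))// ler_wpM2r//.
  exact: am_s_scale.
have hRt : `|Ex Q Rt| <= (48 * K + 9 * 12 ^+ 3) * e * Ex Q (fun w => bmp y k w * s k.+1 w).
  have i4 : L1 Q (fun w => 48 * (bmp y k w * `|eta k.+1 w| ^+ 3)) by exact: L1Z.
  have i5 : L1 Q (fun w => 9 * 12 ^+ 3 * e * (bmp y k w * s k.+1 w)) by exact: L1Z.
  apply: le_trans (Ex_absW iRt (L1D i4 i5) Rtle) _.
  rewrite (ExD i4 i5) (ExZ _ i3) (ExZ _ iBs).
  have gen (u v c : R) : u <= K * e * v -> 48 * u + 9 * c * e * v <= (48 * K + 9 * c) * e * v.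
    move=> h; have -> : (48 * K + 9 * c) * e * v = 48 * (K * e * v) + 9 * c * e * v by ring.
    by rewrite lerD2r ler_wpM2l.
  exact: gen.
have iA p : L1 Q (fun w => (A k.+1 w) ^- p).
  apply: (L1b (c := a ^- p) kn') => [|w]; first by apply: mwrtV; exact: mwrtX.
  by rewrite ger0_norm ?inv_scale_le// invr_ge0 exprn_ge0// ltW.
have iAs p : L1 Q (fun w => s k.+1 w * (A k.+1 w) ^- p).
  by have := am_L1s AM kn (iA p); congr L1; apply/funext => w; rewrite mulrC.
have /andP[al0 _] := am_al AM; have /andP[be0 _] := am_be AM.
have b1 : Ex Q (fun w => `|P1 w| * s k.+1 w) <= Ex Q (fun w => s k.+1 w * (A k.+1 w)^-1).
  apply: Ex_le (am_L1s AM kn (L1_abs iP1)) (iAs 1%N) _.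
  by move=> w; rewrite mulrC ler_wpM2l.
have b2 : Ex Q (fun w => `|P2 w| * s k.+1 w) <= 8 * Ex Q (fun w => s k.+1 w * (A k.+1 w) ^- 2).
  rewrite -(ExZ _ (iAs 2%N)); apply: Ex_le (am_L1s AM kn (L1_abs iP2)) (L1Z _ (iAs 2%N)) _.
  by move=> w; rewrite mulrC mulrCA ler_wpM2l.
rewrite ERt; apply: le_trans (ler_normB _ _) _.
apply: lerD; first (apply: le_trans (ler_normB _ _) _; apply: lerD => //).
  by apply: le_trans h1 _; rewrite ler_wpM2l.
by apply: le_trans h2 _; rewrite [8 * be]mulrC -[leRHS]mulrA ler_wpM2l.
Qed.

End lindeberg.

(** * Contraction inequality for the distance to the normal law *)

Section berry_esseen_bound.
Context (R : realType) d (T : measurableType d) (Q : probability T R).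
Variables (n : nat) (F : nat -> set (set T)) (eta s : nat -> T -> R).
Variables (e dl al be K a : R).
Hypothesis AM : approx_martingale Q n F eta s e dl al be K.
Hypothesis ea : 4 * e <= a.
Hypothesis a1 : a <= 1.

Local Notation S := (mart_sum eta).
Local Notation V := (mart_sum s).
Local Notation A := (scale s dl a).
Local Notation Phi := (@std_normal_cdf R).

Let sF := am_sigma AM.
Let s_ge0 := am_s_ge0 AM.
Let e_gt0 := am_e AM.

Let a_gt0 : 0 < a.
Proof. by apply: lt_le_trans ea; rewrite mulr_gt0// (am_e AM). Qed.

Let mSn : measurable_fun setT (S n).
Proof. exact: (am_measurable AM (leqnn n) (am_measurable_S AM (leqnn n))). Qed.

(** The bump times s, with S_k replaced by the final value S_n. The distance to y is then the same
    for all k, as [sum_scale_dist] requires. *)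
Definition late_bump y k w : R :=
  s k.+1 w * (A k.+1 w) ^- 3 / (1 + `|S n w - y| ^+ 2 / A k.+1 w ^+ 2).

Let opz (x : R) : 0 < 1 + x ^+ 2.
Proof. by have := sqr_ge0 x; lra. Qed.

Let A0 k w : (k < n)%N -> 0 < A k.+1 w.
Proof. by move=> kn; exact: (scale_gt0 AM ea). Qed.

Let W k w := s k.+1 w * (A k.+1 w) ^- 3.

Let W0 k w : (k < n)%N -> 0 <= W k w.
Proof.
by move=> kn; rewrite mulr_ge0// invr_ge0 exprn_ge0// ltW// A0.
Qed.

Let Wle k w : (k < n)%N -> W k w <= 12 * e ^+ 2 * a ^- 3.
Proof.
move=> kn; apply: ler_pM => //; last exact: (inv_scale_le AM ea).
  by rewrite invr_ge0 exprn_ge0// ltW// A0.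
exact: (am_s_le AM).
Qed.

Let mW k : (k < n)%N -> measurable_wrt (F k) (W k).
Proof.
move=> kn; have sG := sF (ltnW kn).
apply: (mwrtM sG); first exact: (am_predictable AM).
apply: mwrtV; apply: mwrtX.
exact: (am_measurable_scale a AM (ltnW kn) kn (am_measurable_V AM kn)).
Qed.

Lemma late_bump_bound y k w : (k < n)%N -> 0 <= late_bump y k w <= 12 * e ^+ 2 * a ^- 3.
Proof.
move=> kn; have A2 : 0 < A k.+1 w ^+ 2 by rewrite exprn_gt0// A0.
have x0 : 0 <= `|S n w - y| ^+ 2 / A k.+1 w ^+ 2.
  by apply: divr_ge0 (ltW A2); exact: sqr_ge0.
rewrite /late_bump -/(W k w); apply/andP; split.
  by apply: divr_ge0; [exact: W0|lra].
rewrite ler_pdivrMr; last lra.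
by apply: le_trans (Wle w kn) _; rewrite ler_peMr ?(le_trans (W0 w kn))//; [exact: Wle|lra].
Qed.

Lemma late_bump_L1 y k : (k < n)%N -> L1 Q (late_bump y k).
Proof.
move=> kn; apply: (@L1_bnd _ _ _ _ _ (12 * e ^+ 2 * a ^- 3)); last first.
  by move=> w; have /andP[h1 h2] := late_bump_bound y w kn; rewrite ger0_norm.
have mA := am_measurable AM (ltnW kn)
  (am_measurable_scale a AM (ltnW kn) kn (am_measurable_V AM kn)).
apply: measurable_funM; first exact: (am_measurable AM (ltnW kn) (mW kn)).
apply: measurableT_comp; first exact: invr_measurable.
apply: measurable_funD => //; apply: measurable_funM.
  apply: measurable_funX; apply: measurableT_comp => //.
  exact: measurable_funB.
apply: measurableT_comp; first exact: invr_measurable.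
exact: measurable_funX.
Qed.

(* The tangent line of 1/t at c turns the upper bound on the conditional second moment of S_n - S_k into a lower bound on the conditional mean of the late bump. *)
Lemma bump_le_late_bump y k : (k < n)%N ->
  Ex Q (fun w => bump eta s dl a y k w * s k.+1 w) <= 61 * Ex Q (late_bump y k).
Proof.
move=> kn; have kn' := ltnW kn; have sG := sF kn'.
have mA := am_measurable_scale a AM kn' kn (am_measurable_V AM kn).
pose z w := (y - S k w) / A k.+1 w.
have mz : measurable_wrt (F k) z by exact: (am_measurable_ratio a AM y kn).
(* The denominator t of the late bump is at most 1 + 2 z^2 + 2 D^2 / A^2, that is c - 60 + 2 D^2 /
   A^2. The reserve 60 = 2 * 30 pays for the mean of the last term, bounded in [hUD2] through 15 * 2
   = 30. Finally c <= 61 (1 + z^2) returns to the bump. *)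
pose c w := 61 + 2 * z w ^+ 2.
have c61 w : 61 <= c w by rewrite /c; have := sqr_ge0 (z w); lra.
have c0 w : 0 < c w by have := c61 w; lra.
have mc : measurable_wrt (F k) c by rewrite /c; mwrt_auto sG.
have A2 w : 0 < A k.+1 w ^+ 2 by rewrite exprn_gt0// A0.
have mWk := mW kn.
have bnd (X : T -> R) (C : R) : measurable_wrt (F k) X ->
    (forall w, 0 <= X w <= C) -> L1 Q X.
  move=> mX XC; apply: (@L1_bnd _ _ _ _ _ C); first exact: (am_measurable AM kn' mX).
  by move=> w; have /andP[? ?] := XC w; rewrite ger0_norm.
pose Wc p w := W k w * (c w) ^- p.
have Wc_bnd p w : 0 <= Wc p w <= 12 * e ^+ 2 * a ^- 3.
  have h0 : 0 < c w ^+ p by rewrite exprn_gt0.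
  have h1 : 1 <= c w ^+ p by rewrite exprn_ege1//; have := c61 w; lra.
  rewrite /Wc; apply/andP; split; first by rewrite mulr_ge0 ?W0// invr_ge0 ltW.
  rewrite ler_pdivrMr//; apply: le_trans (Wle w kn) _.
  by rewrite ler_peMr// (le_trans (W0 w kn))// Wle.
have mWc p : measurable_wrt (F k) (Wc p) by rewrite /Wc; mwrt_auto sG.
have iWc p : L1 Q (Wc p) := bnd _ _ (mWc p) (Wc_bnd p).
(* The predictable weight that D^2 receives in the tangent line of 1/t at c, including the slope
   c^-2 and the scaling by A^2. *)
pose U w := Wc 2 w * (A k.+1 w) ^- 2.
have mU : measurable_wrt (F k) U by rewrite /U; mwrt_auto sG.
have U0 w : 0 <= U w.
  by have /andP[h _] := Wc_bnd 2%N w; rewrite mulr_ge0// invr_ge0 ltW.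
have iU : L1 Q U.
  apply: (bnd _ (12 * e ^+ 2 * a ^- 3 * a ^- 2) mU) => w; rewrite U0/=.
  have /andP[h1 h2] := Wc_bnd 2%N w.
  by apply: ler_pM => //; [rewrite invr_ge0 ltW|exact: (inv_scale_le AM ea)].
have kE : (k + (n - k))%N = n by rewrite subnKC.
have [] := @am_increment_sqr _ _ _ _ _ _ _ _ _ _ _ _ _ AM k (n - k) U _ mU U0 iU.
  by rewrite kE.
rewrite kE => iUD hUD.
pose D w := S n w - S k w.
have hUD2 : Ex Q (fun w => U w * D w ^+ 2) <= 30 * Ex Q (Wc 2).
  have r01 w := am_restP AM w (leqnn n).
  have iUrD : L1 Q (fun w => U w * (1 + remaining s dl n w) * (S n w - S k w) ^+ 2).
    apply: (L1_le _ (L1Z 3 iUD)) => [|w].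
      apply: measurable_funM; last first.
        apply: measurable_funX; apply: measurable_funB => //.
        exact: (am_measurable AM kn' (am_measurable_S AM kn')).
      apply: measurable_funM; first exact: L1_meas iU.
      apply: measurable_funD => //; apply: measurable_funB => //.
      exact: (am_measurable AM (leqnn n) (am_measurable_V' AM (leqnn n))).
    have /andP[r0 r2] := r01 w; have UD0 := mulr_ge0 (U0 w) (sqr_ge0 (S n w - S k w)).
    rewrite ger0_norm; last by rewrite mulrAC mulr_ge0//; lra.
    rewrite ger0_norm; last by rewrite mulr_ge0.
    by rewrite mulrAC [leRHS]mulrC ler_wpM2l//; lra.
  have h1 : Ex Q (fun w => U w * D w ^+ 2) <=
      Ex Q (fun w => U w * (1 + remaining s dl n w) * (S n w - S k w) ^+ 2).
    apply: Ex_le iUD iUrD _ => w.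
    have /andP[r0 r2] := r01 w; have UD0 := mulr_ge0 (U0 w) (sqr_ge0 (S n w - S k w)).
    by rewrite -[leRHS]mulrAC ler_peMr//; lra.
  have iUV : L1 Q (fun w => U w * (V n w - V k w)).
    apply: (L1_le _ (L1Z 2 iU)) => [|w].
      apply: measurable_funM; first exact: L1_meas iU.
      apply: measurable_funB.
        exact: (am_measurable AM (leqnn n) (am_measurable_V' AM (leqnn n))).
      exact: (am_measurable AM kn' (am_measurable_V' AM kn')).
    have /andP[r0 r2] := am_restP AM w kn'; have /andP[q0 q2] := r01 w.
    have hV := am_V_homo AM w kn'; have U0w := U0 w.
    rewrite ger0_norm; last by rewrite mulr_ge0// subr_ge0.
    rewrite ger0_norm; last by rewrite mulr_ge0.
    by rewrite mulrC ler_wpM2r//; move: r2 q0; rewrite /remaining; lra.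
  have h2 : Ex Q (fun w => U w * (V n w - V k w)) <= 2 * Ex Q (Wc 2).
    rewrite -(ExZ _ (iWc 2%N)); apply: Ex_le iUV (L1Z _ (iWc 2%N)) _ => w.
    have /andP[q0 q2] := r01 w.
    have hV : V n w - V k w <= 2 * A k.+1 w ^+ 2.
      have := scaleS a AM w kn; rewrite (scale_sqr a AM w kn') => E.
      have := am_s_scale_sqr AM ea w kn; move: q0 E; rewrite /remaining.
      by have := sqr_ge0 a; lra.
    have -> : 2 * Wc 2 w = U w * (2 * A k.+1 w ^+ 2).
      rewrite /U; move: (lt0r_neq0 (A2 w)); move: (A k.+1 w ^+ 2) (Wc 2 w) => u v u0.
      by field.
    by rewrite ler_wpM2l.
  by move: hUD h1 h2; set x1 := Ex Q _; set x2 := Ex Q _; set x3 := Ex Q _;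
    set x4 := Ex Q _; lra.
have iLB := late_bump_L1 y kn.
have key w : Wc 1 w + 60 * Wc 2 w <= late_bump y k w + 2 * (U w * D w ^+ 2).
  pose t := 1 + `|S n w - y| ^+ 2 / A k.+1 w ^+ 2.
  have t0 : 0 < t.
    rewrite /t; apply: ltr_pwDl => //.
    by apply: divr_ge0 (ltW (A2 w)); exact: sqr_ge0.
  have tle : t <= c w - 60 + 2 * (D w ^+ 2 / A k.+1 w ^+ 2).
    have -> : c w - 60 + 2 * (D w ^+ 2 / A k.+1 w ^+ 2) =
        1 + 2 * ((y - S k w) ^+ 2 + D w ^+ 2) / A k.+1 w ^+ 2.
      rewrite /c /z expr_div_n; move: (lt0r_neq0 (A2 w)).
      by move: (A k.+1 w ^+ 2) ((y - S k w) ^+ 2) (D w ^+ 2) => u v x u0; field.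
    rewrite lerD2l ler_pM2r ?invr_gt0// real_normK ?num_real//.
    have -> : S n w - y = D w - (y - S k w) by rewrite /D; ring.
    move: (D w) (y - S k w) => u v; have := sqr_ge0 (u + v).
    have -> : (u + v) ^+ 2 = 2 * (v ^+ 2 + u ^+ 2) - (u - v) ^+ 2 by ring.
    by lra.
  have tangent : (c w)^-1 + 60 * (c w) ^- 2 <= t^-1 + 2 * ((c w) ^- 2 * (D w ^+ 2 / A k.+1 w ^+ 2)).
    have cw := c0 w; have c2 : 0 < (c w) ^- 2 by rewrite invr_gt0 exprn_gt0.
    have h : 2 * (c w)^-1 - t * (c w) ^- 2 <= t^-1.
      rewrite -subr_ge0.
      have -> : t^-1 - (2 * (c w)^-1 - t * (c w) ^- 2) = t^-1 * (1 - t / c w) ^+ 2.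
        move: (lt0r_neq0 t0) (lt0r_neq0 cw); move: (t) (c w) => u v u0 v0.
        by field; rewrite u0 v0.
      by rewrite mulr_ge0 ?sqr_ge0// invr_ge0 ltW.
    have gen (x u v X ui xi : R) : 0 <= v -> u * v = ui -> x <= u - 60 + 2 * X ->
        2 * ui - x * v <= xi -> ui + 60 * v <= xi + 2 * (v * X).
      move=> v0 uv xu xv; have := ler_wpM2r v0 xu.
      by rewrite mulrDl mulrBl uv -mulrA [X * v]mulrC; lra.
    apply: gen (ltW c2) _ tle h.
    by move: (lt0r_neq0 cw); move: (c w) => v v0; field.
  have := ler_wpM2l (W0 w kn) tangent.
  rewrite /late_bump -/(W k w) -/t /U /Wc expr1.
  move: ((c w)^-1) ((c w) ^- 2) (W k w) (t^-1) (D w ^+ 2) ((A k.+1 w) ^- 2).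
  move=> x1 x2 x3 x4 x5 x6.
  have -> : x3 * (x1 + 60 * x2) = x3 * x1 + 60 * (x3 * x2) by ring.
  by have -> : x3 * (x4 + 2 * (x2 * (x5 * x6))) = x3 * x4 + 2 * (x3 * x2 * x6 * x5) by ring.
have i1 : L1 Q (fun w => Wc 1 w + 60 * Wc 2 w) := L1D (iWc 1%N) (L1Z 60 (iWc 2%N)).
have i2 : L1 Q (fun w => late_bump y k w + 2 * (U w * D w ^+ 2)) := L1D iLB (L1Z 2 iUD).
have := Ex_le i1 i2 key.
rewrite (ExD (iWc 1%N) (L1Z 60 (iWc 2%N))) (ExD iLB (L1Z 2 iUD)) (ExZ _ iUD) (ExZ _ (iWc 2%N)).
have : Ex Q (fun w => bump eta s dl a y k w * s k.+1 w) <= 61 * Ex Q (Wc 1).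
  rewrite -(ExZ _ (iWc 1%N)); apply: Ex_le (am_L1s AM kn (am_L1_bump AM ea y kn)) (L1Z _ (iWc 1%N)) _ => w.
  rewrite /bump /standardized -/(z w) /Wc expr1 (_ : _ * s k.+1 w = W k w * (1 + z w ^+ 2)^-1); last first.
    by rewrite /W; ring.
  rewrite mulrCA ler_wpM2l ?W0//.
  rewrite -[leLHS]mul1r ler_pdivrMr ?opz// mulrAC ler_pdivlMr// mul1r /c.
  by have := sqr_ge0 (z w); lra.
move: hUD2; rewrite -/(Ex Q _).
set x1 := Ex Q _; set x2 := Ex Q _; set x3 := Ex Q _; set x4 := Ex Q _; set x5 := Ex Q _.
lra.
Qed.

End berry_esseen_bound.

Section berry_esseen_contraction.
Context (R : realType) d (T : measurableType d) (Q : probability T R).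
Variables (n : nat) (F : nat -> set (set T)) (eta s : nat -> T -> R).
Variables (e dl al be K a D : R).
Hypothesis AM : approx_martingale Q n F eta s e dl al be K.
Hypothesis K0 : 0 <= K.
Hypothesis ea : 4 * e <= a.
Hypothesis a1 : a <= 1.
Hypothesis V_ge : {ae Q, forall w, 1 - dl ^+ 2 <= mart_sum s n w}.
Hypothesis SD : forall y,
  `|fine (Q [set w | mart_sum eta n w <= y]) - std_normal_cdf y| <= D.

Local Notation S := (mart_sum eta).
Local Notation V := (mart_sum s).
Local Notation A := (scale s dl a).
Local Notation Phi := (@std_normal_cdf R).
Local Notation f := (smooth_cdf eta s dl a).
Local Notation C1 := (48 * K + 9 * 12 ^+ 3).

Let a_gt0 : 0 < a.
Proof. by apply: lt_le_trans ea; rewrite mulr_gt0// (am_e AM). Qed.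

Let mSn : measurable_fun setT (S n).
Proof. exact: (am_measurable AM (leqnn n) (am_measurable_S AM (leqnn n))). Qed.

Let inv_dist y : Ex Q (fun w => (a + `|S n w - y|)^-1) <= 7 + 12 * `|ln a| + 8 * D / a.
Proof. by apply: (Ex_inv_dist_le mSn SD); rewrite a_gt0 a1. Qed.

Let L1_inv_dist y : L1 Q (fun w => (a + `|S n w - y|)^-1).
Proof.
have inv0 w : 0 < a + `|S n w - y| by apply: ltr_pwDl.
apply: (@L1_bnd _ _ _ _ _ a^-1).
  apply: measurableT_comp; first exact: invr_measurable.
  apply: measurable_funD => //.
  by apply: measurableT_comp => //; exact: measurable_funB.
move=> w; rewrite ger0_norm ?invr_ge0 ?(ltW (inv0 w))//.
by rewrite lef_pV2 ?posrE// lerDl.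
Qed.

Let sum_late_bump y :
  \sum_(0 <= k < n) Ex Q (late_bump n eta s dl a y k)
    <= 12 * (7 + 12 * `|ln a| + 8 * D / a).
Proof.
have iLB k : (0 <= k < n)%N -> L1 Q (late_bump n eta s dl a y k).
  by move=> /andP[_ kn]; exact: (late_bump_L1 AM ea).
rewrite -(Ex_sum iLB).
apply: (@le_trans _ _ (12 * Ex Q (fun w => (a + `|S n w - y|)^-1))).
  rewrite -(ExZ _ (L1_inv_dist y)).
  apply: Ex_le (L1_sum iLB) (L1Z _ (L1_inv_dist y)) _ => w.
  exact: (@sum_scale_dist R (fun k => A k w) (fun k => s k w) n a a_gt0
    (fun k => scale_ge AM ea w (k := k)) (fun k => scale_ratio AM ea w (k := k))
    (fun k => scaleS a AM w (k := k)) (am_s_ge0 AM ^~ w) `|S n w - y| (normr_ge0 _)).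
by rewrite ler_pM2l.
Qed.

Let iA p k : (k < n)%N -> L1 Q (fun w => s k.+1 w * (A k.+1 w) ^- p).
Proof.
move=> kn; have A0 w := scale_gt0 AM ea w kn.
have iAp : L1 Q (fun w => (A k.+1 w) ^- p).
  apply: (@L1_bnd _ _ _ _ _ (a ^- p)) => [|w].
    apply: measurableT_comp; first exact: invr_measurable.
    apply: measurable_funX; apply: (am_measurable AM (ltnW kn)).
    exact: (am_measurable_scale a AM (ltnW kn) kn (am_measurable_V AM kn)).
  by rewrite ger0_norm ?(inv_scale_le AM ea)// invr_ge0 exprn_ge0// ltW.
by have := am_L1s AM kn iAp; congr L1; apply/funext => w; rewrite mulrC.
Qed.

Let sum_inv : \sum_(0 <= k < n) Ex Q (fun w => s k.+1 w * (A k.+1 w)^-1) <= 6.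
Proof.
have i k : (0 <= k < n)%N -> L1 Q (fun w => s k.+1 w * (A k.+1 w)^-1).
  by move=> /andP[_ kn]; exact: (iA 1 kn).
rewrite -(Ex_sum i) -[leRHS](Ex_cst Q 6).
apply: Ex_le (L1_sum i) (L1_cst _ _) _ => w.
have := @sum_scale_inv R (fun k => A k w) (fun k => s k w) n a a_gt0
  (fun k => scale_ge AM ea w (k := k)) (fun k => scale_ratio AM ea w (k := k))
  (fun k => scaleS a AM w (k := k)) (am_s_ge0 AM ^~ w).
by have := scale_le2 AM ea a1 w (leq0n n); lra.
Qed.

Let sum_inv_sqr :
  \sum_(0 <= k < n) Ex Q (fun w => s k.+1 w * (A k.+1 w) ^- 2) <= 8 * (1 + `|ln a|).
Proof.
have i k : (0 <= k < n)%N -> L1 Q (fun w => s k.+1 w * (A k.+1 w) ^- 2).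
  by move=> /andP[_ kn]; exact: (iA 2 kn).
rewrite -(Ex_sum i) -[leRHS](Ex_cst Q (8 * (1 + `|ln a|))).
apply: Ex_le (L1_sum i) (L1_cst _ _) _ => w.
have := @sum_scale_inv_sqr R (fun k => A k w) (fun k => s k w) n a a_gt0
  (fun k => scale_ge AM ea w (k := k)) (fun k => scale_ratio AM ea w (k := k))
  (fun k => scaleS a AM w (k := k)) (am_s_ge0 AM ^~ w).
have h0 : ln (A 0 w) <= 1.
  apply: le_trans (_ : ln 2 <= _).
    by rewrite ler_ln ?posrE// ?(scale_gt0 AM ea)// (scale_le2 AM ea a1).
  have h : -1 < 1 :> R by lra.
  by have := le_ln1Dx h.
have h1 : ln a <= ln (A n w).
  by rewrite ler_ln ?posrE// ?(scale_gt0 AM ea)// (scale_ge AM ea).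
by rewrite (ler0_norm (ln_le0 a1)); lra.
Qed.

Let C1_ge0 : 0 <= C1.
Proof. by rewrite addr_ge0// mulr_ge0// exprn_ge0. Qed.

Lemma lindeberg_total y : `|Ex Q (f y n) - Ex Q (f y 0)| <=
  C1 * e * (61 * (12 * (7 + 12 * `|ln a| + 8 * D / a)))
  + al * 6 + 8 * be * (8 * (1 + `|ln a|)).
Proof.
have -> : Ex Q (f y n) - Ex Q (f y 0) =
    \sum_(0 <= k < n) (Ex Q (f y k.+1) - Ex Q (f y k)).
  by rewrite (telescope_sumr (fun k => Ex Q (f y k))).
apply: le_trans (ler_norm_sum _ _ _) _.
apply: (@le_trans _ _ (\sum_(0 <= k < n) (C1 * e * (61 * Ex Q (late_bump n eta s dl a y k))
    + al * Ex Q (fun w => s k.+1 w * (A k.+1 w)^-1)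
    + 8 * be * Ex Q (fun w => s k.+1 w * (A k.+1 w) ^- 2)))).
  rewrite !big_nat; apply: ler_sum => k /andP[_ kn].
  apply: le_trans (lindeberg_step AM ea y kn) _.
  rewrite !lerD2r ler_wpM2l ?mulr_ge0 ?(ltW (am_e AM))//.
  exact: (bump_le_late_bump AM ea).
have /andP[al0 _] := am_al AM; have /andP[be0 _] := am_be AM.
rewrite !big_split/= -!mulr_sumr.
apply: lerD; first apply: lerD.
- rewrite ler_wpM2l ?mulr_ge0 ?(ltW (am_e AM))// ler_pM2l//.
- by rewrite ler_wpM2l.
- by rewrite ler_wpM2l ?mulr_ge0.
Qed.

Let dl2 : 0 <= dl ^+ 2 <= 1.
Proof. by have /andP[d0 d1] := am_dl AM; rewrite sqr_ge0 exprn_ile1. Qed.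

(** At time 0 the smoothed value is deterministic: a normal distribution function of variance 1 +
    dl^2 + a^2. *)
Let initial y : `|Ex Q (f y 0) - Phi y| <= 3 * (dl ^+ 2 + a ^+ 2).
Proof.
have /andP[d0 d1] := dl2.
have a2 : 0 <= a ^+ 2 <= 1 by rewrite sqr_ge0 exprn_ile1// ltW.
have /andP[a20 a21] := a2.
set q := dl ^+ 2 + a ^+ 2.
have q1 : 0 < 1 + q by rewrite /q; lra.
have -> : Ex Q (f y 0) = Phi (y * (Num.sqrt (1 + q))^-1).
  rewrite -[RHS](Ex_cst Q); congr Ex; apply/funext => w.
  by rewrite /smooth_cdf /scale /remaining !mart_sum0 !subr0 addrA.
apply: (@std_normal_cdf_shrink_le R y _ q).
- by rewrite /q; apply/andP; split; lra.
- by rewrite invr_gt0 sqrtr_gt0.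
- by rewrite exprVn sqr_sqrtr ?(ltW q1)// mulVf// gt_eqF.
Qed.

Lemma berry_esseen_contraction z :
  `|fine (Q [set w | S n w <= z]) - Phi z| <=
  4 / 3 * (C1 * e * (61 * (12 * (7 + 12 * `|ln a| + 8 * D / a)))
    + al * 6 + 8 * be * (8 * (1 + `|ln a|)) + 3 * (dl ^+ 2 + a ^+ 2))
  + 16 / 3 * (2 * dl + a) + D / 3.
Proof.
have /andP[dl0 _] := am_dl AM.
(* Almost surely the last scale satisfies A_n^2 <= 2 dl^2 + a^2 <= b^2, so the final smoothing is at
   scale at most b. Taking the minimum with b makes this hold everywhere, as [smoothing_inequality]
   demands, without changing expectations. *)
pose b := 2 * dl + a; have b0 : 0 < b by rewrite /b; have := a_gt0; lra.
have An w := scale_gt0 AM ea w (leqnn n).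
pose m w := Num.min (A n w) b.
have m0 w : 0 < m w by rewrite lt_min An b0.
have mb w : m w <= b by rewrite ge_min lexx orbT.
have mAn : measurable_fun setT (A n).
  exact: (am_measurable AM (leqnn n) (am_measurable_scale a AM (leqnn n) (leqnn n) (am_measurable_V' AM (leqnn n)))).
pose g y w := Phi ((y - S n w) / m w).
have mg y : measurable_fun setT (g y).
  apply: (measurableT_comp (@measurable_std_normal_cdf R)).
  apply: measurable_funM; first exact: measurable_funB.
  apply: measurableT_comp; first exact: invr_measurable.
  exact: measurable_minr.
have g01 y w : 0 <= g y w <= 1 by rewrite std_normal_cdf_ge0 std_normal_cdf_le1.
have gf y : Ex Q (g y) = Ex Q (f y n).
  apply: Ex_ae.
  - by apply: (@L1_bnd _ _ _ _ _ 1) => // w; have /andP[? ?] := g01 y w; rewrite ger0_norm.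
  - exact: (am_L1_smooth a AM y (leqnn n)).
  apply: filterS V_ge => w hV; rewrite /g /smooth_cdf /m min_l//.
  suff : A n w ^+ 2 <= b ^+ 2 by rewrite ler_pXn2r ?nnegrE ?(ltW (An w)) ?(ltW b0).
  rewrite (scale_sqr a AM w (leqnn n)) /remaining /b.
  have -> : (2 * dl + a) ^+ 2 = 2 * dl ^+ 2 + a ^+ 2 + (2 * dl ^+ 2 + 4 * (dl * a)) by ring.
  have := mulr_ge0 dl0 (ltW a_gt0); have /andP[? _] := dl2; lra.
apply: (smoothing_inequality mSn SD b0 mg g01).
- move=> y w Xy; apply: std_normal_cdf_le; rewrite ler_wpM2l ?subr_ge0//.
  by rewrite lef_pV2 ?posrE.
- move=> y w yX; apply: std_normal_cdf_le; rewrite ler_wnM2l ?subr_le0//.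
  by rewrite lef_pV2 ?posrE.
- move=> y; rewrite gf.
  have -> : Ex Q (f y n) - Phi y = (Ex Q (f y n) - Ex Q (f y 0)) + (Ex Q (f y 0) - Phi y).
    by move: (Ex Q _) (Ex Q _) (Phi y) => u v t; ring.
  by apply: le_trans (ler_normD _ _) _; apply: lerD; [exact: lindeberg_total|exact: initial].
Qed.

End berry_esseen_contraction.

Lemma ln_half_ge (R : realType) (e : R) : 0 < e <= 1 / 2 -> 1 <= 2 * `|ln e|.
Proof.
move=> /andP[e0 e2].
have h : -1 < e - 1 by lra.
have := le_ln1Dx h; rewrite addrC subrK => le.
by rewrite ler0_norm; lra.
Qed.

(** The constant is fixed before the probability space, because the bound is applied to tilted
    probabilities that depend on x and on the martingale. *)
Theorem am_berry_esseen (R : realType) (K : R) : 0 <= K ->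
  exists C : R, 0 < C /\
  forall d (T : measurableType d) (Q : probability T R) n F eta s e dl al be,
    e <= 1 / 2 -> approx_martingale Q n F eta s e dl al be K ->
    {ae Q, forall w, 1 - dl ^+ 2 <= mart_sum s n w} ->
    forall y, `|fine (Q [set w | mart_sum eta n w <= y]) - std_normal_cdf y|
      <= C * (e * `|ln e| + al + be * `|ln e| + dl).
Proof.
move=> K0; pose C1 := 48 * K + 9 * 12 ^+ 3.
have C10 : 0 <= C1 by rewrite addr_ge0// mulr_ge0// exprn_ge0.
(* With a = kp e the term containing D / a is at most D / 4, hence D / 3 after the factor 4/3; with
   the D / 3 of the smoothing this is 2 D / 3. The summand 4 ensures 4 e <= a. The constant [C]
   collects the other terms after multiplication by 3. *)
pose kp := 32 * (61 * 12) * C1 + 4.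
have kp4 : 4 <= kp by rewrite /kp lerDr !mulr_ge0.
pose C := 4 * (61 * 12) * 26 * C1 + 56 * kp + 24 * 32 + 44.
have C0 : 0 < C.
  by rewrite /C; have := mulr_ge0 (_ : 0 <= 4 * (61 * 12) * 26) C10; lra.
exists C; split=> // d T Q n F eta s e dl al be e2 AM Vge y.
have e0 := am_e AM; have /andP[dl0 dl1] := am_dl AM.
have /andP[al0 _] := am_al AM; have /andP[be0 _] := am_be AM.
have L2 := ln_half_ge (introT andP (conj e0 e2)).
set L := `|ln e| in L2 *.
have L0 : 0 <= L by exact: normr_ge0.
have eL := mulr_ge0 (ltW e0) L0; have beL := mulr_ge0 be0 L0.
have mS : measurable_fun setT (mart_sum eta n).
  exact: (am_measurable AM (leqnn n) (am_measurable_S AM (leqnn n))).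
have le1 z : `|fine (Q [set w | mart_sum eta n w <= z]) - std_normal_cdf z| <= 1.
  have := prob_ge0 Q [set w | mart_sum eta n w <= z].
  have := prob_le1 Q (measurable_le z mS).
  have := std_normal_cdf_ge0 z; have := std_normal_cdf_le1 z.
  by rewrite ler_norml => *; apply/andP; split; lra.
have CC1 : 0 <= 4 * (61 * 12) * 26 * C1 by rewrite !mulr_ge0.
have big : 2 * kp <= C by rewrite /C; lra.
have tot : e * L <= e * L + al + be * L + dl by lra.
have tot0 : 0 <= e * L + al + be * L + dl by lra.
(* If kp e exceeds 1, the claimed bound exceeds 1 and is trivial. *)
have [a1|] := leP (kp * e) 1; last first.
  move=> ke; apply: le_trans (le1 y) _; apply: le_trans (ltW ke) _.
  apply: (@le_trans _ _ (2 * kp * (e * L))).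
    have -> : 2 * kp * (e * L) = kp * e * (2 * L) by ring.
    by rewrite ler_peMr// mulr_ge0//; lra.
  by apply: ler_pM => //; lra.
pose a := kp * e.
have a0 : 0 < a by rewrite mulr_gt0//; lra.
have ea : 4 * e <= a by rewrite ler_wpM2r// ltW.
pose E := [set r | exists z, r = `|fine (Q [set w | mart_sum eta n w <= z]) - std_normal_cdf z|].
have supE : has_sup E.
  split; first by exists `|fine (Q [set w | mart_sum eta n w <= 0]) - std_normal_cdf 0|; exists 0.
  by exists 1 => _ [z ->]; exact: le1.
(* The contraction is applied to the best constant. It is finite, being at most 1, so 2 D / 3 can be
   moved to the left-hand side. *)
pose D := sup E.
have SD z : `|fine (Q [set w | mart_sum eta n w <= z]) - std_normal_cdf z| <= D.
  by apply: ub_le_sup; [case: supE|exists z].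
have D0 : 0 <= D by exact: le_trans (SD 0).
have DB := berry_esseen_contraction AM K0 ea a1 Vge SD.
have {}DB : D <= 4 / 3 * (C1 * e * (61 * (12 * (7 + 12 * `|ln a| + 8 * D / a)))
    + al * 6 + 8 * be * (8 * (1 + `|ln a|)) + 3 * (dl ^+ 2 + a ^+ 2))
  + 16 / 3 * (2 * dl + a) + D / 3.
  by apply: ge_sup; [case: supE|move=> _ [z ->]; exact: DB].
have La : `|ln a| <= L.
  rewrite /L ler0_norm ?ln_le0// ler0_norm; last by apply: ln_le0; lra.
  rewrite lerN2 ler_ln ?posrE//; lra.
have kp0 : kp != 0 by rewrite gt_eqF//; lra.
have h1 : C1 * e * (61 * (12 * (8 * D / a))) <= D / 4.
  have -> : C1 * e * (61 * (12 * (8 * D / a))) = D / 4 * (32 * (61 * 12) * C1 / kp).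
    by rewrite /a; move: (lt0r_neq0 e0) kp0; move: (kp) (C1) (D) => k c u e_0 k0; field; rewrite e_0 k0.
  rewrite ler_piMr//; first lra.
  by rewrite ler_pdivrMr; rewrite /kp; lra.
apply: le_trans (SD y) _.
have h2 : C1 * e * (61 * (12 * (7 + 12 * `|ln a|))) <= 61 * 12 * 26 * (C1 * (e * L)).
  have -> : 61 * 12 * 26 * (C1 * (e * L)) = C1 * e * (61 * (12 * (26 * L))).
    by move: (C1) => c; ring.
  rewrite ler_wpM2l ?mulr_ge0 ?(ltW e0)// ler_wpM2l// ler_wpM2l//; lra.
have h3 : be * (1 + `|ln a|) <= 3 * (be * L).
  by rewrite mulrCA ler_wpM2l//; lra.
have h4 : a <= 2 * (kp * (e * L)).
  have -> : 2 * (kp * (e * L)) = a * (2 * L) by rewrite /a; ring.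
  by rewrite ler_peMr ?(ltW a0).
have h5 : a ^+ 2 <= a by rewrite expr2 ler_piMr ?(ltW a0).
have h6 : dl ^+ 2 <= dl by rewrite expr2 ler_piMr.
have h7 : C * (e * L + al + be * L + dl) = (4 * (61 * 12 * 26 * (C1 * (e * L)))
    + 56 * (kp * (e * L)) + (24 * 32 + 44) * (e * L)) + C * al + C * (be * L) + C * dl.
  have gen (c k u v w z : R) : (4 * (61 * 12) * 26 * c + 56 * k + 24 * 32 + 44) * (u + v + w + z) =
      4 * (61 * 12 * 26 * (c * u)) + 56 * (k * u) + (24 * 32 + 44) * u
      + (4 * (61 * 12) * 26 * c + 56 * k + 24 * 32 + 44) * v
      + (4 * (61 * 12) * 26 * c + 56 * k + 24 * 32 + 44) * w
      + (4 * (61 * 12) * 26 * c + 56 * k + 24 * 32 + 44) * z by ring.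
  exact: gen.
have Cge : 24 * 32 + 44 <= C by rewrite /C; have := kp4; have := CC1; lra.
have h8 := ler_wpM2r al0 Cge; have h9 := ler_wpM2r beL Cge; have h10 := ler_wpM2r dl0 Cge.
have dist (u p q : R) : u * (61 * (12 * (7 + p + q))) =
  u * (61 * (12 * (7 + p))) + u * (61 * (12 * q)) by ring.
rewrite h7; move: DB; rewrite dist.
have -> : 8 * be * (8 * (1 + `|ln a|)) = 64 * (be * (1 + `|ln a|)) by ring.
move: h1 h2 h3 h4 h5 h6 h8 h9 h10 eL beL.
move: (C1 * e * (61 * (12 * (7 + 12 * `|ln a|)))) (C1 * e * (61 * (12 * (8 * D / a)))) => x1 x2.
move: (C1 * (e * L)) (kp * (e * L)) (be * (1 + `|ln a|)) (C * (be * L)) => x3 x4 x5 x6.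
move: (C * al) (C * dl) (e * L) (be * L) (dl ^+ 2) (a ^+ 2) => x7 x8 x9 x10 x11 x12.
lra.
Qed.

(** * Exponential moments of one increment *)

Section limits.
Context d (T : measurableType d) (R : realType) (P : probability T R).

Lemma L1_monotone_limit (f : nat -> T -> R) (g : T -> R) (c : R) :
  (forall k, L1 P (f k)) -> (forall k w, 0 <= f k w) ->
  (forall w, nondecreasing_seq (f ^~ w)) ->
  (forall w, f ^~ w @ \oo --> g w) ->
  (forall k, Ex P (f k) <= c) -> L1 P g.
Proof.
move=> iL f0 fnd fg fc.
have mg : measurable_fun setT g.
  by apply: (@measurable_fun_cvg _ _ _ _ f) => // k; exact: L1_meas (iL k).
have g0 w : 0 <= g w.
  apply: le_trans (f0 0%N w) _; rewrite -(cvg_lim (@Rhausdorff R) (fg w)).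
  apply: nondecreasing_cvgn_le; first exact: fnd.
  by apply/cvg_ex; exists (g w).
apply: L1_ge0 => //.
have limE w : limn (fun k => (f k w)%:E) = (g w)%:E.
  by apply/cvg_lim => //; apply/cvg_EFin; [near=> k|exact: fg].
have H : (\int[P]_w (f k w)%:E)%E @[k --> \oo] --> (\int[P]_w (g w)%:E)%E.
  under [X in _ --> X]eq_integral do rewrite -limE.
  apply: cvg_monotone_convergence => // [k|k w _|w _ k l kl].
  - exact: measurable_int (iL k).
  - by rewrite lee_fin.
  - by rewrite lee_fin fnd.
apply: (@le_lt_trans _ _ c%:E); last exact: ltry.
rewrite -(cvg_lim _ H)//; apply: lime_le; first by apply/cvg_ex; eexists; exact: H.
by near=> k; rewrite ExE// lee_fin.
Unshelve. all: by end_near. Qed.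

Lemma Ex_dominated_limit_le (f : nat -> T -> R) (g h : T -> R) (c : R) :
  (forall k, measurable_fun setT (f k)) ->
  (forall w, f ^~ w @ \oo --> g w) -> L1 P h ->
  (forall k w, `|f k w| <= h w) ->
  (forall k, Ex P (f k) <= c) -> L1 P g /\ Ex P g <= c.
Proof.
move=> mf fg ih fh fc.
have mg : measurable_fun setT g by apply: (@measurable_fun_cvg _ _ _ _ f).
have il k : L1 P (f k).
  apply: (L1_le (mf k) ih) => w; apply: le_trans (fh k w) _; exact: ler_norm.
have ig : L1 P g.
  apply: (L1_le mg ih) => w; apply: le_trans (_ : h w <= _); last exact: ler_norm.
  have H : (`|f k w| @[k --> \oo]) --> `|g w| by apply: cvg_norm; exact: fg.
   rewrite -(cvg_lim (@Rhausdorff R) H).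
  apply: limr_le; first by apply/cvg_ex; eexists; exact: H.
  by near=> k; exact: fh.
split=> //; rewrite -lee_fin -ExE//.
have H : (\int[P]_w (f k w)%:E)%E @[k --> \oo] --> (\int[P]_w (g w)%:E)%E.
  apply: (dominated_cvg _ _ _ _ ih) => // [k|w _|k w _].
  - exact: measurable_int (il k).
  - by apply/cvg_EFin; [near=> k|exact: fg].
  - by rewrite lee_fin.
rewrite -(cvg_lim _ H)//; apply: lime_le; first by apply/cvg_ex; eexists; exact: H.
by near=> k; rewrite ExE// lee_fin.
Unshelve. all: by end_near. Qed.
End limits.

Section exponential.
Context (R : realType).
Implicit Types z y : R.

Lemma expR_taylor1 z : `|expR z - 1| <= `|z| * expR `|z|.
Proof.
have := @mean_value_le R expR expR 0 z (expR `|z|).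
rewrite expR0 subr0 mulrC; apply => x.
by rewrite subr0 => xz; rewrite ger0_norm ?expR_ge0// ler_expR (le_trans (ler_norm x)).
Qed.

Lemma expR_taylor2 z : `|expR z - 1 - z| <= `|z| ^+ 2 * expR `|z|.
Proof.
have := @mean_value_le R (fun x => expR x - 1 - x) (fun x => expR x - 1) 0 z (`|z| * expR `|z|).
rewrite expR0 subrr !subr0 mulrAC -expr2; apply => [x|x].
  by apply: is_derive_eq; rewrite subr0.
rewrite subr0 => xz; apply: le_trans (expR_taylor1 x) _.
by apply: ler_pM; rewrite ?expR_ge0// ler_expR.
Qed.

Lemma expR_taylor3 z : `|expR z - 1 - z - z ^+ 2 / 2| <= `|z| ^+ 3 * expR `|z|.
Proof.
have -> : `|z| ^+ 3 * expR `|z| = `|z| ^+ 2 * expR `|z| * `|z| by ring.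
have := @mean_value_le R (fun x => expR x - 1 - x - x ^+ 2 / 2) (fun x => expR x - 1 - x) 0 z (`|z| ^+ 2 * expR `|z|).
rewrite expR0 subrr expr0n/= mul0r !subr0; apply => [x|x].
  by apply: is_derive_eq; rewrite /GRing.scale/=; field.
rewrite subr0 => xz; apply: le_trans (expR_taylor2 x) _.
by apply: ler_pM; rewrite ?expR_ge0 ?exprn_ge0// ?ler_expR// lerXn2r ?nnegrE.
Qed.

Lemma series_exp_coeff_le z N : `|series (exp_coeff z) N| <= expR z + expR (- z).
Proof.
have h : `|series (exp_coeff z) N| <= series (exp_coeff `|z|) N.
  apply: le_trans (ler_norm_sum _ _ _) _; apply: ler_sum => k _.
  by rewrite /exp_coeff/= normrM normrX normfV (ger0_norm (ler0n _ _)).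
apply: le_trans h _; apply: (@le_trans _ _ (expR `|z|)).
  apply: nondecreasing_cvgn_le; last exact: is_cvg_series_exp_coeff.
  apply/nondecreasing_seqP => k; rewrite seriesSr lerDl /exp_coeff/=.
  by rewrite divr_ge0 ?exprn_ge0.
have [z0|z0] := ger0P z.
  by rewrite lerDl expR_ge0.
by rewrite lerDr expR_ge0.
Qed.

(** The right-hand side is a combination of exponentials minus their value at 0, so exponential
    moments bound its conditional mean by a multiple of the variance. It vanishes to second order at
    0, like the left-hand side, and its larger exponent 3/4 absorbs the polynomial; 64 = 36 * 16 /
    9. *)
Lemma sqr_expR_le_cosh y : 0 <= y ->
  y ^+ 2 * expR (y / 2) <= 64 * (expR (3 * y / 4) + expR (- (3 * y / 4)) - 2).
Proof.
move=> y0; pose z := 3 * y / 4; have z0 : 0 <= z by rewrite /z; lra.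
have ez := expR_gt0 z.
have h1 : expR z * (z / (1 + z)) ^+ 2 <= expR z + expR (- z) - 2.
  have -> : expR z + expR (- z) - 2 = expR z * (1 - expR (- z)) ^+ 2.
    by rewrite expRN; move: (lt0r_neq0 ez); move: (expR z) => t t0; field.
  rewrite ler_pM2l//.
  have h : z / (1 + z) <= 1 - expR (- z).
    have -> : z / (1 + z) = 1 - (1 + z)^-1 by field; rewrite gt_eqF//; lra.
    rewrite lerD2l lerN2 expRN lef_pV2 ?posrE// ?expR_ge1Dx//; lra.
  have h0 : 0 <= z / (1 + z) by apply: divr_ge0 => //; lra.
  by apply: lerXn2r; rewrite ?nnegrE// (le_trans h0).
have h2 : (1 + z) ^+ 2 <= 36 * expR (y / 4).
  have -> : 36 * expR (y / 4) = (6 * expR (y / 8)) ^+ 2.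
    have -> : y / 4 = y / 8 + y / 8 by field.
    by rewrite expRD; ring.
  have e0 := expR_ge0 (y / 8).
  rewrite ler_pXn2r ?nnegrE ?mulr_ge0//; last lra.
  by have := expR_ge1Dx (y / 8); rewrite /z; lra.
rewrite -/z; apply: (@le_trans _ _ (64 * (expR z * (z / (1 + z)) ^+ 2))); last by rewrite ler_pM2l.
have -> : expR z = expR (y / 4) * expR (y / 2) by rewrite -expRD; congr expR; rewrite /z; field.
have -> : 64 * (expR (y / 4) * expR (y / 2) * (z / (1 + z)) ^+ 2) =
    y ^+ 2 * expR (y / 2) * (36 * expR (y / 4)) / (1 + z) ^+ 2.
  by rewrite expr_div_n {1}/z; field; rewrite gt_eqF//; lra.
rewrite ler_pdivlMr ?exprn_gt0//; last lra.
by rewrite ler_wpM2l// mulr_ge0 ?expR_ge0// sqr_ge0.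
Qed.

End exponential.

Section conditional_expectation_weights.
Context d (T : measurableType d) (R : realType) (P : probability T R).
Variable G : set (set T).
Hypotheses (sG : sigma_algebra setT G) (Gm : G `<=` measurable).
Implicit Types X Y W : T -> R.

Lemma L1_indicM A X : measurable A -> L1 P X -> L1 P (fun w => \1_A w * X w).
Proof.
move=> mA iX; apply: (L1_le _ iX).
  by apply: measurable_funM; [exact: measurable_indic|exact: L1_meas iX].
by move=> w; rewrite indicE; case: (_ \in _); rewrite ?mul1r ?mul0r ?normr0.
Qed.

Lemma is_cond_exp_L1 X Y : is_cond_exp P G X Y -> L1 P Y.
Proof. by case. Qed.

Lemma is_cond_exp_Ex X Y A : L1 P X -> is_cond_exp P G X Y -> G A ->
  Ex P (fun w => \1_A w * X w) = Ex P (fun w => \1_A w * Y w).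
Proof.
move=> iX [_ iY XY] GA; apply: EFin_inj; have mA := Gm GA.
rewrite -!ExE; [|exact: L1_indicM..].
by rewrite -!integral_indicM//; exact/esym/XY.
Qed.

Lemma is_cond_exp_weight X Y W : L1 P X -> is_cond_exp P G X Y ->
  measurable_wrt G W -> (forall w, 0 <= W w) ->
  L1 P (fun w => W w * X w) -> L1 P (fun w => W w * Y w) ->
  Ex P (fun w => W w * X w) = Ex P (fun w => W w * Y w).
Proof. by move=> iX [_ iY XY]; apply: Ex_weight => // A GA; rewrite XY. Qed.

(** Integrability of [W X] is a conclusion: for nonnegative functions the identity holds between
    extended integrals first. *)
Lemma is_cond_exp_ge0_weight X Y W : (forall w, 0 <= X w) -> (forall w, 0 <= Y w) ->
  L1 P X -> is_cond_exp P G X Y ->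
  measurable_wrt G W -> (forall w, 0 <= W w) -> L1 P (fun w => W w * Y w) ->
  L1 P (fun w => W w * X w) /\
  Ex P (fun w => W w * X w) = Ex P (fun w => W w * Y w).
Proof.
move=> X0 Y0 iX cXY mW W0 iWY.
have [mY iY XY] := cXY.
have iWX : L1 P (fun w => W w * X w).
  apply: L1_ge0.
  - by apply: measurable_funM; [exact: (mwrt_meas Gm)|exact: L1_meas iX].
  - by move=> w; rewrite mulr_ge0.
  - rewrite (ge0_integral_weight sG Gm X0 Y0 iX iY)//; last by move=> A GA; rewrite XY.
    by rewrite ExE// ltry.
by split=> //; exact: (is_cond_exp_weight iX cXY).
Qed.

End conditional_expectation_weights.

(** Morally s^2 <= E[X^4 | G] <= 12 e^2 s, where 12 = 4! / 2. The conditional Jensen inequality is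
    replaced by integrating (X^2 - 12 e^2)^2 >= 0 over the sets of [G], and [cond_exp_between] gives
    a version bounded everywhere. *)
Lemma cond_variance_between (R : realType) d (T : measurableType d) (P : probability T R)
    (G : set (set T)) (X : T -> R) (e : R) :
  sigma_algebra setT G -> G `<=` measurable -> 0 < e ->
  (forall k, L1 P (fun w => X w ^+ k)) ->
  (forall A, G A -> Ex P (fun w => \1_A w * X w ^+ 4)
    <= 12 * e ^+ 2 * Ex P (fun w => \1_A w * X w ^+ 2)) ->
  exists s, is_cond_exp P G (fun w => X w ^+ 2) s /\ forall w, 0 <= s w <= 12 * e ^+ 2.
Proof.
move=> sG Gm e0 iX h4.
have e2 : 0 < e ^+ 2 by rewrite exprn_gt0.
apply: (cond_exp_between sG Gm (iX 2)).
- exact: mwrt_cst.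
- exact: mwrt_cst.
- exact: L1_cst.
- exact: L1_cst.
- by move=> _; rewrite mulr_ge0// ltW.
- move=> A GA; have iA k := L1_indicM (Gm _ GA) (iX k).
  apply: Ex_le (iA 2%N) _ => [|w]; first exact: (L1_indicM (Gm _ GA) (L1_cst P 0)).
  by rewrite mulr0 mulr_ge0// sqr_ge0.
- move=> A GA; have iA k := L1_indicM (Gm _ GA) (iX k).
  have i1 : L1 P (fun w => \1_A w * (12 * e ^+ 2)) := L1_indicM (Gm _ GA) (L1_cst P _).
  have : Ex P (fun w => 24 * e ^+ 2 * (\1_A w * X w ^+ 2)) <=
      Ex P (fun w => \1_A w * X w ^+ 4 + 12 * e ^+ 2 * (\1_A w * (12 * e ^+ 2))).
    apply: Ex_le (L1Z _ (iA 2%N)) (L1D (iA 4%N) (L1Z _ i1)) _ => w.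
    rewrite -subr_ge0 [X in 0 <= X](_ : _ = \1_A w * (X w ^+ 2 - 12 * e ^+ 2) ^+ 2).
      by rewrite mulr_ge0// sqr_ge0.
    by move: (\1_A w) (X w) => u v; ring.
  rewrite (ExD (iA 4%N) (L1Z _ i1)) (ExZ _ (iA 2%N)) (ExZ _ i1).
  move: (h4 A GA); set u := Ex P _; set v := Ex P _; set z := Ex P _ => h h'.
  have : 12 * e ^+ 2 * v <= 12 * e ^+ 2 * z by lra.
  by rewrite ler_pM2l ?mulr_gt0.
Qed.

Section one_step.
Context (R : realType) d (T : measurableType d) (P : probability T R).
Variables (G : set (set T)) (X s : T -> R) (e : R).
Hypotheses (sG : sigma_algebra setT G) (Gm : G `<=` measurable).
Hypothesis e_gt0 : 0 < e.
Hypothesis iX : forall k, L1 P (fun w => X w ^+ k).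
Hypothesis s_ge0 : forall w, 0 <= s w.
Hypothesis s_le : forall w, s w <= 12 * e ^+ 2.
Hypothesis cX : is_cond_exp P G X (fun=> 0).
Hypothesis cX2 : is_cond_exp P G (fun w => X w ^+ 2) s.
Hypothesis hX : forall k A, (2 <= k)%N -> G A ->
  `|Ex P (fun w => \1_A w * X w ^+ k)|
    <= 1 / 2 * k`!%:R * e ^+ (k - 2) * Ex P (fun w => \1_A w * s w).

Let iX1 : L1 P X.
Proof. by have := iX 1. Qed.

Let iS : L1 P s.
Proof. exact: is_cond_exp_L1 cX2. Qed.

Let ms : measurable_wrt G s.
Proof. by case: cX2. Qed.

Let mX : measurable_fun setT X.
Proof. exact: L1_meas iX1. Qed.

Let iA A Y : G A -> L1 P Y -> L1 P (fun w => \1_A w * Y w).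
Proof. by move=> GA; apply: L1_indicM; exact: Gm. Qed.

Let GT : G setT.
Proof. by have [_ + _] := sG => /(_ set0); rewrite setD0; case: sG => G0 _ _; exact. Qed.

Let growth t := t ^+ 2 / (2 * (1 - `|t| * e)).

Let growth_ge0 t : `|t| * e < 1 -> 0 <= growth t.
Proof. by move=> te; apply: divr_ge0; [exact: sqr_ge0|lra]. Qed.

Let L1_growth c : L1 P (fun w => 1 + c * s w).
Proof. by apply: L1D; [exact: L1_cst|exact: L1Z]. Qed.

Let Ex_growth c A : G A -> Ex P (fun w => \1_A w * (1 + c * s w)) =
  Ex P \1_A + c * Ex P (fun w => \1_A w * s w).
Proof.
move=> GA; rewrite -(ExZ _ (iA GA iS)) -(ExD (L1_indic P (Gm GA)) (L1Z _ (iA GA iS))).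
by apply: eq_Ex => w; ring.
Qed.

(** By the moment condition the term of order k >= 2 is at most (t^2 / 2) q^(k-2) times the integral
    of s, with q = |t| e: a geometric series of sum [growth t]. The induction keeps the exact
    partial sum, with factor 1 - q^N. The terms of order 0 and 1 give the mass of [A] and 0. *)
Let series_bound t A N : `|t| * e < 1 -> G A ->
  Ex P (fun w => \1_A w * series (exp_coeff (t * X w)) N)
    <= Ex P (fun w => \1_A w * (1 + growth t * s w)).
Proof.
move=> te GA; rewrite (Ex_growth _ GA).
have il k : L1 P (fun w => t ^+ k / k`!%:R * (\1_A w * X w ^+ k)).
  exact: L1Z (iA GA (iX k)).
have -> : Ex P (fun w => \1_A w * series (exp_coeff (t * X w)) N) =
    \sum_(0 <= k < N) t ^+ k / k`!%:R * Ex P (fun w => \1_A w * X w ^+ k).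
  transitivity (\sum_(0 <= k < N) Ex P (fun w => t ^+ k / k`!%:R * (\1_A w * X w ^+ k))).
    rewrite -Ex_sum//; apply: eq_Ex => w; rewrite /series/= mulr_sumr; apply: eq_bigr => k _.
    by rewrite /exp_coeff/= exprMn; ring.
  by apply: eq_bigr => k _; rewrite (ExZ _ (iA GA (iX k))).
set sg := Ex P (fun w => \1_A w * s w); set pa := Ex P \1_A.
have sg0 : 0 <= sg by apply: Ex_ge0 => w; rewrite mulr_ge0.
have pa0 : 0 <= pa by apply: Ex_ge0 => w.
have g0 := mulr_ge0 (growth_ge0 te) sg0.
set q := `|t| * e; have q0 : 0 <= q by rewrite mulr_ge0// ltW.
have m0 : Ex P (fun w => \1_A w * X w ^+ 0) = pa by apply: eq_Ex => w; rewrite mulr1.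
have m1 : Ex P (fun w => \1_A w * X w ^+ 1) = 0.
  rewrite (is_cond_exp_Ex Gm iX1 cX GA) -[RHS](Ex_cst P 0).
  by apply: eq_Ex => w; rewrite mulr0.
case: N => [|[|N]]; first by rewrite big_geq// addr_ge0.
  by rewrite big_nat1 m0 expr0 fact0 divr1 mul1r lerDl.
apply: (@le_trans _ _ (pa + growth t * sg * (1 - q ^+ N))); last first.
  rewrite lerD2l ler_piMr// gerBl exprn_ge0//.
elim: N => [|N ih].
  by rewrite big_nat_recr//= big_nat1 m0 m1 expr0 subrr !mulr0 addr0 fact0 divr1 mul1r addr0.
rewrite big_nat_recr//=; apply: le_trans (lerD ih (ler_norm _)) _.
rewrite -addrA lerD2l normrM normrM normfV normrX (ger0_norm (ler0n _ _)).
have h := @hX N.+2 A isT GA; rewrite -/sg subSS subSS subn0 in h.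
have fk : 0 < (N.+2)`!%:R :> R by rewrite ltr0n fact_gt0.
have h2 : 0 <= `|t| ^+ N.+2 / (N.+2)`!%:R by rewrite divr_ge0 ?exprn_ge0// ltW.
have {h} := ler_wpM2l h2 h; move: (`|Ex P _|) => E h.
apply: le_trans (lerD (lexx _) h) _.
rewrite le_eqVlt; apply/orP; left; apply/eqP; rewrite /growth -(real_normK (num_real t)) /q.
have : 1 - `|t| * e != 0 by rewrite gt_eqF// subr_gt0.
have fk0 := lt0r_neq0 fk.
have gen (v u g f x y : R) : f != 0 -> 1 - v * u != 0 ->
    v ^+ 2 / (2 * (1 - v * u)) * g * (1 - x * y) + v ^+ 2 * x / f * (1 / 2 * f * y * g) =
    v ^+ 2 / (2 * (1 - v * u)) * g * (1 - v * u * (x * y)).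
  by move=> f0 uv; field; apply/andP.
have -> : `|t| ^+ N.+2 = `|t| ^+ 2 * `|t| ^+ N by rewrite -exprD.
by move=> uv; rewrite [(_ * _) ^+ N.+1]exprS !exprMn; exact: gen.
Qed.

(** The partial sums of the exponential series are not monotone. Adding those for t and -t doubles
    the even terms and cancels the odd ones, so monotone convergence applies to exp (t X) + exp (- t
    X), which then dominates. *)
Lemma L1_expR t : `|t| * e < 1 -> L1 P (fun w => expR (t * X w)).
Proof.
move=> te; have te' : `|- t| * e < 1 by rewrite normrN.
have iser u N : L1 P (fun w => series (exp_coeff (u * X w)) N).
  have -> : (fun w => series (exp_coeff (u * X w)) N) =
      fun w => \sum_(0 <= k < N) u ^+ k / k`!%:R * X w ^+ k.
    apply/funext => w; apply: eq_bigr => k _.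
    by rewrite /exp_coeff/= exprMn mulrAC.
  by apply: L1_sum => k _; exact: L1Z.
have cvg u w : series (exp_coeff (u * X w)) @ \oo --> expR (u * X w).
  exact: is_cvg_series_exp_coeff.
pose f N w := series (exp_coeff (t * X w)) N + series (exp_coeff (- t * X w)) N.
have fS N w : f N w <= f N.+1 w.
  rewrite /f !seriesSr /exp_coeff/= mulNr exprNn.
  set a := series _ N; set b := series _ N; set c := (t * X w) ^+ N / _.
  rewrite -mulrA -/c; have [odN|evN] := boolP (odd N); first by rewrite -signr_odd odN; lra.
  rewrite -signr_odd (negbTE evN) expr0 mul1r.
  suff : 0 <= c by lra.
  by rewrite /c divr_ge0// exprn_even_ge0.
have fnd w : nondecreasing_seq (f ^~ w) by apply/nondecreasing_seqP => N; exact: fS.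
have f0 N w : 0 <= f N w.
  apply: le_trans (fnd w 0%N N isT).
  by rewrite /f /series/= !big_geq// addr0.
have h1 : L1 P (fun w => expR (t * X w) + expR (- t * X w)).
  apply: (@L1_monotone_limit _ _ _ P f _
    (Ex P (fun w => \1_setT w * (1 + growth t * s w)) + Ex P (fun w => \1_setT w * (1 + growth (- t) * s w)))) => //.
  - by move=> N; exact: L1D.
  - by move=> w; exact: cvgD.
  - move=> N; rewrite /f (ExD (iser t N) (iser (- t) N)).
    have E1 (Y : T -> R) : Ex P Y = Ex P (fun w => \1_setT w * Y w).
      by apply: eq_Ex => w; rewrite indicT mul1r.
    by apply: lerD; rewrite [leLHS]E1; exact: series_bound.
apply: (L1_le _ h1).
  by apply: measurableT_comp => //; exact: measurable_funM.
by move=> w; rewrite !ger0_norm ?addr_ge0 ?expR_ge0// lerDl expR_ge0.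
Qed.

Lemma Ex_expR_le t A : `|t| * e < 1 -> G A ->
  Ex P (fun w => \1_A w * expR (t * X w))
    <= Ex P (fun w => \1_A w * (1 + t ^+ 2 / (2 * (1 - `|t| * e)) * s w)).
Proof.
move=> te GA; have te' : `|- t| * e < 1 by rewrite normrN.
have h := L1D (L1_expR te) (L1_expR te').
have [] // := @Ex_dominated_limit_le _ _ _ P
  (fun N w => \1_A w * series (exp_coeff (t * X w)) N) (fun w => \1_A w * expR (t * X w)) _
  (Ex P (fun w => \1_A w * (1 + growth t * s w))) _ _ h.
- move=> N; apply: measurable_funM; first by apply: measurable_indic; exact: Gm.
  apply: measurable_sum => k; apply: measurable_funM => //.
  by apply: measurable_funX; exact: measurable_funM.
- by move=> w; apply: cvgMr; exact: is_cvg_series_exp_coeff.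
- move=> N w; rewrite normrM; apply: le_trans (_ : `|series (exp_coeff (t * X w)) N| <= _).
    by rewrite indicE; case: (_ \in _); rewrite ?normr1 ?mul1r// normr0 mul0r.
  by apply: le_trans (series_exp_coeff_le _ _) _; rewrite mulNr.
- by move=> N; exact: series_bound.
Qed.

(** One random variable controls all Taylor remainders that occur for |t| e <= 1/4, and its
    conditional mean is at most 144 s. Every such remainder is thus measured in units of the
    conditional variance. *)
Definition dominator w : R := X w ^+ 2 * expR (`|X w| / (2 * e)).

Lemma dominator_ge0 w : 0 <= dominator w.
Proof. by rewrite mulr_ge0 ?expR_ge0// sqr_ge0. Qed.

Lemma dominator_measurable : measurable_fun setT dominator.
Proof.
apply: measurable_funM; first exact: measurable_funX.
apply: measurableT_comp => //; apply: measurable_funM => //.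
exact: measurableT_comp.
Qed.

(** Between the exponent 1 / (2 e) of the dominator, which leaves room for the factor X^2, and the
    limit 1 / e for exponential moments. There [growth] is 9 / (8 e^2), and 64 e^2 * 2 * 9 / (8 e^2)
    = 144. *)
Let c := 3 / (4 * e).

Let ce : `|c| * e = 3 / 4.
Proof.
rewrite ger0_norm; last by rewrite divr_ge0// mulr_ge0// ltW.
by rewrite /c; field; rewrite gt_eqF.
Qed.

Let ce1 : `|c| * e < 1.
Proof. by rewrite ce; lra. Qed.

Let Nce1 : `|- c| * e < 1.
Proof. by rewrite normrN. Qed.

Let dominator_le w :
  dominator w <= 64 * e ^+ 2 * ((expR (c * X w) - 1) + (expR (- c * X w) - 1)).
Proof.
have y0 : 0 <= `|X w| / e by rewrite divr_ge0// ltW.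
have := sqr_expR_le_cosh y0.
have -> : 3 * (`|X w| / e) / 4 = c * `|X w| by rewrite /c; field; rewrite gt_eqF.
have -> : `|X w| / e / 2 = `|X w| / (2 * e) by field; rewrite gt_eqF.
have -> : expR (c * `|X w|) + expR (- (c * `|X w|)) = expR (c * X w) + expR (- (c * X w)).
  by have [_|_] := ger0P (X w) => //; rewrite mulrN opprK addrC.
have e2 : 0 < e ^+ 2 by rewrite exprn_gt0.
rewrite /dominator expr_div_n real_normK ?num_real// mulNr.
rewrite mulrAC ler_pdivrMr//.
by move: (expR _) (X w ^+ 2) (expR (c * X w)) (expR (- (c * X w))) (e ^+ 2) => x1 x2 x3 x4 x5; lra.
Qed.

Let iE t : `|t| * e < 1 -> L1 P (fun w => expR (t * X w) - 1).
Proof. by move=> te; apply: L1B (L1_expR te) (L1_cst _ _). Qed.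

Let L1_dominator : L1 P dominator.
Proof.
apply: (L1_le dominator_measurable (L1Z (64 * e ^+ 2) (L1D (iE ce1) (iE Nce1)))) => w.
by rewrite ger0_norm ?dominator_ge0// (le_trans (dominator_le w))// ler_norm.
Qed.

Let Ex_expR_sub1 t A : `|t| * e < 1 -> G A ->
  Ex P (fun w => \1_A w * (expR (t * X w) - 1)) <= growth t * Ex P (fun w => \1_A w * s w).
Proof.
move=> te GA; have := Ex_expR_le te GA; rewrite (Ex_growth _ GA) -/(growth t).
have i1 : L1 P \1_A := L1_indic P (Gm GA).
have i2 := iA GA (L1_expR te).
have -> : Ex P (fun w => \1_A w * (expR (t * X w) - 1)) =
    Ex P (fun w => \1_A w * expR (t * X w)) - Ex P \1_A.
  by rewrite -(ExB i2 i1); apply: eq_Ex => w; rewrite mulrBr mulr1.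
by rewrite lerBlDl.
Qed.

Let Ex_dominator A : G A ->
  Ex P (fun w => \1_A w * dominator w) <= Ex P (fun w => \1_A w * (144 * s w)).
Proof.
move=> GA; have i1 := iA GA (iE ce1); have i2 := iA GA (iE Nce1).
have h1 := Ex_expR_sub1 ce1 GA; have h2 := Ex_expR_sub1 Nce1 GA.
have gc t : `|t| = `|c| -> growth t = 9 / 8 * e ^- 2.
  move=> tc; rewrite /growth tc ce -(real_normK (num_real t)) tc.
  have -> : `|c| = 3 / 4 / e by rewrite -ce mulfK// gt_eqF.
  by field; rewrite gt_eqF.
rewrite gc// in h1; rewrite gc ?normrN// in h2.
have -> : Ex P (fun w => \1_A w * (144 * s w)) = 144 * Ex P (fun w => \1_A w * s w).
  by rewrite -(ExZ _ (iA GA iS)); apply: eq_Ex => w; rewrite mulrCA.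
apply: (@le_trans _ _ (Ex P (fun w => 64 * e ^+ 2 * (\1_A w * (expR (c * X w) - 1)
    + \1_A w * (expR (- c * X w) - 1))))).
  apply: Ex_le (iA GA L1_dominator) (L1Z _ (L1D i1 i2)) _ => w.
  have i0 : 0 <= \1_A w :> R by [].
  apply: le_trans (ler_wpM2l i0 (dominator_le w)) _.
  by rewrite mulrCA -mulrDr.
rewrite (ExZ _ (L1D i1 i2)) (ExD i1 i2).
have e2 : 0 < e ^+ 2 by rewrite exprn_gt0.
move: h1 h2; set u := Ex P _; set g := Ex P _; set v := Ex P _ => h1 h2.
have : u + v <= 9 / 4 * e ^- 2 * g.
  by move: h1 h2; move: (e ^- 2) => z; lra.
move=> /(ler_wpM2l (_ : 0 <= 64 * e ^+ 2)) h.
apply: le_trans (h _) _; first by rewrite mulr_ge0// ltW.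
rewrite le_eqVlt; apply/orP; left; apply/eqP.
have gen (z y : R) : z != 0 -> 64 * z * (9 / 4 * z^-1 * y) = 144 * y by move=> z0; field.
exact/gen/lt0r_neq0.
Qed.

Let L1_weight_s W : measurable_wrt G W -> L1 P W -> L1 P (fun w => W w * s w).
Proof.
move=> mW iW; apply: (L1_le _ (L1Z (12 * e ^+ 2) iW)).
  by apply: measurable_funM; [exact: L1_meas iW|exact: L1_meas iS].
move=> w; rewrite mulrC normrM [leRHS]normrM (ger0_norm (s_ge0 w)) ler_wpM2r//.
by rewrite (le_trans (s_le w))// ler_norm.
Qed.

Lemma dominator_weight W : measurable_wrt G W -> (forall w, 0 <= W w) -> L1 P W ->
  L1 P (fun w => W w * dominator w) /\
  Ex P (fun w => W w * dominator w) <= 144 * Ex P (fun w => W w * s w).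
Proof.
move=> mW W0 iW; have iWs := L1_weight_s mW iW.
have [||||||||Y [cY Yb]] := @cond_exp_between _ _ _ P G sG Gm dominator (fun=> 0) (fun w => 144 * s w).
- exact: L1_dominator.
- exact: mwrt_cst.
- by apply: (mwrtM sG) => //; exact: mwrt_cst.
- exact: L1_cst.
- exact: L1Z.
- by move=> w; rewrite mulr_ge0.
- move=> A GA; apply: Ex_le (iA GA (L1_cst P 0)) (iA GA L1_dominator) _ => w.
  by rewrite mulr0 mulr_ge0// dominator_ge0.
- exact: Ex_dominator.
have Y0 w : 0 <= Y w by have /andP[] := Yb w.
have iWY : L1 P (fun w => W w * Y w).
  apply: (L1_le _ (L1Z 144 iWs)).
    by case: cY => mY _ _; apply: measurable_funM; [exact: L1_meas iW|exact: (mwrt_meas Gm)].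
  move=> w; have /andP[? ?] := Yb w.
  by rewrite mulrCA !ger0_norm ?mulr_ge0// ler_wpM2l.
have [iWD ->] := is_cond_exp_ge0_weight sG Gm dominator_ge0 Y0 L1_dominator cY mW W0 iWY.
split=> //; rewrite -(ExZ _ iWs); apply: Ex_le iWY (L1Z _ iWs) _ => w.
by have /andP[? ?] := Yb w; rewrite mulrCA ler_wpM2l.
Qed.

Lemma step_weight W : measurable_wrt G W -> (forall w, 0 <= W w) -> L1 P W ->
  [/\ L1 P (fun w => W w * s w), L1 P (fun w => W w * X w),
      L1 P (fun w => W w * X w ^+ 2), Ex P (fun w => W w * X w) = 0 &
      Ex P (fun w => W w * X w ^+ 2) = Ex P (fun w => W w * s w)].
Proof.
move=> mW W0 iW; have iWs := L1_weight_s mW iW.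
have [iWX2 E2] := is_cond_exp_ge0_weight sG Gm (fun w => sqr_ge0 (X w)) s_ge0 (iX 2) cX2 mW W0 iWs.
have iWX : L1 P (fun w => W w * X w).
  apply: (L1_le _ (L1D iW iWX2)); first by apply: measurable_funM => //; exact: L1_meas iW.
  move=> w; rewrite -{2}[W w]mulr1 -mulrDr !normrM; apply: ler_wpM2l => //.
  rewrite [leRHS]ger0_norm ?addr_ge0 ?sqr_ge0//; exact: norm_le_sqr.
split=> //; rewrite (is_cond_exp_weight sG Gm iX1 cX mW W0 iWX).
  by rewrite -[RHS](Ex_cst P 0); apply: eq_Ex => w; rewrite mulr0.
by have := L1_cst P (0 : R); congr L1; apply/funext => w; rewrite mulr0.
Qed.

(** The extra factor |X| is at most 4 e exp (|X| / (4 e)), and the exponential of |t X| takes the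
    other half of the exponent |X| / (2 e). *)
Lemma cube_expR_le t w : `|t| * e <= 1 / 4 ->
  `|X w| ^+ 3 * expR `|t * X w| <= 4 * e * dominator w.
Proof.
move=> te; set x := `|X w|; have x0 : 0 <= x by exact: normr_ge0.
have e4 : 0 < 4 * e by rewrite mulr_gt0.
have h1 : x <= 4 * e * expR (x / (4 * e)).
  by rewrite mulrC -ler_pdivrMr//; apply: le_trans (expR_ge1Dx _); rewrite lerDr.
have h2 : expR `|t * X w| <= expR (x / (4 * e)).
  rewrite ler_expR normrM -/x ler_pdivlMr// mulrAC.
  rewrite (_ : `|t| * (4 * e) * x = 4 * (`|t| * e) * x); last by move: (`|t|) => v; ring.
  by rewrite ler_piMl//; lra.
have h3 : expR (x / (2 * e)) = expR (x / (4 * e)) * expR (x / (4 * e)).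
  by rewrite -expRD; congr expR; field; rewrite gt_eqF.
rewrite /dominator -/x -(real_normK (num_real (X w))) -/x h3.
have -> : 4 * e * (x ^+ 2 * (expR (x / (4 * e)) * expR (x / (4 * e)))) =
  x ^+ 2 * ((4 * e * expR (x / (4 * e))) * expR (x / (4 * e))) by ring.
rewrite exprSr -mulrA ler_wpM2l ?exprn_ge0//.
by apply: ler_pM; rewrite ?expR_ge0.
Qed.

(** For the lower bound, the third-order remainder costs |t|^3 * 4 e * 144 s = t^2 * 576 |t| e s.
    When this exceeds t^2 s / 2 the inequality 1 + t X <= exp (t X) still gives 1; the maximum joins
    both cases, so that m >= 1 always. *)
Lemma cond_expR_between t : `|t| * e < 1 ->
  exists m, is_cond_exp P G (fun w => expR (t * X w)) m /\
  forall w, 1 + t ^+ 2 * Num.max 0 (1 / 2 - 576 * (`|t| * e)) * s w <= m w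
    <= 1 + t ^+ 2 / (2 * (1 - `|t| * e)) * s w.
Proof.
move=> te; set mx := Num.max 0 _.
have mgrowth u : measurable_wrt G (fun w => 1 + u * s w) by mwrt_auto sG.
have q0 : 0 <= `|t| * e by rewrite mulr_ge0// ltW.
have mx0 : 0 <= mx by rewrite le_max lexx.
have mx2 : mx <= 1 / 2 by rewrite ge_max; apply/andP; split; lra.
apply: (cond_exp_between sG Gm (L1_expR te)) => //; first last.
- by move=> A GA; exact: Ex_expR_le.
- move=> A GA; rewrite (Ex_growth _ GA).
  have i1 : L1 P \1_A := L1_indic P (Gm GA).
  have iE1 := iA GA (L1_expR te); have iX' k := iA GA (iX k).
  have iAX := iA GA iX1; have iAX2 := iA GA (iX 2); have iAs := iA GA iS.
  have EX0 : Ex P (fun w => \1_A w * X w) = 0.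
    rewrite (is_cond_exp_Ex Gm iX1 cX GA) -[RHS](Ex_cst P 0).
    by apply: eq_Ex => w; rewrite mulr0.
  have EX2 := is_cond_exp_Ex Gm (iX 2) cX2 GA.
  rewrite /mx; have [mneg|mpos] := leP 0 (1 / 2 - 576 * (`|t| * e)); last first.
    rewrite mulr0 mul0r addr0.
    have -> : Ex P \1_A = Ex P (fun w => \1_A w + t * (\1_A w * X w)).
      by rewrite (ExD i1 (L1Z _ iAX)) (ExZ _ iAX) EX0 mulr0 addr0.
    apply: Ex_le (L1D i1 (L1Z _ iAX)) iE1 _ => w.
    rewrite mulrCA -{1}[\1_A w]mulr1 -mulrDr ler_wpM2l//; exact: expR_ge1Dx.
  have te4 : `|t| * e <= 1 / 4 by lra.
  have iAD := iA GA L1_dominator.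
  have Edom := Ex_dominator GA.
  have E144 : Ex P (fun w => \1_A w * (144 * s w)) = 144 * Ex P (fun w => \1_A w * s w).
    by rewrite -(ExZ _ iAs); apply: eq_Ex => w; rewrite mulrCA.
  rewrite E144 in Edom.
  have j1 := L1Z (t ^+ 2 / 2) iAX2; have j2 := L1Z (`|t| ^+ 3 * (4 * e)) iAD.
  have j3 := L1Z t iAX.
  have k1 : L1 P (fun w => \1_A w + t * (\1_A w * X w)) := L1D i1 j3.
  have k2 : L1 P (fun w => \1_A w + t * (\1_A w * X w) + t ^+ 2 / 2 * (\1_A w * X w ^+ 2)) :=
    L1D k1 j1.
  apply: (@le_trans _ _ (Ex P (fun w => (\1_A w + t * (\1_A w * X w)
      + t ^+ 2 / 2 * (\1_A w * X w ^+ 2)) - `|t| ^+ 3 * (4 * e) * (\1_A w * dominator w)))); last first.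
    apply: Ex_le (L1B k2 j2) iE1 _ => w.
    have h := expR_taylor3 (t * X w).
    have h' : `|t * X w| ^+ 3 * expR `|t * X w| <= `|t| ^+ 3 * (4 * e) * dominator w.
      have -> : `|t * X w| ^+ 3 * expR `|t * X w| = `|t| ^+ 3 * (`|X w| ^+ 3 * expR `|t * X w|).
        by rewrite {1}normrM exprMn mulrA.
      rewrite -[_ * (4 * e) * _]mulrA; apply: ler_wpM2l; first exact: exprn_ge0.
      exact: cube_expR_le.
    have := le_trans h h'; rewrite ler_norml => /andP[+ _].
    have i0 : 0 <= \1_A w :> R by [].
    move=> h3; have : 1 + t * X w + (t * X w) ^+ 2 / 2 - `|t| ^+ 3 * (4 * e) * dominator w
      <= expR (t * X w) by lra.
    move=> /(ler_wpM2l i0); apply: le_trans.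
    rewrite le_eqVlt; apply/orP; left; apply/eqP.
    by move: (\1_A w : R) (X w) (dominator w) (`|t| ^+ 3) => u x y v; field.
  rewrite (ExB k2 j2) (ExD k1 j1) (ExD i1 j3) (ExZ _ iAX) (ExZ _ iAX2) (ExZ _ iAD).
  rewrite EX0 EX2.
  have h4 : `|t| ^+ 3 * (4 * e) * Ex P (fun w => \1_A w * dominator w)
     <= t ^+ 2 * (576 * (`|t| * e)) * Ex P (fun w => \1_A w * s w).
    rewrite -(real_normK (num_real t)).
    have t0 : 0 <= `|t| ^+ 3 * (4 * e) by rewrite !mulr_ge0// ltW.
    apply: le_trans (ler_wpM2l t0 Edom) _.
    rewrite le_eqVlt; apply/orP; left; apply/eqP.
    by move: (Ex P _) (`|t|) => u v; ring.
  move: h4; move: (Ex P _) (Ex P _) (Ex P _) => u v g.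
  by rewrite mulrBr mulrBl mulr0 addr0; move: (t ^+ 2 * (576 * (`|t| * e)) * g) => z; lra.
- move=> w; rewrite lerD2l ler_wpM2r//.
  rewrite ler_wpM2l ?sqr_ge0//; apply: le_trans mx2 _.
  by rewrite mul1r lef_pV2 ?posrE; lra.
Qed.

Lemma sqr_expR_le t w : `|t| * e <= 1 / 4 ->
  `|X w| ^+ 2 * expR `|t * X w| <= dominator w.
Proof.
move=> te; rewrite real_normK ?num_real// ler_wpM2l ?sqr_ge0// ler_expR normrM.
rewrite ler_pdivlMr ?mulr_gt0// mulrC mulrA ler_piMl//.
by rewrite (_ : 2 * e * `|t| = 2 * (`|t| * e)); [lra|ring].
Qed.

(** A pointwise second-order expansion of [h] in [X] with coefficients known to [G] becomes one of
    conditional means: X averages to 0, X^2 to s, and the dominator to at most 144 s. All moments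
    under the tilted law go through this lemma. *)
Lemma Ex_expansion (W h a b : T -> R) (g A B rho : R) :
  measurable_wrt G W -> (forall w, 0 <= W w) -> L1 P W ->
  measurable_fun setT h -> measurable_wrt G a -> measurable_wrt G b ->
  (forall w, `|a w| <= A) -> (forall w, `|b w| <= B) -> 0 <= rho ->
  (forall w, `|h w - a w - b w * X w - g * X w ^+ 2| <= rho * dominator w) ->
  L1 P (fun w => W w * h w) /\
  `|Ex P (fun w => W w * h w) - Ex P (fun w => W w * a w) - g * Ex P (fun w => W w * s w)|
    <= 144 * rho * Ex P (fun w => W w * s w).
Proof.
move=> mW W0 iW mh ma mb aA bB rho0 hR.
have mWT := L1_meas iW; have maT := mwrt_meas Gm ma; have mbT := mwrt_meas Gm mb.
have bnd (f : T -> R) C : measurable_fun setT f -> (forall w, `|f w| <= C) -> L1 P (fun w => W w * f w).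
  move=> mf fC; apply: (L1_le _ (L1Z C iW)); first exact: measurable_funM.
  by move=> w; rewrite mulrC !normrM ler_wpM2r// (le_trans (fC w))// ler_norm.
have iWa := bnd _ _ maT aA.
have [iWs iWX iWX2 EX EX2] := step_weight mW W0 iW.
have [iWD ED] := dominator_weight mW W0 iW.
(* The coefficient [b] may have either sign; shifted by its bound [B] it gives a nonnegative weight,
   and the shift contributes nothing because X has conditional mean 0. *)
pose U w := W w * (b w + B).
have mU : measurable_wrt G U by rewrite /U; mwrt_auto sG.
have U0 w : 0 <= U w.
  by rewrite /U mulr_ge0//; have := bB w; rewrite ler_norml => /andP[]; lra.
have iU : L1 P U.
  apply: (bnd _ (2 * B)); first exact: measurable_funD.
  by move=> w; have := bB w; rewrite !ler_norml => /andP[? ?]; apply/andP; split; lra.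
have [_ iUX _ EUX _] := step_weight mU U0 iU.
have iWbX : L1 P (fun w => W w * (b w * X w)).
  have := L1B iUX (L1Z B iWX); congr L1; apply/funext => w; rewrite /U; ring.
have EWbX : Ex P (fun w => W w * (b w * X w)) = 0.
  transitivity (Ex P (fun w => U w * X w) - Ex P (fun w => B * (W w * X w))).
    by rewrite -(ExB iUX (L1Z B iWX)); apply: eq_Ex => w; rewrite /U; ring.
  by rewrite EUX (ExZ _ iWX) EX mulr0 subrr.
pose r w := h w - a w - b w * X w - g * X w ^+ 2.
have iWr : L1 P (fun w => W w * r w).
  apply: (L1_le _ (L1Z rho iWD)).
    apply: measurable_funM => //; apply: measurable_funB; last first.
      by apply: measurable_funM => //; exact: measurable_funX.
    by apply: measurable_funB; [exact: measurable_funB|exact: measurable_funM].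
  by move=> w; rewrite mulrCA normrM [leRHS]normrM ler_wpM2l// (le_trans (hR w))// ler_norm.
have i1 : L1 P (fun w => W w * a w + W w * (b w * X w)) := L1D iWa iWbX.
have i2 : L1 P (fun w => g * (W w * X w ^+ 2) + W w * r w) := L1D (L1Z g iWX2) iWr.
have hE : (fun w => W w * h w) = fun w =>
    W w * a w + W w * (b w * X w) + (g * (W w * X w ^+ 2) + W w * r w).
  by apply/funext => w; rewrite /r; ring.
rewrite hE; split; first exact: L1D.
rewrite (ExD i1 i2) (ExD iWa iWbX) (ExD (L1Z g iWX2) iWr) (ExZ _ iWX2) EWbX EX2.
have : `|Ex P (fun w => W w * r w)| <= rho * (144 * Ex P (fun w => W w * s w)).
  apply: le_trans (ler_wpM2l rho0 ED); rewrite -(ExZ _ iWD).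
  apply: Ex_absW iWr (L1Z rho iWD) _ => w.
  by rewrite normrM (ger0_norm (W0 w)) mulrCA ler_wpM2l//; exact: hR.
move: (Ex P (fun w => W w * a w)) (Ex P (fun w => W w * s w)) (Ex P (fun w => W w * r w)) => u v z.
have -> : u + 0 + (g * v + z) - u - g * v = z by ring.
by have -> : 144 * rho * v = rho * (144 * v) by ring.
Qed.

End one_step.

(** * Likelihood and exponential tail bound *)

(** The hypotheses of the theorem after a choice of versions [s] of the conditional variances. Upper
    bounds hold at every point and moments are stated as integrals over the sets of F_k; only the
    lower bound on the bracket remains almost sure, and it is carried over to the tilted law. *)
Record bernstein_martingale (R : realType) d (T : measurableType d)
    (P : probability T R) (n : nat) (F : nat -> set (set T))
    (xi s : nat -> T -> R) (e dl : R) : Prop := {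
  bm_sigma : forall k, (k <= n)%N -> sigma_algebra setT (F k);
  bm_sub : forall k, (k <= n)%N -> F k `<=` measurable;
  bm_filtration : forall k, (k < n)%N -> F k `<=` F k.+1;
  bm_adapted : forall k, (k < n)%N -> measurable_wrt (F k.+1) (xi k.+1);
  bm_L1 : forall k p, (k < n)%N -> L1 P (fun w => xi k.+1 w ^+ p);
  bm_mean : forall k, (k < n)%N -> is_cond_exp P (F k) (xi k.+1) (fun=> 0);
  bm_variance : forall k, (k < n)%N ->
    is_cond_exp P (F k) (fun w => xi k.+1 w ^+ 2) (s k.+1);
  bm_moment : forall k p A, (k < n)%N -> (2 <= p)%N -> F k A ->
    `|Ex P (fun w => \1_A w * xi k.+1 w ^+ p)|
      <= 1 / 2 * p`!%:R * e ^+ (p - 2) * Ex P (fun w => \1_A w * s k.+1 w);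
  bm_s_ge0 : forall k w, 0 <= s k w;
  bm_s_le : forall k w, s k w <= 12 * e ^+ 2;
  bm_sum_le : forall w, mart_sum s n w <= 1 + dl ^+ 2;
  bm_sum_ge : {ae P, forall w, 1 - dl ^+ 2 <= mart_sum s n w};
  bm_e : 0 < e;
  bm_dl : 0 <= dl <= 1 }.

Section likelihood.
Context (R : realType) d (T : measurableType d) (P : probability T R).
Variables (n : nat) (F : nat -> set (set T)) (xi s : nat -> T -> R) (e dl t : R).
Hypothesis BM : bernstein_martingale P n F xi s e dl.
Hypothesis te : `|t| * e < 1.

Lemma bm_cond_expR : exists m : nat -> T -> R,
  (forall k, (k < n)%N -> is_cond_exp P (F k) (fun w => expR (t * xi k.+1 w)) (m k)) /\
  (forall k w, 1 + t ^+ 2 * Num.max 0 (1 / 2 - 576 * (`|t| * e)) * s k.+1 w <= m k w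
    <= 1 + t ^+ 2 / (2 * (1 - `|t| * e)) * s k.+1 w).
Proof.
have /choice[m mP] : forall k, exists m : T -> R,
  ((k < n)%N -> is_cond_exp P (F k) (fun w => expR (t * xi k.+1 w)) m) /\
  forall w, 1 + t ^+ 2 * Num.max 0 (1 / 2 - 576 * (`|t| * e)) * s k.+1 w <= m w
    <= 1 + t ^+ 2 / (2 * (1 - `|t| * e)) * s k.+1 w.
  move=> k; have [kn|_] := ltnP k n; last first.
    (* Beyond the horizon any function between the two bounds will do; taking the upper one lets the
       bounds hold for all k. *)
    exists (fun w => 1 + t ^+ 2 / (2 * (1 - `|t| * e)) * s k.+1 w).
    split=> // w; rewrite lexx andbT lerD2l ler_wpM2r ?(bm_s_ge0 BM)//.
    rewrite ler_wpM2l ?sqr_ge0//.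
    have q0 : 0 <= `|t| * e by rewrite mulr_ge0// ltW// (bm_e BM).
    apply: (@le_trans _ _ (1 / 2)); first by rewrite ge_max; apply/andP; split; lra.
    by rewrite mul1r lef_pV2 ?posrE; have := te; lra.
  have [m [cm mb]] := cond_expR_between (bm_sigma BM (ltnW kn)) (bm_sub BM (ltnW kn))
    (bm_e BM) (fun p => bm_L1 BM p kn) (bm_s_ge0 BM k.+1) (bm_mean BM kn)
    (bm_variance BM kn) (fun p A => @bm_moment _ _ _ _ _ _ _ _ _ _ BM k p A kn) te.
  by exists m.
by exists m; split=> k; [exact: (mP k).1|exact: (mP k).2].
Qed.

Variable m : nat -> T -> R.
Hypothesis cm : forall k, (k < n)%N ->
  is_cond_exp P (F k) (fun w => expR (t * xi k.+1 w)) (m k).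
Hypothesis m_between : forall k w,
  1 + t ^+ 2 * Num.max 0 (1 / 2 - 576 * (`|t| * e)) * s k.+1 w <= m k w
    <= 1 + t ^+ 2 / (2 * (1 - `|t| * e)) * s k.+1 w.

Lemma cond_expR_ge1 k w : 1 <= m k w.
Proof.
have /andP[+ _] := m_between k w; apply: le_trans.
rewrite lerDl mulr_ge0 ?(bm_s_ge0 BM)// mulr_ge0 ?sqr_ge0//.
by rewrite le_max lexx.
Qed.

Let m_gt0 k w : 0 < m k w.
Proof. exact: lt_le_trans ltr01 (cond_expR_ge1 k w). Qed.

Definition likelihood k w : R := \prod_(0 <= i < k) (expR (t * xi i.+1 w) / m i w).

Local Notation Z := likelihood.

Lemma likelihood_gt0 k w : 0 < Z k w.
Proof. by apply: prodr_gt0 => i _; rewrite divr_gt0 ?expR_gt0. Qed.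

Lemma likelihoodS k w : Z k.+1 w = Z k w * (expR (t * xi k.+1 w) / m k w).
Proof. by rewrite /likelihood big_nat_recr. Qed.

Lemma likelihoodE k w :
  expR (t * mart_sum xi k w) = Z k w * \prod_(0 <= i < k) m i w.
Proof.
elim: k => [|k ih].
  by rewrite mart_sum0 mulr0 expR0 /likelihood !big_geq// mulr1.
rewrite mart_sumS mulrDr expRD ih likelihoodS big_nat_recr//=.
have := lt0r_neq0 (m_gt0 k w).
move: (m k w) (Z k w) (expR _) (\prod_(_ <= _ < _) _) => u v x y u0.
by field.
Qed.

Lemma bm_filtration_sub k j : (k <= j <= n)%N -> F k `<=` F j.
Proof. exact: filtration_sub (bm_filtration BM). Qed.

Lemma measurable_likelihood k : (k <= n)%N -> measurable_wrt (F k) (Z k).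
Proof.
move=> kn; have sG := bm_sigma BM kn.
apply: (mwrt_prod sG) => i /andP[_ ik].
have ikn := leq_trans ik kn.
apply: (mwrtM sG).
  apply: (@mwrt_comp _ _ _ _ expR (fun w => t * xi i.+1 w)) => //.
  apply: (mwrtM sG); first exact: mwrt_cst.
  by apply: (mwrt_sub (bm_adapted BM ikn)); apply: bm_filtration_sub; rewrite ik.
apply: mwrtV => //; have [mm _ _] := cm ikn.
by apply: (mwrt_sub mm); apply: bm_filtration_sub; rewrite ltnW.
Qed.

(** The martingale property of the likelihood: averaging over one more increment replaces exp (t xi)
    by m and removes the last quotient. Extended integrals let the identity precede integrability,
    which [likelihood_weight] then transfers in both directions. *)
Lemma likelihood_integral k V : (k <= n)%N -> measurable_wrt (F k) V ->
  (forall w, 0 <= V w) ->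
  (\int[P]_w (Z n w * V w)%:E = \int[P]_w (Z k w * V w)%:E)%E.
Proof.
move=> kn mV V0.
suff H j : (k <= j)%N -> (j <= n)%N ->
  (\int[P]_w (Z j w * V w)%:E = \int[P]_w (Z k w * V w)%:E)%E by exact: H.
elim: j => [|j ih]; first by rewrite leqn0 => /eqP <-.
rewrite leq_eqVlt => /predU1P[<-//|]; rewrite ltnS => kj jn.
rewrite -(ih kj (ltnW jn)).
have jn' := ltnW jn; have sG := bm_sigma BM jn'; have Gm := bm_sub BM jn'.
have iE : L1 P (fun w => expR (t * xi j.+1 w)).
  exact: (L1_expR sG Gm (bm_e BM) (fun p => bm_L1 BM p jn) (bm_s_ge0 BM j.+1) (bm_mean BM jn)
    (bm_variance BM jn) (fun p A => @bm_moment _ _ _ _ _ _ _ _ _ _ BM j p A jn) te).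
have mj : measurable_wrt (F j) (m j) by case: (cm jn).
have mZ := measurable_likelihood jn'.
have mVj : measurable_wrt (F j) V.
  by apply: (mwrt_sub mV); apply: bm_filtration_sub; rewrite kj.
have mW : measurable_wrt (F j) (fun w => Z j w * V w / m j w) by mwrt_auto sG.
have W0 w : 0 <= Z j w * V w / m j w.
  by rewrite divr_ge0 ?(ltW (m_gt0 _ _))// mulr_ge0// ltW// likelihood_gt0.
have [_ im Em] := cm jn.
have := ge0_integral_weight sG Gm (fun w => expR_ge0 (t * xi j.+1 w))
  (fun w => ltW (m_gt0 j w)) iE im (fun A GA => esym (Em A GA)) mW W0.
have -> : (fun w => (Z j w * V w / m j w * m j w)%:E) = fun w => (Z j w * V w)%:E.
  by apply/funext => w; rewrite divfK// gt_eqF.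
have -> // : (fun w => (Z j w * V w / m j w * expR (t * xi j.+1 w))%:E) = fun w => (Z j.+1 w * V w)%:E.
apply/funext => w; congr EFin; rewrite likelihoodS; have := lt0r_neq0 (m_gt0 j w).
by move: (m j w) (Z j w) (V w) (expR _) => u v x y u0; field.
Qed.

Lemma likelihood_weight k V : (k <= n)%N -> measurable_wrt (F k) V -> (forall w, 0 <= V w) ->
  (L1 P (fun w => Z n w * V w) <-> L1 P (fun w => Z k w * V w)) /\
  Ex P (fun w => Z n w * V w) = Ex P (fun w => Z k w * V w).
Proof.
move=> kn mV V0; have E := likelihood_integral kn mV V0.
have ZV0 j w : 0 <= Z j w * V w by rewrite mulr_ge0// ltW// likelihood_gt0.
have mZV j : (j <= n)%N -> measurable_fun setT (fun w => Z j w * V w).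
  move=> jn; apply: measurable_funM; last exact: (mwrt_meas (bm_sub BM kn)).
  exact: (mwrt_meas (bm_sub BM jn) (measurable_likelihood jn)).
split; last by rewrite /Ex /Rintegral E.
have fin j : L1 P (fun w => Z j w * V w) -> (\int[P]_w (Z j w * V w)%:E < +oo)%E.
  by move=> /ExE ->; rewrite ltry.
split=> /fin h; apply: L1_ge0 => //; try exact: mZV.
- by rewrite -E.
- by rewrite E.
Qed.

Lemma likelihood_prob : L1 P (Z n) /\ Ex P (Z n) = 1.
Proof.
have Z0 : (fun w => Z 0 w * 1) = fun=> 1.
  by apply/funext => w; rewrite /likelihood big_geq// mulr1.
have Zn : (fun w => Z n w * 1) = Z n by apply/funext => w; rewrite mulr1.
have [L E] := @likelihood_weight 0 (fun=> 1) (leq0n n)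
  (mwrt_cst (bm_sigma BM (leq0n n)) 1) (fun=> ler01).
by move: L E; rewrite Z0 Zn Ex_cst => -[_ h] E; split=> //; apply: h; exact: L1_cst.
Qed.

Lemma prod_cond_expR_le w :
  \prod_(0 <= i < n) m i w <= expR (t ^+ 2 / (2 * (1 - `|t| * e)) * (1 + dl ^+ 2)).
Proof.
apply: (@le_trans _ _ (expR (t ^+ 2 / (2 * (1 - `|t| * e)) * mart_sum s n w))); last first.
  rewrite ler_expR ler_wpM2l ?(bm_sum_le BM)//; apply: divr_ge0; first exact: sqr_ge0.
  by have := te; lra.
rewrite /mart_sum big_add1/= mulr_sumr expR_sum.
apply: ler_prod => i _; rewrite (ltW (m_gt0 i w))/=.
by have /andP[_ h] := m_between i w; apply: le_trans h (expR_ge1Dx _).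
Qed.

(** The sign of t and the event are left free so that both tails are covered. The product of the m
    is bounded everywhere, hence exp (t S_n) is at most a constant times a density of total mass
    1. *)
Lemma exponential_tail (A : set T) (x : R) : measurable A ->
  (forall w, A w -> t * x <= t * mart_sum xi n w) ->
  fine (P A) <= expR (t ^+ 2 / (2 * (1 - `|t| * e)) * (1 + dl ^+ 2) - t * x).
Proof.
move=> mA Ax; have [iZ EZ] := likelihood_prob.
rewrite -(Ex_indic P mA) expRD expRN; set B := expR (_ * (1 + _)).
rewrite -[B]mulr1 -EZ -(ExZ _ iZ) ler_pdivlMr ?expR_gt0//.
rewrite mulrC -(ExZ _ (L1_indic P mA)); apply: Ex_le (L1Z _ (L1_indic P mA)) (L1Z _ iZ) _ => w.
rewrite indicE; case: (boolP (w \in A)) => [|_]; last first.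
  by rewrite mulr0 mulr_ge0 ?expR_ge0// ltW// likelihood_gt0.
rewrite inE mulr1 => Aw; apply: (@le_trans _ _ (expR (t * mart_sum xi n w))).
  by rewrite ler_expR Ax.
rewrite likelihoodE mulrC; apply: ler_wpM2r; first exact/ltW/likelihood_gt0.
exact: prod_cond_expR_le.
Qed.

End likelihood.

Section bernstein_tail.
Context (R : realType) d (T : measurableType d) (P : probability T R).
Variables (n : nat) (F : nat -> set (set T)) (xi s : nat -> T -> R) (e dl : R).
Hypothesis BM : bernstein_martingale P n F xi s e dl.

(** The sign [sg] selects the tail. With the root r in the denominator of [x_hat], the parameter
    satisfies 1 - t e = 1 / r, so the exponent is rational in r and simplifies exactly. *)
Lemma bernstein_tail (A : set T) (x sg : R) : measurable A -> `|sg| = 1 ->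
  (forall w, A w -> `|x| <= sg * mart_sum xi n w) ->
  fine (P A) <= expR (- (x_hat e dl x ^+ 2 / 2)).
Proof.
move=> mA sg1 Ax; have e0 := bm_e BM.
set y := `|x|; have y0 : 0 <= y by exact: normr_ge0.
have d2 : 0 <= dl ^+ 2 by exact: sqr_ge0.
pose v := 1 + dl ^+ 2; have v0 : 0 < v by rewrite /v; lra.
pose r := Num.sqrt (1 + 2 * y * e / v).
have ye : 0 <= 2 * y * e / v by rewrite divr_ge0 ?(ltW v0)// !mulr_ge0// ltW.
have r2 : r ^+ 2 = 1 + 2 * y * e / v by rewrite sqr_sqrtr//; lra.
have r0 : 0 < r by rewrite sqrtr_gt0; lra.
have r10 : 0 < r + 1 by lra.
(* For this t the exponent of [exponential_tail] is - x_hat ^+ 2 / 2. *)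
pose t := 2 * y / (v * (r * (r + 1))).
have t0 : 0 <= t by rewrite divr_ge0 ?mulr_ge0 ?(ltW v0)// ltW// mulr_gt0.
have te : 1 - t * e = r^-1.
  have ve : 2 * y * e / v = (r - 1) * (r + 1).
    by move: r2; set q := 2 * y * e / v => r2; rewrite -[q](addKr 1) -r2; ring.
  have -> : t * e = (2 * y * e / v) / (r * (r + 1)) by rewrite /t; field; rewrite !gt_eqF.
  by rewrite ve; field; rewrite !gt_eqF.
have ti : 0 < r^-1 by rewrite invr_gt0.
have nt : `|sg * t| = t by rewrite normrM sg1 mul1r ger0_norm.
have sg2 : sg * sg = 1 by rewrite -expr2 -(real_normK (num_real sg)) sg1 expr1n.
have te1 : `|sg * t| * e < 1 by rewrite nt; lra.
have [m [cm mb]] := bm_cond_expR BM te1.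
have h := exponential_tail BM te1 cm mb mA (x := sg * y).
have tx : sg * t * (sg * y) = t * y by rewrite mulrACA sg2 mul1r.
apply: (le_trans (h _)) => [w Aw|].
  by rewrite tx [leRHS](_ : _ = t * (sg * mart_sum xi n w)); [apply: ler_wpM2l => //; exact: Ax|ring].
rewrite tx nt te exprMn expr2 sg2 mul1r -/v ler_expR le_eqVlt; apply/orP; left; apply/eqP.
rewrite /x_hat -/y -/v -/r !expr_div_n sqr_sqrtr ?(ltW v0)// /t.
by field; rewrite !gt_eqF//; lra.
Qed.
End bernstein_tail.

(** * The tilted probability *)

Section probability_density.
Context d (T : measurableType d) (R : realType) (P : probability T R).
Variables (Z : T -> R) (Z0 : forall w, 0 <= Z w) (iZ : L1 P Z) (EZ : Ex P Z = 1).

(** The normalization is an argument of the measure, so that its probability structure is inferred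
    from the term. *)
Definition probability_density of Ex P Z = 1 := density Z0 iZ.

HB.instance Definition _ := Measure.on (probability_density EZ).

Let probability_densityT : probability_density EZ setT = 1%E.
Proof. by rewrite /probability_density /density ExE// EZ. Qed.

HB.instance Definition _ := Measure_isProbability.Build _ _ _
  (probability_density EZ) probability_densityT.

Local Notation Q := (probability_density EZ : probability T R).

Lemma maxr_sub (a : R) : a = Num.max a 0 - Num.max (- a) 0.
Proof.
have [a0|] := boolP (0 <= a); first by rewrite (max_l a0) max_r ?oppr_le0// subr0.
rewrite -ltNge => /ltW a0.
by rewrite (max_r a0) max_l ?oppr_ge0// sub0r opprK.
Qed.

Lemma ge0_integral_probability_density (f : T -> R) : measurable_fun setT f ->
  (forall w, 0 <= f w) -> (\int[Q]_w (f w)%:E = \int[P]_w (Z w * f w)%:E)%E.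
Proof.
move=> mf f0; rewrite (@ge0_integral_density _ _ _ P Q Z)//.
- by apply: eq_integral => w _; rewrite -EFinM mulrC.
exact/measurable_EFinP.
Qed.

Lemma L1_probability_density f : measurable_fun setT f ->
  L1 Q f <-> L1 P (fun w => Z w * f w).
Proof.
move=> mf; have mZ := L1_meas iZ.
have E : (\int[Q]_w `|(f w)%:E| = \int[P]_w `|(Z w * f w)%:E|)%E.
  rewrite (_ : (fun w => `|(Z w * f w)%:E|%E) = fun w => (Z w * `|f w|)%:E); last first.
    by apply/funext => w; rewrite /= normrM (ger0_norm (Z0 w)).
  by apply: ge0_integral_probability_density => //; exact: measurableT_comp.
split=> /integrableP[_ h]; apply/integrableP; split.
- by apply/measurable_EFinP; exact: measurable_funM.
- by rewrite /= -E.
- exact/measurable_EFinP.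
- by rewrite /= E.
Qed.

Lemma Ex_probability_density f : measurable_fun setT f -> L1 P (fun w => Z w * f w) ->
  Ex Q f = Ex P (fun w => Z w * f w).
Proof.
move=> mf iZf.
have pos g : measurable_fun setT g -> L1 P (fun w => Z w * g w) ->
    [/\ L1 P (fun w => Z w * Num.max (g w) 0), L1 Q (fun w => Num.max (g w) 0) &
      Ex Q (fun w => Num.max (g w) 0) = Ex P (fun w => Z w * Num.max (g w) 0)].
  move=> mg iZg.
  have mg' : measurable_fun setT (fun w => Num.max (g w) 0) by exact: measurable_maxr.
  have g0 w : 0 <= Num.max (g w) 0 by rewrite le_max lexx orbT.
  have i1 : L1 P (fun w => Z w * Num.max (g w) 0).
    apply: (L1_le _ iZg); first by apply: measurable_funM => //; exact: L1_meas iZ.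
    move=> w; rewrite !normrM ler_wpM2l//.
    by case: (leP (g w) 0) => ?; rewrite ?normr0.
  have i2 : L1 Q (fun w => Num.max (g w) 0) by apply/L1_probability_density.
  by split=> //; apply: EFin_inj; rewrite -!ExE// ge0_integral_probability_density.
have mNf : measurable_fun setT (fun w => - f w) by exact: measurableT_comp.
have iNf : L1 P (fun w => Z w * - f w).
  by have := L1N iZf; congr L1; apply/funext => w; rewrite mulrN.
have [i1 j1 E1] := pos f mf iZf; have [i2 j2 E2] := pos (fun w => - f w) mNf iNf.
transitivity (Ex Q (fun w => Num.max (f w) 0) - Ex Q (fun w => Num.max (- f w) 0)).
  by rewrite -(ExB j1 j2); apply: eq_Ex => w; exact: maxr_sub.
rewrite E1 E2 -(ExB i1 i2); apply: eq_Ex => w.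
by rewrite -mulrBr -maxr_sub.
Qed.

Lemma ae_probability_density (A : set T) :
  {ae P, forall w, A w} -> {ae Q, forall w, A w}.
Proof.
case=> N [mN PN sub]; exists N; split=> //.
by rewrite /= /probability_density /density null_set_integral//; exact/measurable_funTS/measurable_int/iZ.
Qed.

End probability_density.

Section tilt_expansions.
Context (R : realType).
Variables (x s l e D : R).
Hypothesis e_gt0 : 0 < e.
Hypothesis le_small : `|l| * e <= 1 / 1200.
Hypothesis s0 : 0 <= s.
Hypothesis s_le : s <= 12 * e ^+ 2.
Hypothesis D0 : 0 <= D.
Hypothesis cubeD : `|x| ^+ 3 * expR `|l * x| <= 4 * e * D.
Hypothesis sqrD : `|x| ^+ 2 * expR `|l * x| <= D.

Let q := `|l| * e.
Let E := expR (l * x).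
Let u := E - 1 - l * x.
Let p := `|l| * s.

Let q0 : 0 <= q. Proof. by rewrite mulr_ge0// ltW. Qed.

Let p0 : 0 <= p. Proof. by rewrite mulr_ge0. Qed.

Let p_le : p <= e / 100.
Proof.
have h1 := ler_wpM2l (normr_ge0 l) s_le; rewrite -/p in h1.
have h2 : `|l| * (12 * e ^+ 2) = 12 * q * e by rewrite /q; move: (`|l|) => y; ring.
rewrite h2 in h1; apply: le_trans h1 _; rewrite [leRHS]mulrC ler_wpM2r ?(ltW e_gt0)//.
by have := le_small; rewrite -/q; lra.
Qed.

Let u_le : `|u| <= `|l| ^+ 2 * D.
Proof.
apply: le_trans (expR_taylor2 _) _; rewrite {1}normrM exprMn -mulrA.
by rewrite ler_wpM2l// exprn_ge0.
Qed.

Let E_sub1 : `|x| * `|E - 1| <= `|l| * D.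
Proof.
apply: le_trans (ler_wpM2l (normr_ge0 x) (expR_taylor1 _)) _.
rewrite [leLHS](_ : _ = `|l| * (`|x| ^+ 2 * expR `|l * x|)); first by rewrite ler_wpM2l.
by rewrite {1}normrM; ring.
Qed.

Let E_le : E <= expR `|l * x|.
Proof. by rewrite ler_expR ler_norm. Qed.

(** The constant term - l s and the coefficient l of x^2 cancel once x^2 is replaced by its
    conditional mean s: this is why l s is the right centring under the tilted law, with a drift of
    order l^2 e s only. *)
Lemma tilt_expansion1 :
  `|E * (x - l * s) - - (l * s) - (1 - l ^+ 2 * s) * x - l * x ^+ 2| <= 5 * l ^+ 2 * e * D.
Proof.
have -> : E * (x - l * s) - - (l * s) - (1 - l ^+ 2 * s) * x - l * x ^+ 2 = x * u - l * s * u.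
  by rewrite /u; ring.
have h1 : `|x * u| <= 4 * (l ^+ 2 * e * D).
  rewrite normrM; apply: le_trans (ler_wpM2l (normr_ge0 x) (expR_taylor2 _)) _.
  rewrite [leLHS](_ : _ = `|l| ^+ 2 * (`|x| ^+ 3 * expR `|l * x|)); last first.
    by rewrite {1}normrM; ring.
  rewrite real_normK ?num_real//.
  apply: le_trans (ler_wpM2l (sqr_ge0 l) cubeD) _.
  by rewrite le_eqVlt; apply/orP; left; apply/eqP; ring.
have h2 : `|l * s * u| <= l ^+ 2 * e * D.
  rewrite normrM [`|l * s|]normrM (ger0_norm s0) -/p.
  apply: le_trans (ler_pM p0 (normr_ge0 _) (le_trans p_le (_ : _ <= e)) u_le) _.
    by have := e_gt0; lra.
  by rewrite real_normK ?num_real// mulrA [e * _]mulrC.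
have -> : 5 * l ^+ 2 * e * D = 5 * (l ^+ 2 * e * D) by ring.
by apply: le_trans (ler_normB _ _) _; move: h1 h2; move: (l ^+ 2 * e * D) => y; lra.
Qed.

(** The coefficient of x^2 is 1, so the tilt preserves the conditional variance s up to a relative
    error of order |l| e. *)
Lemma tilt_expansion2 :
  `|E * (x - l * s) ^+ 2 - l ^+ 2 * s ^+ 2 - (- (2 * (l * s)) + l ^+ 3 * s ^+ 2) * x
    - 1 * x ^+ 2| <= 6 * q * D.
Proof.
have -> : E * (x - l * s) ^+ 2 - l ^+ 2 * s ^+ 2 - (- (2 * (l * s)) + l ^+ 3 * s ^+ 2) * x
    - 1 * x ^+ 2 = x * (x * (E - 1)) - 2 * (l * s) * (x * (E - 1)) + (l * s) ^+ 2 * u.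
  by rewrite /u; ring.
have h1 : `|x * (x * (E - 1))| <= 4 * (q * D).
  rewrite normrM [`|x * (_ - _)|]normrM.
  have h := ler_wpM2l (sqr_ge0 `|x|) (expR_taylor1 (l * x)).
  rewrite mulrA -expr2; apply: le_trans h _.
  rewrite [leLHS](_ : _ = `|l| * (`|x| ^+ 3 * expR `|l * x|)); last first.
    by rewrite {1}normrM; ring.
  apply: le_trans (ler_wpM2l (normr_ge0 l) cubeD) _.
  by rewrite le_eqVlt /q; apply/orP; left; apply/eqP; move: (`|l|) => y; ring.
have h2 : `|2 * (l * s) * (x * (E - 1))| <= q * D.
  rewrite normrM [`|2 * _|]normrM [`|l * s|]normrM (ger0_norm s0) -/p (ger0_norm (ler0n _ 2)).
  rewrite [`|x * _|]normrM.
  have p2 : 0 <= 2 * p by rewrite mulr_ge0.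
  have pe : 2 * p <= e by have := p_le; have := e_gt0; lra.
  apply: le_trans (ler_pM p2 (mulr_ge0 (normr_ge0 _) (normr_ge0 _)) pe E_sub1) _.
  by rewrite mulrA [e * _]mulrC.
have h3 : `|(l * s) ^+ 2 * u| <= q * D.
  rewrite normrM normrX normrM (ger0_norm s0) -/p.
  have pe : p ^+ 2 <= e ^+ 2.
    by rewrite ler_pXn2r ?nnegrE ?(ltW e_gt0)//; have := p_le; have := e_gt0; lra.
  apply: le_trans (ler_pM (sqr_ge0 p) (normr_ge0 u) pe u_le) _.
  have -> : e ^+ 2 * (`|l| ^+ 2 * D) = q * (q * D) by rewrite /q; move: (`|l|) => y; ring.
  rewrite ler_piMl//; first by rewrite mulr_ge0.
  by have := le_small; rewrite -/q; lra.
apply: le_trans (ler_normD _ _) _; apply: le_trans (lerD (ler_normB _ _) (lexx _)) _.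
by rewrite -[leRHS]mulrA; move: h1 h2 h3; move: (q * D) => y; lra.
Qed.

(** The polynomial 4 |x|^3 + 4 p^3 majorizes |x - l s|^3 by [tilt_cube_le]. The cubic part goes
    entirely into the remainder, so there is no term in x^2. *)
Lemma tilt_expansion3 :
  `|E * (4 * `|x| ^+ 3 + 4 * p ^+ 3) - 4 * p ^+ 3 - 4 * p ^+ 3 * l * x - 0 * x ^+ 2|
    <= 17 * e * D.
Proof.
have -> : E * (4 * `|x| ^+ 3 + 4 * p ^+ 3) - 4 * p ^+ 3 - 4 * p ^+ 3 * l * x - 0 * x ^+ 2 =
    4 * (`|x| ^+ 3 * E) + 4 * p ^+ 3 * u.
  by rewrite /u; move: (`|x| ^+ 3) => y; ring.
have h1 : `|4 * (`|x| ^+ 3 * E)| <= 16 * (e * D).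
  rewrite ger0_norm; last by rewrite !mulr_ge0 ?expR_ge0// exprn_ge0.
  have := le_trans (ler_wpM2l (exprn_ge0 3 (normr_ge0 x)) E_le) cubeD.
  have -> : 4 * e * D = 4 * (e * D) by ring.
  by move: (e * D) (`|x| ^+ 3 * E) => y z; lra.
have h2 : `|4 * p ^+ 3 * u| <= e * D.
  have p3 : 0 <= 4 * p ^+ 3 by rewrite mulr_ge0// exprn_ge0.
  rewrite normrM (ger0_norm p3).
  have pe : 4 * p ^+ 3 <= e ^+ 3.
    apply: (@le_trans _ _ (4 * (e / 100) ^+ 3)).
      rewrite ler_pM2l// ler_pXn2r ?nnegrE//.
      by have := e_gt0; lra.
    rewrite expr_div_n mulrCA ler_piMr ?exprn_ge0 ?(ltW e_gt0)//.
    by rewrite ler_pdivrMr ?exprn_gt0// mul1r; lra.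
  apply: le_trans (ler_pM p3 (normr_ge0 u) pe u_le) _.
  have -> : e ^+ 3 * (`|l| ^+ 2 * D) = q ^+ 2 * (e * D) by rewrite /q; move: (`|l|) => y; ring.
  rewrite ler_piMl//; first by rewrite mulr_ge0// ltW.
  by rewrite exprn_ile1//; have := le_small; rewrite -/q; lra.
apply: le_trans (ler_normD _ _) _.
by rewrite -[leRHS]mulrA; move: h1 h2; move: (e * D) => y; lra.
Qed.

Lemma tilt_drift_sqr_le : l ^+ 2 * s ^+ 2 <= q * s.
Proof.
rewrite -(real_normK (num_real l)).
have -> : `|l| ^+ 2 * s ^+ 2 = p * (`|l| * s) by rewrite /p; move: (`|l|) => y; ring.
have -> : q * s = e * (`|l| * s) by rewrite /q; move: (`|l|) => y; ring.
by rewrite ler_wpM2r//; have := p_le; have := e_gt0; lra.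
Qed.

Lemma tilt_drift_cube_le : 4 * p ^+ 3 <= e * s.
Proof.
have p2 : p ^+ 2 <= (e / 100) ^+ 2.
  by rewrite ler_pXn2r ?nnegrE//; have := e_gt0; lra.
have -> : 4 * p ^+ 3 = 4 * p ^+ 2 * (`|l| * s) by rewrite -/p; ring.
apply: (@le_trans _ _ (4 * (e / 100) ^+ 2 * (`|l| * s))).
  by rewrite ler_wpM2r// ler_pM2l.
have -> : 4 * (e / 100) ^+ 2 * (`|l| * s) = 4 / 100 / 100 * q * (e * s).
  by rewrite /q; move: (`|l|) => y; field.
rewrite ler_piMl//; first by rewrite mulr_ge0// ltW.
by have := le_small; rewrite -/q; lra.
Qed.

Lemma tilt_cube_le : `|x - l * s| ^+ 3 <= 4 * `|x| ^+ 3 + 4 * p ^+ 3.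
Proof.
have : `|x - l * s| <= `|x| + p by rewrite (le_trans (ler_normB _ _))// normrM (ger0_norm s0).
move=> h; apply: (@le_trans _ _ ((`|x| + p) ^+ 3)).
  by rewrite ler_pXn2r ?nnegrE// addr_ge0.
have := normr_ge0 x; have := p0; move: (`|x|) p => y z z0 y0.
have h2 : 0 <= 3 * (y + z) * (y - z) ^+ 2 by rewrite mulr_ge0 ?sqr_ge0// mulr_ge0// addr_ge0.
have -> : (y + z) ^+ 3 = 4 * y ^+ 3 + 4 * z ^+ 3 - 3 * (y + z) * (y - z) ^+ 2 by ring.
by lra.
Qed.

End tilt_expansions.

Section tilted_martingale.
Context (R : realType) d (T : measurableType d) (P : probability T R).
Variables (n : nat) (F : nat -> set (set T)) (xi s : nat -> T -> R) (e dl l : R).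
Hypothesis BM : bernstein_martingale P n F xi s e dl.
Hypothesis le_small : `|l| * e <= 1 / 1200.
Hypothesis l2e_small : 144 * (5 * l ^+ 2 * e) <= 1.
Hypothesis te : `|l| * e < 1.
Variable m : nat -> T -> R.
Hypothesis cm : forall k, (k < n)%N ->
  is_cond_exp P (F k) (fun w => expR (l * xi k.+1 w)) (m k).
Hypothesis m_between : forall k w,
  1 + l ^+ 2 * Num.max 0 (1 / 2 - 576 * (`|l| * e)) * s k.+1 w <= m k w
    <= 1 + l ^+ 2 / (2 * (1 - `|l| * e)) * s k.+1 w.

Local Notation Z := (likelihood xi l m).

Let e_gt0 := bm_e BM.

Lemma likelihood_ge0 k w : 0 <= Z k w.
Proof. exact/ltW/(likelihood_gt0 BM m_between). Qed.

Definition tilted_probability : probability T R :=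
  probability_density (likelihood_ge0 n) (likelihood_prob BM te cm m_between).1
    (likelihood_prob BM te cm m_between).2.

Local Notation Q := tilted_probability.

Let iZ : L1 P (Z n) := (likelihood_prob BM te cm m_between).1.

Let mwrtT k (V : T -> R) : (k <= n)%N -> measurable_wrt (F k) V -> measurable_fun setT V.
Proof. by move=> kn; apply: mwrt_meas; exact: (bm_sub BM). Qed.

Lemma tilted_L1 k (V : T -> R) : (k <= n)%N -> measurable_wrt (F k) V -> (forall w, 0 <= V w) ->
  L1 Q V -> L1 P (fun w => Z k w * V w).
Proof.
move=> kn mV V0 /(L1_probability_density (likelihood_ge0 n) (likelihood_prob BM te cm m_between).1
  (likelihood_prob BM te cm m_between).2 (mwrtT kn mV)) h.
exact/(likelihood_weight BM te cm m_between kn mV V0).1.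
Qed.

(** For quantities known at time k the final likelihood may be replaced by the one at time k.
    Positive and negative parts reduce this to [likelihood_weight]. *)
Lemma tilted_Ex k (V : T -> R) : (k <= n)%N -> measurable_wrt (F k) V ->
  L1 P (fun w => Z k w * V w) -> L1 Q V /\ Ex Q V = Ex P (fun w => Z k w * V w).
Proof.
move=> kn mV iV; have sG := bm_sigma BM kn.
have pos (U : T -> R) : measurable_wrt (F k) U -> L1 P (fun w => Z k w * U w) ->
    [/\ L1 P (fun w => Z k w * Num.max (U w) 0), L1 Q (fun w => Num.max (U w) 0) &
      Ex Q (fun w => Num.max (U w) 0) = Ex P (fun w => Z k w * Num.max (U w) 0)].
  move=> mU iU; have mU' : measurable_wrt (F k) (fun w => Num.max (U w) 0).
    by apply: (mwrt_max sG) => //; exact: mwrt_cst.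
  have U0 w : 0 <= Num.max (U w) 0 by rewrite le_max lexx orbT.
  have i1 : L1 P (fun w => Z k w * Num.max (U w) 0).
    apply: (L1_le _ iU).
      apply: measurable_funM; last exact: mwrtT mU'.
      exact: mwrtT (measurable_likelihood BM cm kn).
    move=> w; rewrite !normrM ler_wpM2l//.
    by case: (leP (U w) 0) => ?; rewrite ?normr0.
  have [h <-] := likelihood_weight BM te cm m_between kn mU' U0.
  have in1 := h.2 i1.
  split=> //; first exact/(L1_probability_density _ _ _ (mwrtT kn mU')).
  exact: Ex_probability_density (mwrtT kn mU') in1.
have iN : L1 P (fun w => Z k w * - V w).
  by have := L1N iV; congr L1; apply/funext => w; rewrite mulrN.
have [i1 j1 E1] := pos V mV iV; have [i2 j2 E2] := pos (fun w => - V w) (mwrtN mV) iN.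
have VE : V = fun w => Num.max (V w) 0 - Num.max (- V w) 0.
  by apply/funext => w; exact: maxr_sub.
split; first by rewrite VE; exact: L1B.
rewrite {1}VE (ExB j1 j2) E1 E2 -(ExB i1 i2); apply: eq_Ex => w.
by rewrite -mulrBr -maxr_sub.
Qed.

Let m_ge1 k w : 1 <= m k w := cond_expR_ge1 BM m_between k w.

Let m_gt0 k w : 0 < m k w.
Proof. exact: lt_le_trans ltr01 (m_ge1 k w). Qed.

Section step.
Variables (k : nat) (W : T -> R).
Hypotheses (kn : (k < n)%N) (mW : measurable_wrt (F k) W).
Hypotheses (W0 : forall w, 0 <= W w) (iW : L1 Q W).

Let kn' : (k <= n)%N := ltnW kn.
Let sG := bm_sigma BM kn'.
Let Gm := bm_sub BM kn'.
Let X := xi k.+1.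
Let sk := s k.+1.
Let V w := Z k w * W w / m k w.
Let D := dominator X e.
Let E w := expR (l * X w).

Let mm : measurable_wrt (F k) (m k). Proof. by case: (cm kn). Qed.

Let mZ : measurable_wrt (F k) (Z k). Proof. exact: (measurable_likelihood BM cm kn'). Qed.

Let mV : measurable_wrt (F k) V. Proof. by rewrite /V; mwrt_auto sG. Qed.

Let V0 w : 0 <= V w.
Proof. by rewrite divr_ge0 ?(ltW (m_gt0 _ _))// mulr_ge0// likelihood_ge0. Qed.

Let iZW : L1 P (fun w => Z k w * W w). Proof. exact: tilted_L1. Qed.

Let iV : L1 P V.
Proof.
apply: (L1_le (mwrtT kn' mV) iZW) => w.
rewrite ger0_norm// ger0_norm ?mulr_ge0 ?likelihood_ge0// /V.
by rewrite ler_pdivrMr// ler_peMr// mulr_ge0// likelihood_ge0.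
Qed.

Let msk : measurable_wrt (F k) sk. Proof. by case: (bm_variance BM kn). Qed.

Let mX' : measurable_wrt (F k.+1) X. Proof. exact: (bm_adapted BM kn). Qed.

Let mX : measurable_fun setT X. Proof. exact: mwrtT mX'. Qed.

Let up (U : T -> R) : measurable_wrt (F k) U -> measurable_wrt (F k.+1) U.
Proof. by move=> mU; apply: (mwrt_sub mU); exact: (bm_filtration BM kn). Qed.

(** The likelihood at time k + 1 is Z_k exp (l X) / m_k. All but the exponential is known at time k
    and forms the weight [V], so moments under the tilted law become moments of exp (l X) h under
    [P], in reach of [Ex_expansion]. *)
Let transfer (h : T -> R) : measurable_wrt (F k.+1) h -> L1 P (fun w => V w * (E w * h w)) ->
  L1 Q (fun w => W w * h w) /\
  Ex Q (fun w => W w * h w) = Ex P (fun w => V w * (E w * h w)).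
Proof.
move=> mh; have -> : (fun w => V w * (E w * h w)) = fun w => Z k.+1 w * (W w * h w).
  apply/funext => w; rewrite likelihoodS /V -/X -/(E w).
  have := lt0r_neq0 (m_gt0 k w).
  by move: (m k w) (Z k w) (W w) (E w) (h w) => x y z u v x0; field.
apply: tilted_Ex => //; have sG' := bm_sigma BM kn.
by apply: (mwrtM sG') => //; exact: up.
Qed.

Let sk0 w : 0 <= sk w := bm_s_ge0 BM k.+1 w.
Let sk_le w : sk w <= 12 * e ^+ 2 := bm_s_le BM k.+1 w.

Let iX p := bm_L1 BM p kn.
Let hX p A := @bm_moment _ _ _ _ _ _ _ _ _ _ BM k p A kn.

Let q := `|l| * e.

Let q0 : 0 <= q. Proof. by rewrite mulr_ge0// ltW. Qed.

Let iVs : L1 P (fun w => V w * sk w).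
Proof.
by have [] := step_weight sG Gm iX sk0 sk_le (bm_mean BM kn) (bm_variance BM kn) mV V0 iV.
Qed.

Let sg := Ex P (fun w => V w * sk w).
Let sgQ := Ex Q (fun w => W w * sk w).

Let sg0 : 0 <= sg. Proof. by apply: Ex_ge0 => w; rewrite mulr_ge0. Qed.

(** The weights in [sg] and [sgQ] differ by the factor m_k, which lies between 1 and 1 + l^2 s, and
    l^2 s^2 <= q s. *)
Let sgQ_between : sg <= sgQ <= (1 + q) * sg.
Proof.
have iZWs : L1 P (fun w => Z k w * (W w * sk w)).
  apply: (L1_le _ (L1Z (12 * e ^+ 2) iZW)).
    by apply: (mwrtT kn'); mwrt_auto sG.
  move=> w; rewrite mulrA mulrC normrM [leRHS]normrM ler_wpM2r// (ger0_norm (sk0 w)).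
  by rewrite (le_trans (sk_le w))// ler_norm.
have mWs : measurable_wrt (F k) (fun w => W w * sk w) by mwrt_auto sG.
have [_ EQ] := tilted_Ex kn' mWs iZWs.
have ZE w : Z k w * (W w * sk w) = V w * sk w * m k w.
  rewrite /V; have := lt0r_neq0 (m_gt0 k w).
  by move: (m k w) (Z k w) (W w) (sk w) => x y z u x0; field.
have Vs0 w : 0 <= V w * sk w by rewrite mulr_ge0.
rewrite /sgQ EQ; apply/andP; split.
  by apply: Ex_le iVs iZWs _ => w; rewrite ZE ler_peMr.
rewrite -(ExZ _ iVs); apply: Ex_le iZWs (L1Z _ iVs) _ => w.
rewrite ZE -mulrA [leRHS]mulrCA ler_wpM2l//.
have /andP[_ mle] := m_between k w.
apply: (@le_trans _ _ (sk w * (1 + l ^+ 2 * sk w))).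
  rewrite ler_wpM2l//; apply: le_trans mle _; rewrite lerD2l -/sk ler_wpM2r//.
  rewrite ler_piMr ?sqr_ge0// invf_le1; rewrite -/q; have := le_small; rewrite -/q; lra.
have := tilt_drift_sqr_le e_gt0 le_small (sk0 w) (sk_le w); rewrite -/q => h.
rewrite [leLHS](_ : _ = sk w + l ^+ 2 * sk w ^+ 2); last by ring.
by rewrite [leRHS]mulrDl mul1r lerD2l.
Qed.

Let q4 : q <= 1 / 4. Proof. by have := le_small; rewrite -/q; lra. Qed.

Let expansion (h a b : T -> R) (g A B rho : R) :=
  @Ex_expansion _ _ _ _ _ _ _ _ sG Gm e_gt0 iX sk0 sk_le (bm_mean BM kn) (bm_variance BM kn) hX
    V h a b g A B rho mV V0 iV.

Let cubeD w := cube_expR_le X e_gt0 w q4.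
Let sqrD w := sqr_expR_le X e_gt0 w q4.

Let mE : measurable_fun setT E.
Proof. by apply: measurableT_comp => //; exact: measurable_funM. Qed.

Let msT : measurable_fun setT sk := mwrtT kn' msk.

Let eta w := X w - l * sk w.

Let meta : measurable_wrt (F k.+1) eta.
Proof.
have sG' := bm_sigma BM kn; apply: (mwrtB sG') => //.
by apply: (mwrtM sG'); [exact: mwrt_cst|exact: up].
Qed.

Lemma tilted_mean : `|Ex Q (fun w => W w * eta w)| <= 144 * (5 * l ^+ 2 * e) * sgQ.
Proof.
have ma : measurable_wrt (F k) (fun w => - (l * sk w)) by mwrt_auto sG.
have mb : measurable_wrt (F k) (fun w => 1 - l ^+ 2 * sk w) by mwrt_auto sG.
have mh : measurable_fun setT (fun w => E w * eta w).
  by apply: measurable_funM => //; exact: mwrtT meta.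
have rho0 : 0 <= 5 * l ^+ 2 * e by rewrite mulr_ge0 ?(ltW e_gt0)// mulr_ge0// sqr_ge0.
have [] := @expansion _ _ _ l (`|l| * (12 * e ^+ 2)) (1 + l ^+ 2 * (12 * e ^+ 2)) _ mh ma mb _ _ rho0.
- by move=> w; rewrite normrN normrM (ger0_norm (sk0 w)) ler_wpM2l.
- move=> w; apply: le_trans (ler_normB _ _) _.
  rewrite normr1 lerD2l normrM (ger0_norm (sk0 w)) (ger0_norm (sqr_ge0 l)).
  by rewrite ler_wpM2l// sqr_ge0.
- by move=> w; exact: (tilt_expansion1 e_gt0 le_small (sk0 w) (sk_le w) (cubeD w) (sqrD w)).
move=> iVh; have -> : Ex P (fun w => V w * - (l * sk w)) = - l * sg.
  by rewrite -(ExZ _ iVs); apply: eq_Ex => w; ring.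
have [_ ->] := transfer meta iVh; rewrite -/sg => h.
have /andP[s1 _] := sgQ_between.
apply: (@le_trans _ _ (144 * (5 * l ^+ 2 * e) * sg)).
  by move: h; move: (Ex P _) => u; rewrite (_ : u - - l * sg - l * sg = u); last ring.
by rewrite ler_wpM2l// mulr_ge0.
Qed.

(** The expansion error has constant 6; the seventh unit pays for the squared drift l^2 s^2 and for
    the passage from [sg] to [sgQ], each at most q [sg]. *)
Lemma tilted_variance : `|Ex Q (fun w => W w * eta w ^+ 2) - sgQ| <= 144 * (7 * (`|l| * e)) * sgQ.
Proof.
have ma : measurable_wrt (F k) (fun w => l ^+ 2 * sk w ^+ 2) by mwrt_auto sG.
have mb : measurable_wrt (F k) (fun w => - (2 * (l * sk w)) + l ^+ 3 * sk w ^+ 2).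
  by mwrt_auto sG.
have mh : measurable_fun setT (fun w => E w * eta w ^+ 2).
  by apply: measurable_funM => //; apply: measurable_funX; exact: mwrtT meta.
have rho0 : 0 <= 6 * q by rewrite mulr_ge0.
have a_le w := tilt_drift_sqr_le e_gt0 le_small (sk0 w) (sk_le w).
have a_ge0 w : 0 <= l ^+ 2 * sk w ^+ 2 by rewrite mulr_ge0 ?sqr_ge0.
have sk2 w : sk w ^+ 2 <= (12 * e ^+ 2) ^+ 2.
  by rewrite ler_pXn2r ?nnegrE// (le_trans (sk0 w)).
have aA w : `|l ^+ 2 * sk w ^+ 2| <= q * (12 * e ^+ 2).
  by rewrite ger0_norm// (le_trans (a_le w))// ler_wpM2l.
have [] := @expansion _ _ _ 1 _ (2 * (`|l| * (12 * e ^+ 2)) + `|l| ^+ 3 * (12 * e ^+ 2) ^+ 2)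
    _ mh ma mb aA _ rho0.
- move=> w; apply: le_trans (ler_normD _ _) _; rewrite normrN; apply: lerD.
    rewrite normrM (ger0_norm (ler0n _ 2)) ler_pM2l// normrM (ger0_norm (sk0 w)).
    by rewrite ler_wpM2l.
  rewrite normrM normrX (ger0_norm (sqr_ge0 (sk w))).
  by rewrite ler_wpM2l// exprn_ge0.
- by move=> w; exact: (tilt_expansion2 e_gt0 le_small (sk0 w) (sk_le w) (dominator_ge0 X e w) (cubeD w) (sqrD w)).
move=> iVh; have meta2 : measurable_wrt (F k.+1) (fun w => eta w ^+ 2) by exact: mwrtX.
have [_ ->] := transfer meta2 iVh; rewrite -/sg mul1r => h.
have iVa : L1 P (fun w => V w * (l ^+ 2 * sk w ^+ 2)).
  apply: (L1_le _ (L1Z q iVs)); first by apply: (mwrtT kn'); mwrt_auto sG.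
  move=> w; rewrite ger0_norm; last exact: mulr_ge0.
  rewrite ger0_norm; last exact: mulr_ge0 q0 (mulr_ge0 (V0 w) (sk0 w)).
  by rewrite [leRHS]mulrCA; apply: ler_wpM2l.
have Ea : 0 <= Ex P (fun w => V w * (l ^+ 2 * sk w ^+ 2)) <= q * sg.
  apply/andP; split; first by apply: Ex_ge0 => w; rewrite mulr_ge0.
  rewrite -(ExZ _ iVs); apply: Ex_le iVa (L1Z _ iVs) _ => w.
  by rewrite [leRHS]mulrCA ler_wpM2l.
have /andP[s1 s2] := sgQ_between; have /andP[a1 a2] := Ea.
have gen (c u v : R) : c * (u * q) * v = u * (c * (q * v)) by ring.
have {}s2 : sgQ <= sg + q * sg by have := s2; rewrite mulrDl mul1r.
rewrite -/q gen; rewrite gen in h.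
have := ler_wpM2l q0 s1; have := mulr_ge0 q0 sg0; move: h a1 a2 s1 s2.
move: (q * sg) (q * sgQ) (Ex P _) (Ex P _) => u v x y.
by rewrite !ler_norml => /andP[? ?] *; apply/andP; split; lra.
Qed.

Lemma tilted_third_moment : L1 Q (fun w => W w * `|eta w| ^+ 3) /\
  Ex Q (fun w => W w * `|eta w| ^+ 3) <= 144 * 18 * e * sgQ.
Proof.
pose p w := `|l| * sk w.
have mp : measurable_wrt (F k) p by rewrite /p; mwrt_auto sG.
have p0 w : 0 <= p w by rewrite mulr_ge0.
have ma : measurable_wrt (F k) (fun w => 4 * p w ^+ 3) by mwrt_auto sG.
have mb : measurable_wrt (F k) (fun w => 4 * p w ^+ 3 * l) by mwrt_auto sG.
pose h w := 4 * `|X w| ^+ 3 + 4 * p w ^+ 3.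
have mpT : measurable_fun setT (fun w => 4 * p w ^+ 3) := mwrtT kn' ma.
have mh : measurable_fun setT (fun w => E w * h w).
  apply: measurable_funM => //; apply: measurable_funD => //.
  apply: measurable_funM => //; apply: measurable_funX; exact: measurableT_comp.
have rho0 : 0 <= 17 * e by rewrite mulr_ge0// ltW.
have a0 w : 0 <= 4 * p w ^+ 3 by rewrite mulr_ge0// exprn_ge0.
have a_le w : 4 * p w ^+ 3 <= e * sk w.
  exact: (tilt_drift_cube_le e_gt0 le_small (sk0 w) (sk_le w)).
have aA w : `|4 * p w ^+ 3| <= e * (12 * e ^+ 2).
  by rewrite ger0_norm// (le_trans (a_le w))// ler_wpM2l// ltW.
have [] := @expansion _ _ _ 0 _ (e * (12 * e ^+ 2) * `|l|) _ mh ma mb aA _ rho0.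
- by move=> w; rewrite normrM ler_wpM2r.
- by move=> w; exact: (tilt_expansion3 e_gt0 le_small (sk0 w) (sk_le w) (dominator_ge0 X e w) (cubeD w) (sqrD w)).
move=> iVh; rewrite -/sg mul0r subr0 => hb.
have iVa : L1 P (fun w => V w * (4 * p w ^+ 3)).
  apply: (L1_le _ (L1Z e iVs)); first by apply: (mwrtT kn'); mwrt_auto sG.
  move=> w; rewrite ger0_norm; last exact: mulr_ge0.
  rewrite ger0_norm; last exact: mulr_ge0 (ltW e_gt0) (mulr_ge0 (V0 w) (sk0 w)).
  by rewrite [leRHS]mulrCA ler_wpM2l.
have Ea : Ex P (fun w => V w * (4 * p w ^+ 3)) <= e * sg.
  rewrite -(ExZ _ iVs); apply: Ex_le iVa (L1Z _ iVs) _ => w.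
  by rewrite [leRHS]mulrCA ler_wpM2l.
have meta3 : measurable_wrt (F k.+1) (fun w => `|eta w| ^+ 3).
  by apply: mwrtX; exact: mwrt_abs.
have E0 w : 0 <= E w by exact: expR_ge0.
have h_ge w : V w * (E w * `|eta w| ^+ 3) <= V w * (E w * h w).
  by rewrite !ler_wpM2l//; exact: tilt_cube_le.
have iVe : L1 P (fun w => V w * (E w * `|eta w| ^+ 3)).
  apply: (L1_le _ iVh).
    apply: measurable_funM; first exact: mwrtT mV.
    by apply: measurable_funM => //; exact: mwrtT meta3.
  have e30 w : 0 <= `|eta w| ^+ 3 by exact: exprn_ge0.
  move=> w; rewrite ger0_norm; last exact: mulr_ge0 (V0 w) (mulr_ge0 (E0 w) (e30 w)).
  by rewrite (le_trans (h_ge w))// ler_norm.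
have [iQ ->] := transfer meta3 iVe; split=> //.
apply: le_trans (Ex_le iVe iVh h_ge) _.
have /andP[s1 _] := sgQ_between; have := ler_wpM2l (ltW e_gt0) s1.
move: hb Ea; have gen (c u v z : R) : c * (u * v) * z = c * u * (v * z) by ring.
rewrite gen -[_ * e * sgQ]mulrA; have := mulr_ge0 (ltW e_gt0) sg0.
move: (Ex P _) (Ex P _) (e * sg) (e * sgQ) => u v x y.
by rewrite ler_norml => ? /andP[? ?] ? ?; lra.
Qed.

End step.

(** The smallness assumptions keep the relative errors below 1: 144 * 7 < 1200 for the variance, and
    [l2e_small] for the drift. *)
Lemma tilted_approx_martingale :
  approx_martingale Q n F (fun k w => xi k w - l * s k w) s e dl
    (144 * (5 * l ^+ 2 * e)) (144 * (7 * (`|l| * e))) (144 * 18).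
Proof.
have al0 : 0 <= 144 * (5 * l ^+ 2 * e) by apply: mulr_ge0 => //; apply: mulr_ge0 (ltW e_gt0); apply: mulr_ge0 => //; exact: sqr_ge0.
have be0 : 0 <= 144 * (7 * (`|l| * e)) by rewrite !mulr_ge0// ltW.
split.
- exact: (bm_sigma BM).
- exact: (bm_sub BM).
- exact: (bm_filtration BM).
- move=> k kn; have sG' := bm_sigma BM kn; apply: (mwrtB sG'); first exact: (bm_adapted BM).
  apply: (mwrtM sG'); first exact: mwrt_cst.
  have [msk _ _] := bm_variance BM kn; apply: (mwrt_sub msk).
  exact: (bm_filtration BM).
- by move=> k kn; case: (bm_variance BM kn).
- exact: (bm_s_ge0 BM).
- exact: (bm_s_le BM).
- exact: (bm_sum_le BM).
- move=> k W kn mW W0 iW.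
  have [h3 h4] := tilted_third_moment kn mW W0 iW.
  by split=> //; [exact: tilted_mean|exact: tilted_variance].
- exact: e_gt0.
- exact: (bm_dl BM).
- by rewrite al0.
- by rewrite be0/=; have := le_small; lra.
Qed.

Lemma tilted_sum_ge : {ae Q, forall w, 1 - dl ^+ 2 <= mart_sum s n w}.
Proof. exact: ae_probability_density (bm_sum_ge BM). Qed.

End tilted_martingale.

(** * Half-lines *)

Section elementary.
Context (R : realType).
Implicit Types a e dl x : R.

Lemma expR_sub_sqr_le a : 0 <= a -> expR (a - a ^+ 2) <= 1 + a.
Proof.
move=> a0; have a2 : 0 < 1 - (a - a ^+ 2).
  have -> : 1 - (a - a ^+ 2) = (a - 1 / 2) ^+ 2 + 3 / 4 by field.
  by have := sqr_ge0 (a - 1 / 2); lra.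
have h : 1 - (a - a ^+ 2) <= expR (- (a - a ^+ 2)) by exact: expR_ge1Dx.
rewrite -[a - a ^+ 2]opprK expRN invf_ple ?posrE ?expR_gt0//; last lra.
apply: le_trans h; rewrite -[leLHS]mul1r ler_pdivrMr; last lra.
have -> : (1 - (a - a ^+ 2)) * (1 + a) = 1 + a ^+ 3 by ring.
by rewrite lerDl exprn_ge0.
Qed.

Lemma expR_sub1_le a : expR a - 1 <= a * expR a.
Proof.
have := expR_ge1Dx (- a); rewrite expRN => /(ler_wpM2r (expR_ge0 a)).
by rewrite mulVf ?gt_eqF ?expR_gt0// mulrDl mul1r mulNr; lra.
Qed.

(** An expansion of x_hat^2 to first order in e. Errors of order 1 are harmless, since they only
    multiply the final bound by a constant; 6 is 4 from the square of z and 2 from the factor 1 +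
    dl^2. *)
Lemma x_hat_sqr_le e dl x : 0 < e -> `|x| * e <= 1 -> x ^+ 2 * e <= 1 ->
  x ^+ 2 * dl ^+ 2 <= 1 ->
  x_hat e dl x ^+ 2 <= x ^+ 2 /\ x_hat e dl x ^+ 2 <= x ^+ 2 - `|x| ^+ 3 * e + 6.
Proof.
move=> e0 xe x2e xdl.
have d2 : 0 <= dl ^+ 2 by exact: sqr_ge0.
pose v := 1 + dl ^+ 2; have v0 : 0 < v by rewrite /v; lra.
rewrite -(real_normK (num_real x)) in x2e xdl *.
rewrite /x_hat; set y := `|x|; rewrite -/y in xe x2e xdl *.
have y0 : 0 <= y by exact: normr_ge0.
have y20 := sqr_ge0 y; have ye0 : 0 <= y * e by rewrite mulr_ge0// ltW.
rewrite -/v; pose z := 2 * y * e / v.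
have z0 : 0 <= z by rewrite divr_ge0 ?(ltW v0)// !mulr_ge0// ltW.
rewrite -/z; set r := Num.sqrt (1 + z).
have r2 : r ^+ 2 = 1 + z by rewrite sqr_sqrtr//; lra.
have r1 : 1 <= r by rewrite -sqrtr1 ler_sqrt; lra.
have -> : (2 * y / Num.sqrt v / (1 + r)) ^+ 2 = y ^+ 2 / v * (4 / (1 + r) ^+ 2).
  rewrite !expr_div_n sqr_sqrtr ?(ltW v0)//.
  by field; rewrite !gt_eqF//; lra.
have r12 : 0 < (1 + r) ^+ 2 by rewrite exprn_gt0//; lra.
have vi : v^-1 <= 1 by rewrite invf_le1// /v; lra.
have vi0 : 0 < v^-1 by rewrite invr_gt0.
have h1 : 4 / (1 + r) ^+ 2 <= 1.
  rewrite ler_pdivrMr// mul1r; have -> : 4 = (1 + 1) ^+ 2 :> R by ring.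
  by rewrite ler_pXn2r ?nnegrE//; lra.
have yv : y ^+ 2 / v <= y ^+ 2 by rewrite ler_piMr.
have yv0 : 0 <= y ^+ 2 / v by rewrite mulr_ge0// ltW.
split; first by apply: le_trans yv; rewrite ler_piMr.
(* In terms of u = r - 1 the variable z is u (u + 2), and clearing the denominator leaves a
   polynomial in u with nonnegative coefficients. *)
have h2 : 4 / (1 + r) ^+ 2 <= 1 - z / 2 + z ^+ 2.
  rewrite ler_pdivrMr//; have -> : z = (r - 1) * (r - 1 + 2) by rewrite -[z](addKr 1) -r2; ring.
  have -> : (1 + r) ^+ 2 = (2 + (r - 1)) ^+ 2 by ring.
  have : 0 <= r - 1 by lra.
  move: (r - 1) => u u0.
  have -> : (1 - u * (u + 2) / 2 + (u * (u + 2)) ^+ 2) * (2 + u) ^+ 2 =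
    4 + (11 * u ^+ 2 + 29 * u ^+ 3 + 47 / 2 * u ^+ 4 + 8 * u ^+ 5 + u ^+ 6) by field.
  by rewrite lerDl !addr_ge0// ?mulr_ge0// exprn_ge0.
apply: le_trans (ler_wpM2l yv0 h2) _.
have z2 : z <= 2 * (y * e) by rewrite /z -!mulrA !(ler_wpM2l)// ler_piMr// ltW.
have zz : y ^+ 2 / v * z ^+ 2 <= 4.
  apply: (@le_trans _ _ (y ^+ 2 * (2 * (y * e)) ^+ 2)).
    by apply: ler_pM => //; [exact: sqr_ge0|rewrite ler_pXn2r ?nnegrE//; lra].
  have -> : y ^+ 2 * (2 * (y * e)) ^+ 2 = 4 * (y ^+ 2 * e) ^+ 2 by ring.
  by rewrite ler_piMr// exprn_ile1// mulr_ge0// ltW.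
have zl : y ^+ 3 * e - 2 <= y ^+ 2 / v * (z / 2).
  have -> : y ^+ 2 / v * (z / 2) = y ^+ 3 * e * (v^-1) ^+ 2.
    by rewrite /z; field; rewrite gt_eqF.
  have vv : 1 - 2 * dl ^+ 2 <= v^-1 ^+ 2.
    have : 1 - dl ^+ 2 <= v^-1.
      rewrite -[leRHS]mul1r ler_pdivlMr// /v.
      have -> : (1 - dl ^+ 2) * (1 + dl ^+ 2) = 1 - (dl ^+ 2) ^+ 2 by ring.
      by have := sqr_ge0 (dl ^+ 2); lra.
    have := sqr_ge0 (1 - v^-1).
    have -> : (1 - v^-1) ^+ 2 = 1 - 2 * v^-1 + v^-1 ^+ 2 by ring.
    by lra.
  have y3 : 0 <= y ^+ 3 * e by rewrite mulr_ge0 ?exprn_ge0// ltW.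
  apply: le_trans (ler_wpM2l y3 vv).
  have -> : y ^+ 3 * e * (1 - 2 * dl ^+ 2) = y ^+ 3 * e - 2 * ((y * e) * (y ^+ 2 * dl ^+ 2)) by ring.
  have : (y * e) * (y ^+ 2 * dl ^+ 2) <= 1 by rewrite mulr_ile1// mulr_ge0.
  by lra.
have -> : y ^+ 2 / v * (1 - z / 2 + z ^+ 2) =
  y ^+ 2 / v - y ^+ 2 / v * (z / 2) + y ^+ 2 / v * z ^+ 2 by ring.
by lra.
Qed.

End elementary.

Section gaussian_half_line.
Context (R : realType).
Variables (x : R) (B : set R) (h1 h2 : R -> R).
Hypothesis mB : measurable B.
Hypothesis hE : forall u, expR (- (x * u)) * \1_B (u + x) = h1 u - h2 u.
Hypothesis h_le : forall u, expR (- (x * u)) * \1_B (u + x) <= expR (- (`|x| * `|u|)).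

Local Notation h := (fun u : R => expR (- (x * u)) * \1_B (u + x)).

Lemma half_line_weight_bound (u : R) : 0 <= h u <= 1.
Proof.
rewrite mulr_ge0 ?expR_ge0//=; apply: le_trans (h_le u) _.
by rewrite -[leRHS]expR0 ler_expR oppr_le0 mulr_ge0.
Qed.

Lemma measurable_half_line_weight : measurable_fun [set: R] h.
Proof.
have m1 : measurable_fun [set: R] (fun u : R => expR (- (x * u))).
  have m0 : measurable_fun [set: R] (fun u : R => - x * u).
    exact: (measurable_funM (measurable_cst _) (@measurable_id _ _ setT)).
  have -> : (fun u : R => expR (- (x * u))) = (fun u : R => expR (- x * u)).
    by apply/funext => u; rewrite mulNr.
  exact: (measurableT_comp (@measurable_expR R) m0).
have m2 : measurable_fun [set: R] (fun u : R => \1_B (u + x) : R).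
  have m3 : measurable_fun [set: R] (fun u : R => u + x) by exact: measurable_funD.
  have m4 : measurable_fun [set: R] (\1_B : R -> R) by exact: measurable_indic.
  exact: (measurableT_comp m4 m3).
exact: measurable_funM m1 m2.
Qed.

(** The weight is at most exp (- |x| |u|), of normal mean at most 2 / |x|. This gains the factor 1 +
    |x| that brings the error |x|^3 e of the change of measure down to x^2 e. *)
Lemma std_normal_half_line_weight : (1 + `|x|) * Ex (@std_normal R) h <= 3.
Proof.
have ih : L1 (@std_normal R) h.
  apply: (@L1_bnd _ _ _ _ _ 1); first exact: measurable_half_line_weight.
  by move=> u; have /andP[h0 hle1] := half_line_weight_bound u; rewrite ger0_norm.
have H1 : Ex (@std_normal R) h <= 1.
  rewrite -[leRHS](Ex_cst (@std_normal R)); apply: Ex_le ih (L1_cst _ _) _ => u.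
  by have /andP[] := half_line_weight_bound u.
have [x0|x0] := eqVneq x 0; first by rewrite {1}x0 normr0 addr0 mul1r (le_trans H1)//; lra.
have xp : 0 < `|x| by rewrite normr_gt0.
suff : `|x| * Ex (@std_normal R) h <= 2 by rewrite mulrDl mul1r; lra.
rewrite mulrC -ler_pdivlMr//; apply: le_trans (Ex_std_normal_expRN 0 xp).
apply: Ex_le ih _ _ => [|u]; last by rewrite subr0; exact: h_le.
apply: (@L1_bnd _ _ _ _ _ 1) => [|u].
  apply: measurableT_comp => //; apply: measurableT_comp => //.
  apply: measurable_funM => //; apply: measurableT_comp => //.
  exact: measurable_funB.
by rewrite ger0_norm ?expR_ge0// -[leRHS]expR0 ler_expR oppr_le0 mulr_ge0.
Qed.

Hypothesis mh1 : measurable_fun setT h1.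
Hypothesis mh2 : measurable_fun setT h2.
Hypothesis h1_dec : forall u v, u <= v -> h1 v <= h1 u.
Hypothesis h2_dec : forall u v, u <= v -> h2 v <= h2 u.
Hypothesis h1_01 : forall u, 0 <= h1 u <= 1.
Hypothesis h2_01 : forall u, 0 <= h2 u <= 1.

(** The weight is not monotone, but it is a difference of two nonincreasing functions with values in
    [0, 1], each compared at cost D. *)
Lemma Ex_half_line_comparison d (T : measurableType d) (Q : probability T R)
    (U : T -> R) (D : R) : measurable_fun setT U ->
  (forall y, `|fine (Q [set w | U w <= y]) - std_normal_cdf y| <= D) ->
  `|Ex Q (fun w => h (U w)) - Ex (@std_normal R) h| <= 2 * D.
Proof.
move=> mU UD.
have c1 := Ex_normal_comparison mU UD mh1 h1_dec h1_01.
have c2 := Ex_normal_comparison mU UD mh2 h2_dec h2_01.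
have i d' (T' : measurableType d') (Q' : probability T' R) (g : R -> R) (X : T' -> R) :
    measurable_fun setT g -> measurable_fun setT X -> (forall u, 0 <= g u <= 1) ->
    L1 Q' (fun w => g (X w)).
  move=> mg mX g01; apply: (@L1_bnd _ _ _ _ _ 1); first exact: (measurableT_comp mg mX).
  by move=> w; have /andP[? ?] := g01 (X w); rewrite ger0_norm.
have e1 : Ex Q (fun w => h (U w)) = Ex Q (fun w => h1 (U w)) - Ex Q (fun w => h2 (U w)).
  by rewrite -(ExB (i _ _ _ _ _ mh1 mU h1_01) (i _ _ _ _ _ mh2 mU h2_01)); apply: eq_Ex => w; exact: hE.
have mid : measurable_fun [set: R] (fun u : R => u) by [].
have e2 : Ex (@std_normal R) h = Ex (@std_normal R) h1 - Ex (@std_normal R) h2.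
  rewrite -(ExB (i _ _ (@std_normal R) _ _ mh1 mid h1_01) (i _ _ (@std_normal R) _ _ mh2 mid h2_01)).
  by apply: eq_Ex => u; exact: hE.
move: c1 c2; rewrite e1 e2.
move: (Ex Q (fun w => h1 (U w))) (Ex Q (fun w => h2 (U w))) (Ex (@std_normal R) h1) (Ex (@std_normal R) h2) => a b c g.
by rewrite !ler_norml => /andP[? ?] /andP[? ?]; apply/andP; split; lra.
Qed.

End gaussian_half_line.

Lemma sandwich_comparison (R : realType) (p E0 eA eM A M HQ Hg D : R) :
  0 < E0 -> 1 <= eA -> 0 <= eM <= 1 -> eA - 1 <= A * eA -> 1 - M <= eM -> A <= M ->
  0 <= M -> 0 <= Hg -> 0 <= D -> `|HQ - Hg| <= 2 * D -> p <= eA * E0 * HQ ->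
  eM * E0 * HQ <= p -> `|p - E0 * Hg| <= E0 * eA * (M * Hg + 2 * D).
Proof.
move=> E00 eA1 /andP[eM0 eM1] eAA MeM AM M0 Hg0 D0.
rewrite ler_norml => /andP[d1 d2] up lo.
have eA0 : 0 <= eA by lra.
rewrite ler_norml; apply/andP; split.
  rewrite lerNl opprB; apply: (@le_trans _ _ (E0 * (M * Hg + 2 * D))).
    rewrite lerBlDr -lerBlDl; apply: le_trans lo.
    rewrite -mulrBr [eM * E0]mulrC -mulrA ler_pM2l//.
    apply: (@le_trans _ _ (eM * (Hg - 2 * D))); last by rewrite ler_wpM2l//; lra.
    have := ler_wpM2r Hg0 MeM; have := ler_wpM2r D0 eM1.
    by rewrite mulrBr mulrBl mul1r [eM * (2 * D)]mulrCA; lra.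
  rewrite -mulrA ler_pM2l// ler_peMl// addr_ge0 ?mulr_ge0//.
rewrite lerBlDr; apply: le_trans up _.
have -> : eA * E0 * HQ = E0 * (eA * HQ) by ring.
rewrite -mulrA -mulrDr ler_pM2l//.
have h1 : eA * HQ <= eA * (Hg + 2 * D) by rewrite ler_wpM2l//; lra.
have h2 := ler_wpM2r Hg0 eAA.
have h3 : A * (eA * Hg) <= M * (eA * Hg) by rewrite ler_wpM2r// mulr_ge0.
have -> : eA * (M * Hg + 2 * D) = M * (eA * Hg) + eA * (2 * D) by ring.
move: h1 h2; rewrite mulrDr mulrBl mul1r -mulrA; lra.
Qed.

(** * Undoing the change of measure on a half-line *)

Section half_line_probability.
Context (R : realType) d (T : measurableType d) (P : probability T R).
Variables (n : nat) (F : nat -> set (set T)) (xi s : nat -> T -> R) (e dl x : R).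
Hypothesis BM : bernstein_martingale P n F xi s e dl.
Hypothesis xe_small : `|x| * e <= 1 / 1200.
Hypothesis x2e_small : x ^+ 2 * e <= 1.
Hypothesis xdl_small : x ^+ 2 * dl ^+ 2 <= 1.
Hypothesis te : `|x| * e < 1.
Variable m : nat -> T -> R.
Hypothesis cm : forall k, (k < n)%N ->
  is_cond_exp P (F k) (fun w => expR (x * xi k.+1 w)) (m k).
Hypothesis m_between : forall k w,
  1 + x ^+ 2 * Num.max 0 (1 / 2 - 576 * (`|x| * e)) * s k.+1 w <= m k w
    <= 1 + x ^+ 2 / (2 * (1 - `|x| * e)) * s k.+1 w.

Local Notation Z := (likelihood xi x m).
Local Notation Q := (tilted_probability BM te cm m_between).
Local Notation S := (mart_sum xi n).
Local Notation V := (mart_sum s n).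

Let Pi w := \prod_(0 <= i < n) m i w.
Let q := `|x| * e.
Let e_gt0 := bm_e BM.

Let q0 : 0 <= q. Proof. by rewrite mulr_ge0// ltW. Qed.

Let q_small : q <= 1 / 1200. Proof. exact: xe_small. Qed.

Let mxi k : (k < n)%N -> measurable_fun setT (xi k.+1).
Proof. by move=> kn; apply: (mwrt_meas (bm_sub BM kn) (bm_adapted BM kn)). Qed.

Let mS : measurable_fun setT S.
Proof.
rewrite /mart_sum; under eq_fun do rewrite big_add1 big_nat/=.
rewrite (_ : (fun w => _) = fun w => \sum_(i < n) xi i.+1 w).
  by apply: measurable_sum => i; exact: mxi.
by apply/funext => w; rewrite -(big_mkord xpredT (fun i => xi i.+1 w)) big_nat.
Qed.

Let mPi : measurable_fun setT Pi.
Proof.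
apply: (mwrt_meas (bm_sub BM (leqnn n))); apply: (mwrt_prod (bm_sigma BM (leqnn n))).
move=> i /andP[_ iN]; have [mi _ _] := cm iN; apply: (mwrt_sub mi).
by apply: (bm_filtration_sub BM); rewrite ltnW/=.
Qed.

Let Pi_gt0 w : 0 < Pi w.
Proof.
by apply: prodr_gt0 => i _; apply: lt_le_trans ltr01 (cond_expR_ge1 BM m_between i w).
Qed.

Let V_le w : V w <= 1 + dl ^+ 2 := bm_sum_le BM w.

Let V0 w : 0 <= V w.
Proof. by apply: sumr_ge0 => i _; exact: (bm_s_ge0 BM). Qed.

(** The product [Pi] times exp (- x^2 / 2) lies between exp (- M), almost surely, and exp A. The
    crude M suffices where it appears linearly; for [A] the sharper bound x^2 q / 2 + 2 is also
    needed, because exp A must fit under exp (- x_hat^2 / 2). *)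
Let M := 580 * (x ^+ 2 * q) + x ^+ 2 * dl ^+ 2.
Let A := x ^+ 2 / (2 * (1 - q)) * (1 + dl ^+ 2) - x ^+ 2 / 2.

Let x2q0 : 0 <= x ^+ 2 * q. Proof. by rewrite mulr_ge0// sqr_ge0. Qed.

Let x2d0 : 0 <= x ^+ 2 * dl ^+ 2. Proof. by rewrite mulr_ge0// sqr_ge0. Qed.

Let A_bound : [/\ 0 <= A, A <= M & A <= x ^+ 2 * q / 2 + 2].
Proof.
have h := q_small.
have -> : A = x ^+ 2 / 2 * ((q + dl ^+ 2) / (1 - q)).
  by rewrite /A; field; rewrite gt_eqF//; lra.
have qd0 : 0 <= q + dl ^+ 2 by rewrite addr_ge0// sqr_ge0.
have x20 : 0 <= x ^+ 2 / 2 by rewrite divr_ge0// sqr_ge0.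
have i0 : 0 < 1 - q by lra.
have up : (q + dl ^+ 2) / (1 - q) <= (q + dl ^+ 2) * (1 + 2 * q).
  apply: ler_wpM2l => //; rewrite -[leLHS]mul1r ler_pdivrMr//.
  have -> : (1 + 2 * q) * (1 - q) = 1 + q * (1 - 2 * q) by ring.
  by rewrite lerDl mulr_ge0//; lra.
have xq2 : x ^+ 2 * q ^+ 2 <= 1.
  rewrite [leLHS](_ : _ = (x ^+ 2 * e) ^+ 2); last first.
    by rewrite /q exprMn -(real_normK (num_real x)); ring.
  by rewrite exprn_ile1// mulr_ge0 ?sqr_ge0// ltW.
have E : x ^+ 2 / 2 * ((q + dl ^+ 2) * (1 + 2 * q)) =
    x ^+ 2 * q / 2 + x ^+ 2 * q ^+ 2 + x ^+ 2 * dl ^+ 2 / 2 + x ^+ 2 * dl ^+ 2 * q by field.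
have xdq : x ^+ 2 * dl ^+ 2 * q <= x ^+ 2 * dl ^+ 2 / 2.
  by rewrite ler_wpM2l//; lra.
have xqq : x ^+ 2 * q ^+ 2 <= x ^+ 2 * q.
  by rewrite expr2 mulrA ler_piMr//; lra.
have up2 := ler_wpM2l x20 up; rewrite E in up2.
have a0 : 0 <= x ^+ 2 / 2 * ((q + dl ^+ 2) / (1 - q)).
  by rewrite mulr_ge0// divr_ge0// ltW.
have h1 := x2q0; have h2 := x2d0; have h3 := xdl_small.
split=> //; apply: (le_trans up2); rewrite ?/M; move: xq2 xdq xqq h1 h2 h3;
  move: (x ^+ 2 * q) (x ^+ 2 * q ^+ 2) (x ^+ 2 * dl ^+ 2) (x ^+ 2 * dl ^+ 2 * q) => u v y z; lra.
Qed.

Let Pi_le w : Pi w * expR (- (x ^+ 2 / 2)) <= expR A.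
Proof.
rewrite expRD ler_wpM2r ?expR_ge0//; exact: (prod_cond_expR_le BM te m_between).
Qed.

Let Pi_ge w : 1 - dl ^+ 2 <= V w -> expR (- M) <= Pi w * expR (- (x ^+ 2 / 2)).
Proof.
move=> hV; have h := q_small.
pose k := 1 / 2 - 576 * q; have k0 : 0 <= k by rewrite /k; lra.
pose a i := x ^+ 2 * k * s i.+1 w.
have a0 i : 0 <= a i by exact: mulr_ge0 (mulr_ge0 (sqr_ge0 x) k0) (bm_s_ge0 BM _ _).
have ma i : 1 + a i <= m i w.
  have /andP[+ _] := m_between i w; rewrite -/q -/k; apply: le_trans.
  by rewrite max_r.
(* From k <= 1/2 and s <= 12 e^2. It turns the quadratic loss in 1 + a >= exp (a - a^2) into the
   relative loss 1 - 6 q^2, so the exponents sum to a multiple of the bracket. *)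
have a_le i : a i <= 6 * q ^+ 2.
  apply: (@le_trans _ _ (x ^+ 2 * (1 / 2) * (12 * e ^+ 2))).
    apply: ler_pM; rewrite ?(bm_s_ge0 BM) ?(bm_s_le BM)//; first by rewrite mulr_ge0// sqr_ge0.
    by rewrite ler_wpM2l ?sqr_ge0// /k; have := q0; lra.
  rewrite /q exprMn -(real_normK (num_real x)) le_eqVlt; apply/orP; left; apply/eqP.
  by field.
have step1 : expR ((1 - 6 * q ^+ 2) * (x ^+ 2 * k * V w)) <= Pi w.
  rewrite /mart_sum big_add1/= !mulr_sumr expR_sum; apply: ler_prod => i _.
  rewrite expR_ge0/=; apply: le_trans (ma i); apply: le_trans (expR_sub_sqr_le (a0 i)).
  rewrite ler_expR -/(a i) mulrBl mul1r lerD2l lerN2 [leLHS]expr2.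
  exact: ler_wpM2r.
have step2 : expR (- M + x ^+ 2 / 2) <= expR ((1 - 6 * q ^+ 2) * (x ^+ 2 * k * V w)).
  rewrite ler_expR.
  have x20 := sqr_ge0 x; have q20 := sqr_ge0 q.
  have qq : q ^+ 2 <= q / 1200 by rewrite expr2 [q / _]mulrC ler_wpM2r//; have := h; lra.
  have d0 := sqr_ge0 dl.
  apply: (@le_trans _ _ (x ^+ 2 * ((1 - 6 * q ^+ 2) * (k * (1 - dl ^+ 2))))); last first.
    rewrite [leRHS](_ : _ = x ^+ 2 * ((1 - 6 * q ^+ 2) * (k * V w))); last by ring.
    rewrite ler_wpM2l// ler_wpM2l ?ler_wpM2l//; lra.
  have -> : - M + x ^+ 2 / 2 = x ^+ 2 * (1 / 2 - 580 * q - dl ^+ 2).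
    by rewrite /M; move: (580 : R) => c; field.
  rewrite ler_wpM2l//.
  have k1 : (1 - 6 * q ^+ 2) * (k * (1 - dl ^+ 2)) =
     k * (1 - dl ^+ 2) - 6 * q ^+ 2 * (k * (1 - dl ^+ 2)) by ring.
  have k2 : k * (1 - dl ^+ 2) = k - k * dl ^+ 2 by ring.
  have k3 : k * dl ^+ 2 <= dl ^+ 2 by rewrite ler_piMl// /k; have := q0; lra.
  have k4 : 6 * q ^+ 2 * (k * (1 - dl ^+ 2)) <= 6 * q ^+ 2.
    have dl1 : 1 - dl ^+ 2 <= 1 by lra.
    apply: ler_piMr; first by rewrite mulr_ge0.
    apply: (@le_trans _ _ (k * 1)); first by rewrite ler_wpM2l.
    by rewrite mulr1 /k; have := q0; lra.
  rewrite k1 k2; move: k3 k4 qq q0; rewrite k2 /k; move: (q ^+ 2) (k * dl ^+ 2) => u v; lra.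
have -> : expR (- M) = expR (- M + x ^+ 2 / 2) * expR (- (x ^+ 2 / 2)).
  by rewrite -expRD addrK.
by rewrite ler_wpM2r ?expR_ge0// (le_trans step2).
Qed.

Let V_ge : {ae Q, forall w, 1 - dl ^+ 2 <= V w}.
Proof. exact: (tilted_sum_ge BM te cm m_between). Qed.

Let U w := S w - x.

Let mU : measurable_fun setT U. Proof. exact: measurable_funB. Qed.

Variable D : R.
Hypothesis TD : forall y, `|fine (Q [set w | mart_sum (fun k w => xi k w - x * s k w) n w <= y])
  - std_normal_cdf y| <= D.

Let Tn := mart_sum (fun k w => xi k w - x * s k w) n.

Let TnE w : Tn w = S w - x * V w.
Proof. by rewrite /Tn /mart_sum sumrB mulr_sumr. Qed.

Let mTn : measurable_fun setT Tn.
Proof.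
have AM := am_measurable_S.
have mV : measurable_fun setT V.
  rewrite /mart_sum; under eq_fun do rewrite big_add1 big_nat/=.
  rewrite (_ : (fun w => _) = fun w => \sum_(i < n) s i.+1 w).
    apply: measurable_sum => i; have [ms _ _] := bm_variance BM (ltn_ord i).
    exact: (mwrt_meas (bm_sub BM (ltnW (ltn_ord i)))).
  by apply/funext => w; rewrite -(big_mkord xpredT (fun i => s i.+1 w)) big_nat.
rewrite (_ : Tn = fun w => S w - x * V w); last exact/funext.
by apply: measurable_funB => //; exact: measurable_funM.
Qed.

(** The normal approximation concerns the sum centred by x V_n, whereas the tilt of the normal law
    is a translation by x. The two centrings differ by at most |x| dl^2 almost surely, and Phi is
    1-Lipschitz. *)
Let UD y : `|fine (Q [set w | U w <= y]) - std_normal_cdf y| <= D + `|x| * dl ^+ 2.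
Proof.
have close w : 1 - dl ^+ 2 <= V w -> `|U w - Tn w| <= `|x| * dl ^+ 2.
  move=> hV; rewrite TnE /U (_ : _ - _ = x * (V w - 1)); last by ring.
  by rewrite normrM ler_wpM2l// ler_norml; have := V_le w; lra.
have mset (X : T -> R) z : measurable_fun setT X -> measurable [set w | X w <= z].
  by move=> mX; exact: measurable_le.
have ineq (X Y : T -> R) z r : measurable_fun setT X -> measurable_fun setT Y ->
    {ae Q, forall w, Y w <= X w + r} ->
    fine (Q [set w | X w <= z]) <= fine (Q [set w | Y w <= z + r]).
  move=> mX mY XY; rewrite -!Ex_indic; [|exact: mset..].
  apply: Ex_le_ae; [by apply: L1_indic; exact: mset..|].
  apply: filterS XY => w h; rewrite !indicE.
  case: (boolP (w \in [set w | X w <= z])) => //; rewrite inE/= => hX.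
  by rewrite mem_set//= (le_trans h)// lerD2r.
have ae1 : {ae Q, forall w, Tn w <= U w + `|x| * dl ^+ 2}.
  by apply: filterS V_ge => w /close; rewrite ler_norml => /andP[]; lra.
have ae2 : {ae Q, forall w, U w <= Tn w + `|x| * dl ^+ 2}.
  by apply: filterS V_ge => w /close; rewrite ler_norml => /andP[]; lra.
have r0 : 0 <= `|x| * dl ^+ 2 by rewrite mulr_ge0// sqr_ge0.
have i1 := ineq U Tn y _ mU mTn ae1.
have i2 := ineq Tn U (y - `|x| * dl ^+ 2) _ mTn mU ae2; rewrite subrK in i2.
have l1 := std_normal_cdf_lipschitz (y + `|x| * dl ^+ 2) y.
have l2 := std_normal_cdf_lipschitz y (y - `|x| * dl ^+ 2).
have t1 := TD (y + `|x| * dl ^+ 2); have t2 := TD (y - `|x| * dl ^+ 2).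
rewrite -/Tn in t1 t2.
rewrite (_ : y + _ - y = `|x| * dl ^+ 2) in l1; last by ring.
rewrite (_ : y - (y - _) = `|x| * dl ^+ 2) in l2; last by ring.
rewrite (ger0_norm r0) in l1; rewrite (ger0_norm r0) in l2.
move: i1 i2 l1 l2 t1 t2; rewrite !ler_norml.
move=> ? ? /andP[? ?] /andP[? ?] /andP[? ?] /andP[? ?]; apply/andP; split; lra.
Qed.

Variables (B : set R) (h1 h2 : R -> R).
Hypothesis mB : measurable B.
Hypothesis hE : forall u, expR (- (x * u)) * \1_B (u + x) = h1 u - h2 u.
Hypothesis h_le : forall u, expR (- (x * u)) * \1_B (u + x) <= expR (- (`|x| * `|u|)).
Hypothesis mh1 : measurable_fun setT h1.
Hypothesis mh2 : measurable_fun setT h2.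
Hypothesis h1_dec : forall u v, u <= v -> h1 v <= h1 u.
Hypothesis h2_dec : forall u v, u <= v -> h2 v <= h2 u.
Hypothesis h1_01 : forall u, 0 <= h1 u <= 1.
Hypothesis h2_01 : forall u, 0 <= h2 u <= 1.

Local Notation h := (fun u : R => expR (- (x * u)) * \1_B (u + x)).

Lemma half_line_probability :
  `|fine (P [set w | B (S w)]) - fine (std_normal R B)| <=
  expR 5 * expR (- (x_hat e dl x ^+ 2 / 2)) *
    (M * Ex (@std_normal R) h + 2 * (D + `|x| * dl ^+ 2)).
Proof.
have mh := measurable_half_line_weight x mB.
have mhU : measurable_fun setT (fun w => h (U w)) by exact: (measurableT_comp mh mU).
have h01 := half_line_weight_bound h_le.
have mBS : measurable [set w | B (S w)] by have := mS measurableT mB; rewrite setTI.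
(* The inverse likelihood Pi exp (- x S) on the event. With S = U + x there is a factor exp (- x^2),
   split in two: one half normalizes [Pi], the other is the factor of [std_normal_tilt]. *)
pose f w := h (U w) * (Pi w * expR (- (x ^+ 2 / 2))) * expR (- (x ^+ 2 / 2)).
have mf : measurable_fun setT f.
  by apply: measurable_funM => //; apply: measurable_funM => //; exact: measurable_funM.
have Zf : (fun w => Z n w * f w) = \1_[set w | B (S w)].
  apply/funext => w; rewrite /f /U subrK.
  have -> : \1_B (S w) = \1_[set w | B (S w)] w :> R by [].
  have E := likelihoodE BM m_between n w; rewrite -/(Pi w) in E.
  have h : expR (- (x * (S w - x))) * expR (- (x ^+ 2 / 2)) * expR (- (x ^+ 2 / 2)) * expR (x * S w) = 1.
    by rewrite -!expRD -[RHS]expR0; congr expR; field.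
  have gen (a c z p i : R) : a * c * c * (z * p) = 1 -> z * (a * i * (p * c) * c) = i.
    by move=> k; rewrite -[RHS]mul1r -k; ring.
  by rewrite E in h; exact: gen.
have iZf : L1 P (fun w => Z n w * f w) by rewrite Zf; exact: L1_indic.
have iQf : L1 Q f.
  exact/(L1_probability_density (likelihood_ge0 BM m_between n)
    (likelihood_prob BM te cm m_between).1 (likelihood_prob BM te cm m_between).2 mf).
have EQf : Ex Q f = fine (P [set w | B (S w)]).
  rewrite (Ex_probability_density (likelihood_ge0 BM m_between n)
    (likelihood_prob BM te cm m_between).1 (likelihood_prob BM te cm m_between).2 mf iZf).
  by rewrite Zf Ex_indic.
have ihU : L1 Q (fun w => h (U w)).
  apply: (@L1_bnd _ _ _ _ _ 1) => // w; have /andP[? ?] := h01 (U w); by rewrite ger0_norm.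
pose E0 := expR (- (x ^+ 2 / 2)); have E00 : 0 < E0 by exact: expR_gt0.
have up : Ex Q f <= expR A * E0 * Ex Q (fun w => h (U w)).
  rewrite -(ExZ _ ihU); apply: Ex_le iQf (L1Z _ ihU) _ => w.
  rewrite /f -/E0 mulrAC [leRHS]mulrC [expR A * E0]mulrC [leRHS]mulrA.
  by apply: ler_wpM2l (Pi_le w); rewrite mulr_ge0 ?(ltW E00)//; have /andP[] := h01 (U w).
have lo : expR (- M) * E0 * Ex Q (fun w => h (U w)) <= Ex Q f.
  rewrite -(ExZ _ ihU); apply: Ex_le_ae (L1Z _ ihU) iQf _.
  apply: filterS V_ge => w hV.
  rewrite /f -/E0 [leRHS]mulrAC [leLHS]mulrC [expR (- M) * E0]mulrC [leLHS]mulrA.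
  by apply: ler_wpM2l (Pi_ge hV); rewrite mulr_ge0 ?(ltW E00)//; have /andP[] := h01 (U w).
have HQ := Ex_half_line_comparison hE mh1 mh2 h1_dec h2_dec h1_01 h2_01 mU UD.
have G : fine (std_normal R B) = E0 * Ex (@std_normal R) h by exact: std_normal_tilt.
have Hg0 : 0 <= Ex (@std_normal R) h by apply: Ex_ge0 => u; have /andP[] := h01 u.
have [A0 AM A2] := A_bound.
have D0 : 0 <= D + `|x| * dl ^+ 2 by exact: le_trans (normr_ge0 _) (UD 0).
have M0 : 0 <= M by exact: le_trans AM.
(* The terms x^2 q / 2 of [A] and of x_hat^2 / 2 cancel; 5 = 2 + 6 / 2. *)
have xh : E0 * expR A <= expR 5 * expR (- (x_hat e dl x ^+ 2 / 2)).
  rewrite -!expRD ler_expR.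
  have xe1 : `|x| * e <= 1 by have := q_small; rewrite -/q; lra.
  have [_] := x_hat_sqr_le e_gt0 xe1 x2e_small xdl_small.
  have -> : `|x| ^+ 3 * e = x ^+ 2 * q by rewrite /q -(real_normK (num_real x)); ring.
  by move: A2; lra.
have rhs0 : 0 <= M * Ex (@std_normal R) h + 2 * (D + `|x| * dl ^+ 2).
  by rewrite addr_ge0// mulr_ge0.
apply: le_trans (ler_wpM2r rhs0 xh).
rewrite -EQf G; have eA1 : 1 <= expR A by rewrite -expR0 ler_expR.
have eM : 0 <= expR (- M) <= 1 by rewrite expR_ge0 -expR0 ler_expR oppr_le0.
exact: (sandwich_comparison E00 eA1 eM (expR_sub1_le A) (expR_ge1Dx (- M)) AM M0 Hg0 D0 HQ up lo).
Qed.

End half_line_probability.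

(** * The conditional Bernstein condition *)

Lemma is_cond_exp_ae (R : realType) d (T : measurableType d) (P : probability T R)
    (G : set (set T)) (X Y Z : T -> R) : G `<=` measurable ->
  is_cond_exp P G X Y -> measurable_wrt G Z -> L1 P Z ->
  {ae P, forall w, Y w = Z w} -> is_cond_exp P G X Z.
Proof.
move=> Gm [mY iY EY] mZ iZ YZ; split=> // A GA; rewrite -EY//.
have mA := Gm _ GA; apply: ae_eq_integral => //.
- by apply: measurable_funTS; exact: measurable_int iZ.
- by apply: measurable_funTS; exact: measurable_int iY.
- by apply: filterS YZ => w /= -> _.
Qed.

Lemma minr_sub_bound (R : realDomainType) (a b c : R) : 0 <= b ->
  0 <= Num.min (a + b) c - Num.min a c <= b.
Proof.
move=> b0; rewrite subr_ge0 lerBlDr; apply/andP; split.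
  by rewrite le_min !ge_min lexx orbT andbT lerDl b0.
rewrite addr_minr le_min; have [ac|ca] := leP (a + b) c.
  by rewrite [b + a]addrC lexx/= (le_trans ac)// lerDr.
by rewrite lerDr b0 andbT addrC ltW.
Qed.

Section bernstein_condition.
Context (R : realType) d (T : measurableType d) (P : probability T R).
Variables (n : nat) (F : nat -> set (set T)) (xi : nat -> T -> R) (e dl : R).
Hypothesis MD : martingale_differences P n F xi.
Hypothesis ixi : forall i k : nat, (1 <= i <= n)%N ->
  P.-integrable setT (EFin \o (fun w => xi i w ^+ k)).
Hypothesis e_gt0 : 0 < e.
Hypothesis moments : forall k i : nat, (2 <= k)%N -> (1 <= i <= n)%N ->
  {ae P, forall w, `|cond_moment P F xi k i w|
    <= 1 / 2 * k`!%:R * e ^+ (k - 2) * cond_moment P F xi 2 i w}.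
Hypothesis dl01 : 0 <= dl <= 1.
Hypothesis bracket : {ae P, forall w, `|quad_char P F xi n w - 1| <= dl ^+ 2}.

Let sF k (kn : (k <= n)%N) : sigma_algebra setT (F k) := (md_sigma_algebra MD kn).1.
Let Fm k (kn : (k <= n)%N) : F k `<=` measurable := (md_sigma_algebra MD kn).2.

Let ix k p : (k < n)%N -> L1 P (fun w => xi k.+1 w ^+ p).
Proof. by move=> kn; apply: ixi. Qed.

Let cmP k p (kn : (k < n)%N) :
  is_cond_exp P (F k) (fun w => xi k.+1 w ^+ p) (cond_moment P F xi p k.+1) :=
  cond_expP (sF (ltnW kn)) (Fm (ltnW kn)) (ix p kn).

Let moment_le k p A : (k < n)%N -> (2 <= p)%N -> F k A ->
  `|Ex P (fun w => \1_A w * xi k.+1 w ^+ p)|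
    <= 1 / 2 * p`!%:R * e ^+ (p - 2) * Ex P (fun w => \1_A w * xi k.+1 w ^+ 2).
Proof.
move=> kn p2 FA; have Gm := Fm (ltnW kn); have mA := Gm _ FA.
rewrite (is_cond_exp_Ex Gm (ix p kn) (cmP p kn) FA) (is_cond_exp_Ex Gm (ix 2 kn) (cmP 2 kn) FA).
have ip := L1_indicM mA (is_cond_exp_L1 (cmP p kn)).
have i2 := L1_indicM mA (is_cond_exp_L1 (cmP 2 kn)).
rewrite -(ExZ _ i2); apply: le_trans (Ex_abs ip) _.
apply: Ex_le_ae (L1_abs ip) (L1Z _ i2) _.
have /filterS : {ae P, forall w, `|cond_moment P F xi p k.+1 w|
    <= 1 / 2 * p`!%:R * e ^+ (p - 2) * cond_moment P F xi 2 k.+1 w} by exact: moments.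
apply=> w h; rewrite normrM mulrCA.
have i0 : 0 <= \1_A w :> R by [].
by rewrite (ger0_norm i0) ler_wpM2l.
Qed.

Lemma exists_variance : exists s0 : nat -> T -> R,
  (forall k, (k < n)%N -> is_cond_exp P (F k) (fun w => xi k.+1 w ^+ 2) (s0 k)) /\
  forall k w, 0 <= s0 k w <= 12 * e ^+ 2.
Proof.
have e2 : 0 <= 12 * e ^+ 2 by rewrite mulr_ge0// sqr_ge0.
have /choice[s0 h] : forall k, exists s : T -> R,
    ((k < n)%N -> is_cond_exp P (F k) (fun w => xi k.+1 w ^+ 2) s) /\
    forall w, 0 <= s w <= 12 * e ^+ 2.
  move=> k; have [kn|_] := ltnP k n; last by exists (fun=> 0); split=> // w; rewrite lexx e2.
  have [|s [cs sb]] := cond_variance_between (sF (ltnW kn)) (Fm (ltnW kn)) e_gt0 (fun p => ix p kn).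
    move=> A FA; apply: le_trans (ler_norm _) _.
    apply: le_trans (moment_le kn (isT : (2 <= 4)%N) FA) _.
    have -> : 1 / 2 * 4`!%:R * e ^+ (4 - 2) = 12 * e ^+ 2 :> R.
      by rewrite (_ : 4`! = 24)%N//= subSS subSS subn0; congr (_ * _); field.
    by [].
  by exists s.
by exists s0; split=> k; [exact: (h k).1|exact: (h k).2].
Qed.

Lemma bernstein_martingale_intro :
  exists s, bernstein_martingale P n F xi s e dl.
Proof.
have [s0 [cs s0b]] := exists_variance.
pose V k w := \sum_(0 <= i < k) s0 i w.
pose c := 1 + dl ^+ 2; have c0 : 0 <= c by rewrite addr_ge0// sqr_ge0.
(* Truncating the bracket at c changes it on a null set only, and makes the upper bound hold everywhere. *)
pose s k w := if k is k'.+1 then Num.min (V k'.+1 w) c - Num.min (V k' w) c else 0.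
have s00 k w : 0 <= s0 k w by have /andP[] := s0b k w.
have VS k w : V k.+1 w = V k w + s0 k w by rewrite /V big_nat_recr.
have sb k w : 0 <= s k w <= 12 * e ^+ 2.
  case: k => [|k]; first by rewrite lexx mulr_ge0// sqr_ge0.
  rewrite /s VS; have /andP[-> h] := minr_sub_bound (V k w) c (s00 k w).
  by have /andP[_] := s0b k w; exact: le_trans.
have sumE k w : mart_sum s k w = Num.min (V k w) c.
  elim: k => [|k ih]; first by rewrite mart_sum0 /V big_geq// min_l.
  by rewrite mart_sumS ih /s addrC subrK.
have Fsub k j : (k <= j <= n)%N -> F k `<=` F j := filtration_sub (md_filtration MD) (j := j).
have mV k j : (k <= j.+1)%N -> (j < n)%N -> measurable_wrt (F j) (V k).
  move=> kj jn; apply: (mwrt_sum (sF (ltnW jn))) => i /andP[_ ik].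
  have ij : (i <= j)%N by rewrite -ltnS (leq_trans ik).
  have [ms _ _] := cs _ (leq_ltn_trans ij jn).
  by apply: (mwrt_sub ms); apply: Fsub; rewrite ij ltnW.
have ms k : (k < n)%N -> measurable_wrt (F k) (s k.+1).
  move=> kn; have sG := sF (ltnW kn).
  by apply: (mwrtB sG); apply: (mwrt_min sG); rewrite ?mwrt_cst//; try exact: mV; exact: mwrt_cst.
have aeV : {ae P, forall w, `|V n w - 1| <= dl ^+ 2}.
  (* Two versions agree off a null set for each k; a countable union of null sets makes them agree
     for all k at once, so the bracket hypothesis applies to [V]. *)
  have h : {ae P, forall w, forall k, (k < n)%N -> cond_moment P F xi 2 k.+1 w = s0 k w}.
    apply: ae_foralln => k; have [kn|_] := ltnP k n; last exact/aeW.
    apply: filterS (is_cond_exp_ae_eq (sF (ltnW kn)) (Fm (ltnW kn)) (cmP 2 kn) (cs k kn)).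
    by move=> w + _.
  apply: filterS2 h bracket => w h; rewrite /quad_char big_add1/=.
  have -> // : \sum_(0 <= i < n) cond_moment P F xi 2 i.+1 w = V n w.
  by rewrite /V !big_nat; apply: eq_bigr => i /andP[_ iN]; exact: h.
have Vhomo j k w : (j <= k)%N -> V j w <= V k w.
  elim: k => [|k ih]; first by rewrite leqn0 => /eqP ->.
  rewrite leq_eqVlt => /predU1P[->//|]; rewrite ltnS => /ih h.
  by rewrite VS (le_trans h)// lerDl.
have aes k : (k < n)%N -> {ae P, forall w, s0 k w = s k.+1 w}.
  move=> kn; apply: filterS aeV => w; rewrite ler_norml => /andP[_ h].
  have Vc j : (j <= n)%N -> V j w <= c by move=> /(Vhomo _ _ w) hj; rewrite /c; lra.
  by rewrite /s !min_l ?Vc// 1?ltnW// VS addrC addKr.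
have cs' k : (k < n)%N -> is_cond_exp P (F k) (fun w => xi k.+1 w ^+ 2) (s k.+1).
  move=> kn; apply: (is_cond_exp_ae (Fm (ltnW kn)) (cs k kn) (ms k kn)) (aes k kn).
  apply: (@L1_bnd _ _ _ _ _ (12 * e ^+ 2)); first exact: (mwrt_meas (Fm (ltnW kn)) (ms k kn)).
  by move=> w; have /andP[? ?] := sb k.+1 w; rewrite ger0_norm.
exists s; split=> //.
- by move=> k kn; exact: (md_filtration MD).
- by move=> k kn; exact: (md_adapted MD).
- move=> k kn; have h := cond_expP (sF (ltnW kn)) (Fm (ltnW kn)) (md_integrable MD kn).
  apply: (is_cond_exp_ae (Fm (ltnW kn)) h); first exact: mwrt_cst (sF (ltnW kn)) 0.
    exact: L1_cst.
  exact: (md_cond_exp0 MD (i := k.+1)).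
- move=> k p A kn p2 FA.
  by rewrite -(is_cond_exp_Ex (Fm (ltnW kn)) (ix 2 kn) (cs' k kn) FA) moment_le.
- by move=> k w; have /andP[] := sb k w.
- by move=> k w; have /andP[] := sb k w.
- by move=> w; rewrite sumE ge_min lexx orbT.
- apply: filterS aeV => w; rewrite ler_norml sumE le_min => /andP[h1 h2].
  by apply/andP; split; rewrite ?/c; have := sqr_ge0 dl; lra.
Qed.

End bernstein_condition.

(** * The theorem *)

Lemma x_hat_le (R : realType) (e dl x : R) : 0 < e -> x_hat e dl x ^+ 2 <= x ^+ 2.
Proof.
move=> e0; rewrite -[leRHS](real_normK (num_real x)) /x_hat; set y := `|x|.
have y0 : 0 <= y by exact: normr_ge0.
have v1 : 1 <= 1 + dl ^+ 2 by rewrite lerDl sqr_ge0.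
have w1 : 1 <= Num.sqrt (1 + dl ^+ 2) by rewrite -[leLHS]sqrtr1 ler_sqrt; lra.
have z0 : 0 <= 2 * y * e / (1 + dl ^+ 2) by rewrite divr_ge0 ?mulr_ge0//; lra.
have r1 : 1 <= Num.sqrt (1 + 2 * y * e / (1 + dl ^+ 2)) by rewrite -[leLHS]sqrtr1 ler_sqrt; lra.
move: w1 r1; move: (Num.sqrt _) (Num.sqrt _) => r v hv hr.
rewrite ler_pXn2r ?nnegrE//; last by rewrite !divr_ge0 ?mulr_ge0//; lra.
rewrite ler_pdivrMr; last lra.
rewrite ler_pdivrMr; last lra.
have : y * 1 <= y * v by rewrite ler_wpM2l.
have : 0 <= y * v * (r - 1) by rewrite !mulr_ge0//; lra.
have -> : y * v * (r - 1) = y * (1 + r) * v - 2 * (y * v) by ring.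
lra.
Qed.

(** Only arithmetic remains: x^2 H <= 3 |x| lowers [M H] by one power of |x|, the bound 1 <= 2 L
    turns e into e L, and dl <= 2 (1 + x^2) dl / (1 + |x|). *)
Lemma half_line_error (R : realType) (C x e L dl M D H : R) :
  0 <= C -> 0 <= e -> 0 <= dl -> 1 <= 2 * L -> (1 + `|x|) * dl <= 1 -> 0 <= H ->
  (1 + `|x|) * H <= 3 ->
  M = 580 * (x ^+ 2 * (`|x| * e)) + x ^+ 2 * dl ^+ 2 ->
  D <= C * (e * L + 144 * (5 * x ^+ 2 * e) + 144 * (7 * (`|x| * e)) * L + dl) ->
  M * H + 2 * (D + `|x| * dl ^+ 2)
    <= (8000 * C + 8000) * ((1 + x ^+ 2) * (e * L + dl / (1 + `|x|))).
Proof.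
move=> C0 e0 dl0 L2 xdl H0 xH -> hD.
rewrite -(real_normK (num_real x)) in hD *.
move: xdl xH hD; have := normr_ge0 x; move: (`|x|) => y y0 ydl yH hD.
have y20 := sqr_ge0 y.
have L0 : 0 <= L by lra.
have eL0 : 0 <= e * L by exact: mulr_ge0.
pose G := (1 + y ^+ 2) * (e * L); have G0 : 0 <= G by apply: mulr_ge0 => //; lra.
have yle : 2 * y <= 1 + y ^+ 2.
  have := sqr_ge0 (y - 1); have -> : (y - 1) ^+ 2 = y ^+ 2 - 2 * y + 1 by ring.
  lra.
have e2 : y ^+ 2 * e <= 2 * G.
  apply: (@le_trans _ _ (y ^+ 2 * (2 * (e * L)))).
    by rewrite ler_wpM2l// mulrCA ler_peMr.
  by rewrite /G mulrCA ler_pM2l// ler_wpM2r//; lra.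
have hG : e * L <= G by rewrite /G ler_peMl//; lra.
have yG : 2 * (y * (e * L)) <= G by rewrite mulrA /G ler_wpM2r.
have dG : dl <= 2 * ((1 + y ^+ 2) * (dl / (1 + y))).
  have -> : 2 * ((1 + y ^+ 2) * (dl / (1 + y))) = dl * (2 * (1 + y ^+ 2) / (1 + y)).
    by move: (y ^+ 2) => u; field; rewrite gt_eqF//; lra.
  rewrite ler_peMr// ler_pdivlMr ?mul1r; lra.
set G2 := (1 + y ^+ 2) * (dl / (1 + y)) in dG.
have -> : (1 + y ^+ 2) * (e * L + dl / (1 + y)) = G + G2 by rewrite mulrDr.
have yd : y * dl ^+ 2 <= dl.
  rewrite expr2 mulrA ler_piMl//; apply: le_trans ydl; rewrite ler_wpM2r//; lra.
have yH2 : y ^+ 2 * H <= 3 * y.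
  by rewrite expr2 -mulrA [leRHS]mulrC ler_wpM2l//; apply: le_trans yH; rewrite ler_wpM2r//; lra.
have m1 : (580 * (y ^+ 2 * (y * e)) + y ^+ 2 * dl ^+ 2) * H <= 580 * (3 * (y ^+ 2 * e)) + 3 * dl.
  have -> : (580 * (y ^+ 2 * (y * e)) + y ^+ 2 * dl ^+ 2) * H =
      580 * (y * e * (y ^+ 2 * H)) + dl ^+ 2 * (y ^+ 2 * H).
    by move: (580 : R) => c; ring.
  apply: lerD.
    rewrite ler_pM2l//; apply: le_trans (ler_wpM2l (mulr_ge0 y0 e0) yH2) _.
    by rewrite le_eqVlt; apply/orP; left; apply/eqP; ring.
  apply: le_trans (ler_wpM2l (sqr_ge0 dl) yH2) _.
  by rewrite mulrCA [dl ^+ 2 * y]mulrC ler_pM2l.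
have dL : 144 * (5 * y ^+ 2 * e) <= 144 * (10 * G).
  by rewrite ler_pM2l// -mulrA; lra.
have bL : 144 * (7 * (y * e)) * L <= 144 * (4 * G).
  rewrite -mulrA ler_pM2l//.
  have -> : 7 * (y * e) * L = 7 * (y * (e * L)) by ring.
  lra.
have h3 : D <= C * (144 * (15 * G) + 2 * G2).
  apply: le_trans hD _; rewrite ler_wpM2l//.
  by move: hG dL bL dG G0; move: (144 * (5 * y ^+ 2 * e)) (144 * (7 * (y * e)) * L) => u v *; lra.
have G20 : 0 <= G2.
  by apply: mulr_ge0; [lra|apply: divr_ge0 => //; lra].
have CG := mulr_ge0 C0 G0; have CG2 := mulr_ge0 C0 G20.
have gen (c : R) : (c * C + c) * (G + G2) = c * (C * G) + c * (C * G2) + c * G + c * G2 by ring.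
have gen2 (c : R) : C * (c * (15 * G) + 2 * G2) = c * (15 * (C * G)) + 2 * (C * G2) by ring.
rewrite gen2 in h3; rewrite gen; move: m1 h3 yd dG e2 G0 CG CG2 G20.
move: ((580 * (y ^+ 2 * (y * e)) + y ^+ 2 * dl ^+ 2) * H) (C * G) (C * G2) (y * dl ^+ 2) (y ^+ 2 * e) => t1 t2 t3 t4 t5.
lra.
Qed.

Section region.
Context (R : realType) d (T : measurableType d) (P : probability T R).
Variables (n : nat) (F : nat -> set (set T)) (xi s : nat -> T -> R) (e dl x : R).
Hypothesis BM : bernstein_martingale P n F xi s e dl.
Local Notation S := (mart_sum xi n).
Local Notation Phi := (@std_normal_cdf R).

Lemma measurable_bm_sum : measurable_fun setT S.
Proof.
apply: (mwrt_meas (bm_sub BM (leqnn n))); apply: (mwrt_sum (bm_sigma BM (leqnn n))).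
case=> // i; rewrite !ltnS => /andP[_ iN].
by apply: (mwrt_sub (bm_adapted BM iN)); apply: (bm_filtration_sub BM); rewrite iN/=.
Qed.

Lemma half_line_ge (B : set R) : 0 <= x -> B = `]x, +oo[%classic ->
  `|fine (P [set w | S w <= x]) - Phi x| = `|fine (P [set w | B (S w)]) - fine (std_normal R B)|.
Proof.
move=> x0 ->; rewrite std_normal_ccdf.
have mA := measurable_le x measurable_bm_sum.
have -> : [set w | `]x, +oo[%classic (S w)] = ~` [set w | S w <= x].
  by apply/seteqP; split=> w /=; rewrite in_itv/= andbT ltNge; move/negP.
rewrite probability_setC// fineB ?fin_num_measure//=.
by rewrite -normrN; congr `|_|; ring.
Qed.

(** The half-line is the one that points away from 0, namely {S > x} for x >= 0 and {S <= x} for x <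
    0, so that the weight exp (- x u) decays on it. Capping the exponential at u = 0 makes it
    monotone; the indicator of {u <= 0} then supplies the other monotone part of the difference. *)
Lemma half_line_decomposition : exists (B : set R) (h1 h2 : R -> R),
  [/\ measurable B,
      `|fine (P [set w | S w <= x]) - Phi x| = `|fine (P [set w | B (S w)]) - fine (std_normal R B)|,
      (forall u, expR (- (x * u)) * \1_B (u + x) = h1 u - h2 u) /\
      (forall u, expR (- (x * u)) * \1_B (u + x) <= expR (- (`|x| * `|u|))),
      [/\ measurable_fun setT h1, forall u v, u <= v -> h1 v <= h1 u & forall u, 0 <= h1 u <= 1] &
      [/\ measurable_fun setT h2, forall u v, u <= v -> h2 v <= h2 u & forall u, 0 <= h2 u <= 1]].
Proof.
pose k (u : R) : R := \1_[set u : R | u <= 0] u.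
have kE u : k u = (u <= 0)%R%:R by rewrite /k indicE mem_setE.
have mk : measurable_fun [set: R] k.
  by apply: measurable_indic; exact: (@measurable_le R _ _ (fun u => u)).
have kdec u v : u <= v -> k v <= k u.
  by move=> uv; rewrite !kE; case: (leP v 0) => // v0; rewrite (le_trans uv v0).
have k01 u : 0 <= k u <= 1 by rewrite kE; case: (u <= 0); rewrite ?lexx ?ler01.
have [x0|x0] := leP 0 x.
  pose h (u : R) := expR (- (x * Num.max u 0)).
  exists `]x, +oo[%classic, h, k; split=> //.
  - exact: half_line_ge.
  - have E u : \1_(`]x, +oo[%classic) (u + x) = (0 < u)%R%:R :> R.
      by rewrite indicE mem_setE in_itv/= andbT ltrDr.
    split=> u; rewrite E ?kE /h; have [u0|u0] := ltP 0 u.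
    + by rewrite mulr1 subr0.
    + by rewrite !mulr0 oppr0 expR0 subrr.
    + by rewrite mulr1 (ger0_norm x0) (gtr0_norm u0).
    + by rewrite mulr0 expR_ge0.
  - split.
    + apply: (measurableT_comp (@measurable_expR R)).
      apply: (measurableT_comp (@oppr_measurable R setT)).
      by apply: measurable_funM => //; exact: measurable_maxr.
    + move=> u v uv; rewrite ler_expR lerN2 ler_wpM2l//.
      by rewrite ge_max !le_max uv lexx orbT.
    + move=> u; rewrite expR_ge0 -expR0 ler_expR oppr_le0 mulr_ge0//.
      by rewrite le_max lexx orbT.
pose h (u : R) := 1 - expR (- (x * Num.min u 0)).
exists `]-oo, x]%classic, k, h; split=> //.
- have E u : \1_(`]-oo, x]%classic) (u + x) = (u <= 0)%R%:R :> R.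
    by rewrite indicE mem_setE in_itv/= gerDr.
  split=> u; rewrite E ?kE /h; have [u0|u0] := leP u 0.
  + by rewrite mulr1 subKr.
  + by rewrite !mulr0 oppr0 expR0 !subrr.
  + by rewrite mulr1 -normrM ger0_norm// mulr_le0// ltW.
  + by rewrite mulr0 expR_ge0.
- split.
  + apply: measurable_funB => //; apply: (measurableT_comp (@measurable_expR R)).
    apply: (measurableT_comp (@oppr_measurable R setT)).
    by apply: measurable_funM => //; exact: measurable_minr.
  + move=> u v uv; rewrite lerD2l lerN2 ler_expR lerN2 ler_wnM2l ?(ltW x0)//.
    by rewrite le_min !ge_min uv lexx orbT.
  + move=> u; rewrite subr_ge0 -{1}expR0 ler_expR oppr_le0 gerBl expR_ge0 andbT.
    by rewrite mulr_le0 ?(ltW x0)// ge_min lexx orbT.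
Qed.

(** Valid for every x: on the half-line away from 0 the two probabilities are bounded separately,
    using x_hat^2 <= x^2 for the normal one. *)
Lemma tail_bound : `|fine (P [set w | S w <= x]) - Phi x|
  <= 2 * expR (- (x_hat e dl x ^+ 2 / 2)).
Proof.
have xx : expR (- (x ^+ 2 / 2)) <= expR (- (x_hat e dl x ^+ 2 / 2)).
  by rewrite ler_expR lerN2 ler_pM2r// x_hat_le// (bm_e BM).
have mA := measurable_le x measurable_bm_sum.
have p0 := prob_ge0 P.
have [x0|x0] := leP 0 x.
  rewrite (half_line_ge x0 erefl) std_normal_ccdf.
  have t1 := std_normal_ccdf_tail x0.
  have mB : measurable [set w | `]x, +oo[%classic (S w)].
    by have := measurable_bm_sum measurableT (measurable_itv `]x, +oo[); rewrite setTI.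
  have t2 : fine (P [set w | `]x, +oo[%classic (S w)]) <= expR (- (x_hat e dl x ^+ 2 / 2)).
    apply: (bernstein_tail BM mB (normr1 _)) => w /=; rewrite in_itv/= andbT => h.
    by rewrite mul1r ger0_norm// ltW.
  have := p0 [set w | `]x, +oo[%classic (S w)]; have := std_normal_cdf_le1 x.
  by move=> ? ?; rewrite ler_norml; apply/andP; split; lra.
have t1 := std_normal_cdf_tail (ltW x0).
have t2 : fine (P [set w | S w <= x]) <= expR (- (x_hat e dl x ^+ 2 / 2)).
  apply: (bernstein_tail BM mA (_ : `|-1| = 1)) => [|w /= h]; first by rewrite normrN normr1.
  by rewrite mulN1r ltr0_norm// lerN2.
have := p0 [set w | S w <= x]; have := std_normal_cdf_ge0 x.
by move=> ? ?; rewrite ler_norml; apply/andP; split; lra.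
Qed.


(** The normal approximation is a hypothesis quantified over all spaces, since it is applied to the
    tilted probability. The threshold 1/1500 yields x^2 e <= 2/1500 and hence 144 * 5 x^2 e <= 1,
    the most demanding smallness condition. *)
Lemma region_bound (C : R) : 0 < C ->
  (forall d (T : measurableType d) (Q : probability T R) n F eta s e dl al be,
    e <= 1 / 2 -> approx_martingale Q n F eta s e dl al be (144 * 18) ->
    {ae Q, forall w, 1 - dl ^+ 2 <= mart_sum s n w} ->
    forall y, `|fine (Q [set w | mart_sum eta n w <= y]) - std_normal_cdf y|
      <= C * (e * `|ln e| + al + be * `|ln e| + dl)) ->
  e <= 1 / 2 -> (1 + x ^+ 2) * (e * `|ln e|) <= 1 / 1500 -> (1 + `|x|) * dl <= 1 / 1500 ->
  `|fine (P [set w | S w <= x]) - Phi x|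
    <= expR 5 * expR (- (x_hat e dl x ^+ 2 / 2)) *
       ((8000 * C + 8000) * ((1 + x ^+ 2) * (e * `|ln e| + dl / (1 + `|x|)))).
Proof.
move=> C0 BE e2 r1 r2; have e0 := bm_e BM; have /andP[dl0 dl1] := bm_dl BM.
have L2 := ln_half_ge (introT andP (conj e0 e2)).
set L := `|ln e| in L2 r1 *.
have x20 := sqr_ge0 x; have x0 := normr_ge0 x.
have x2E := real_normK (num_real x).
have eL : e <= 2 * (e * L) by rewrite mulrCA ler_peMr// ltW.
have xle : 2 * `|x| <= 1 + x ^+ 2.
  rewrite -x2E; have := sqr_ge0 (`|x| - 1).
  have -> : (`|x| - 1) ^+ 2 = `|x| ^+ 2 - 2 * `|x| + 1 by ring.
  lra.
have ge : (1 + x ^+ 2) * e <= 2 * ((1 + x ^+ 2) * (e * L)).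
  by rewrite mulrCA ler_wpM2l//; lra.
have x2e : x ^+ 2 * e <= 2 / 1500.
  have : x ^+ 2 * e <= (1 + x ^+ 2) * e by rewrite ler_wpM2r ?(ltW e0)//; lra.
  lra.
have xe : `|x| * e <= 1 / 1200.
  have : 2 * `|x| * e <= (1 + x ^+ 2) * e by rewrite ler_wpM2r// ltW.
  rewrite -mulrA; lra.
have te : `|x| * e < 1 by lra.
have l2e : 144 * (5 * x ^+ 2 * e) <= 1.
  by rewrite -[5 * _ * _]mulrA; lra.
have x2e1 : x ^+ 2 * e <= 1 by lra.
have xd : `|x| * dl <= 1.
  have : `|x| * dl <= (1 + `|x|) * dl by rewrite ler_wpM2r//; lra.
  lra.
have xdl : x ^+ 2 * dl ^+ 2 <= 1.
  by rewrite -x2E -exprMn exprn_ile1// mulr_ge0.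
have [m [cm mb]] := bm_cond_expR BM te.
have TD := BE _ _ _ _ _ _ _ _ _ _ _ e2 (tilted_approx_martingale BM xe l2e te cm mb)
  (tilted_sum_ge BM te cm mb).
have [B [h1 [h2 [mB -> [hE h_le] [mh1 d1 b1] [mh2 d2 b2]]]]] := half_line_decomposition.
apply: le_trans (@half_line_probability _ _ _ _ _ _ _ _ _ _ _ BM xe x2e1 xdl te m cm mb _ TD
  B h1 h2 mB hE h_le mh1 mh2 d1 d2 b1 b2) _.
rewrite ler_wpM2l ?mulr_ge0 ?expR_ge0//.
have H0 : 0 <= Ex (@std_normal R) (fun u => expR (- (x * u)) * \1_B (u + x)).
  by apply: Ex_ge0 => u; rewrite mulr_ge0 ?expR_ge0.
have r21 : (1 + `|x|) * dl <= 1 by lra.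
exact: (half_line_error (ltW C0) (ltW e0) dl0 L2 r21 H0 (std_normal_half_line_weight mB h_le) erefl (lexx _)).
Qed.

End region.

Theorem theorem2p1 (R : realType) :
  exists C : R, 0 < C /\
  forall (d : measure_display) (T : measurableType d) (P : probability T R)
    (n : nat) (F : nat -> set (set T)) (xi : nat -> T -> R) (eps delta : R),
  (1 <= n)%N ->
  martingale_differences P n F xi ->
  (forall i k : nat, (1 <= i <= n)%N ->
     P.-integrable setT (EFin \o (fun w => xi i w ^+ k))) ->
  0 < eps <= 1 / 2 ->
  (forall k i : nat, (2 <= k)%N -> (1 <= i <= n)%N ->
     {ae P, forall w,
        `|cond_moment P F xi k i w|
          <= 1 / 2 * k`!%:R * eps ^+ (k - 2) * cond_moment P F xi 2 i w}) ->
  0 <= delta <= 1 ->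
  {ae P, forall w, `|quad_char P F xi n w - 1| <= delta ^+ 2} ->
  forall x : R,
    `|fine (P [set w | mart_sum xi n w <= x]) - std_normal_cdf x|
      <= C * (1 + x ^+ 2) * (eps * `|ln eps| + delta / (1 + `|x|))
           * expR (- (x_hat eps delta x ^+ 2 / 2)).
Proof.
have K0 : 0 <= 144 * 18 :> R by exact: mulr_ge0 (ler0n _ _) (ler0n _ _).
have [C [C0 BE]] := am_berry_esseen K0.
have [K1 K10 RB] : exists2 K1 : R, 0 <= K1 &
    forall d (T : measurableType d) (P : probability T R) n F xi s e dl x,
      bernstein_martingale P n F xi s e dl -> e <= 1 / 2 ->
      (1 + x ^+ 2) * (e * `|ln e|) <= 1 / 1500 -> (1 + `|x|) * dl <= 1 / 1500 ->
      `|fine (P [set w | mart_sum xi n w <= x]) - std_normal_cdf x|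
        <= expR 5 * expR (- (x_hat e dl x ^+ 2 / 2)) *
           (K1 * ((1 + x ^+ 2) * (e * `|ln e| + dl / (1 + `|x|)))).
  exists (8000 * C + 8000); first exact: addr_ge0 (mulr_ge0 (ler0n _ _) (ltW C0)) (ler0n _ _).
  by move=> d T P n F xi s e dl x BM; exact: (region_bound BM C0 BE).
(* Where [G] is not small, [tail_bound] suffices: its factor 2 is absorbed by a multiple of [G]. *)
have scale_up (c : R) : 0 < c -> exists2 K2 : R, 0 < K2 & forall G, c <= G -> 2 <= K2 * G.
  move=> c0; exists (2 / c) => [|G hG]; first exact: divr_gt0.
  by rewrite mulrAC ler_pdivlMr// ler_pM2l.
(* Half of the threshold 1/1500: since (1 + |x|)^2 <= 2 (1 + x^2), the part of [G] containing delta
   is at least half of (1 + |x|) delta. *)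
have c0 : 0 < 1 / 3000 :> R by lra.
have [K2 K20 K2G] := scale_up _ c0.
clear BE scale_up c0.
have A0 : 0 <= expR 5 * K1 by apply: mulr_ge0 => //; exact: expR_ge0.
exists (expR 5 * K1 + K2).
split; first lra.
move=> d T P n F xi eps delta n1 MD ixi /andP[e0 e2] moments dl01 bracket x.
have [s BM] := bernstein_martingale_intro MD ixi e0 moments dl01 bracket.
have /andP[dl0 dl1] := dl01.
set G := (1 + x ^+ 2) * (eps * `|ln eps| + delta / (1 + `|x|)).
have x20 := sqr_ge0 x; have x0 := normr_ge0 x.
have L0 : 0 <= eps * `|ln eps| by rewrite mulr_ge0// ltW.
have d0 : 0 <= delta / (1 + `|x|) by apply: divr_ge0 => //; lra.
have G0 : 0 <= G by rewrite mulr_ge0 ?addr_ge0.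
have E0 := expR_ge0 (- (x_hat eps delta x ^+ 2 / 2)).
have GE : G = (1 + x ^+ 2) * (eps * `|ln eps|) + (1 + x ^+ 2) * (delta / (1 + `|x|)).
  by rewrite /G mulrDr.
have g1 : 0 <= (1 + x ^+ 2) * (eps * `|ln eps|) by rewrite mulr_ge0//; lra.
have g2 : 0 <= (1 + x ^+ 2) * (delta / (1 + `|x|)) by rewrite mulr_ge0//; lra.
rewrite -[_ * (1 + x ^+ 2) * _]mulrA -/G.
have outside : 1 / 3000 <= G -> `|fine (P [set w | mart_sum xi n w <= x]) - std_normal_cdf x|
    <= (expR 5 * K1 + K2) * G * expR (- (x_hat eps delta x ^+ 2 / 2)).
  move=> hG; apply: le_trans (tail_bound x BM) _; rewrite ler_wpM2r//.
  by have := K2G _ hG; have := mulr_ge0 A0 G0; rewrite mulrDl; lra.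
have [r1|r1] := leP ((1 + x ^+ 2) * (eps * `|ln eps|)) (1 / 1500); last by apply: outside; lra.
have [r2|r2] := leP ((1 + `|x|) * delta) (1 / 1500); last first.
  apply: outside; rewrite GE.
  have : (1 + `|x|) * delta <= 2 * ((1 + x ^+ 2) * (delta / (1 + `|x|))).
    have -> : 2 * ((1 + x ^+ 2) * (delta / (1 + `|x|))) = 2 * (1 + x ^+ 2) * delta / (1 + `|x|).
      by rewrite !mulrA.
    rewrite ler_pdivlMr; last lra.
    have -> : (1 + `|x|) * delta * (1 + `|x|) = (1 + `|x|) ^+ 2 * delta by ring.
    rewrite ler_wpM2r// -(real_normK (num_real x)).
    have := sqr_ge0 (1 - `|x|).
    have -> : (1 - `|x|) ^+ 2 = 2 * (1 + `|x| ^+ 2) - (1 + `|x|) ^+ 2 by ring.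
    lra.
  lra.
apply: le_trans (RB _ _ _ _ _ _ _ _ _ _ BM e2 r1 r2) _; rewrite -/G.
have gen (a b g : R) : a * b * (K1 * g) = a * K1 * g * b by ring.
by rewrite gen ler_wpM2r// ler_wpM2r// lerDl ltW.
Qed.
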